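(* Let $N\in\mathbb N$ and let $G\subset O_N^*$ be a half-classical quantum group, i.e. any closed quantum subgroup of $O_N^*$. Then $C(G)$ has an algebraic stationary model with $K=2$: there exist a compact Lie group $H$, endowed with its Haar probability measure, and an injective morphism of $C^*$-algebras $\pi:C(G)\to M_2(C(H))$ such that $$\int_G=\Big(tr\otimes\int_H\Big)\pi.$$
   Context: A compact matrix quantum group $G$ is given by a unital $C^*$-algebra $A=C(G)$, generated by the entries of a unitary matrix $u\in M_N(A)$, such that the formulae $\Delta(u_{ij})=\sum_ku_{ik}\otimes u_{kj}$, $\varepsilon(u_{ij})=\delta_{ij}$, $S(u_{ij})=u_{ji}^*$ define morphisms of $C^*$-algebras $\Delta:A\to A\otimes A$, $\varepsilon:A\to\mathbb C$, $S:A\to A^{opp}$. The functional $\int_G$ is the Haar state of $C(G)$. $C(O_N^+)$ is the universal $C^*$-algebra generated by self-adjoint elements $u_{ij}$ ($1\le i,j\le N$) such that $u=(u_{ij})$ is unitary. $C(O_N^* )$ is the quotient of $C(O_N^+)$ by the half-commutation relations $abc=cba$ for all $a,b,c\in\{u_{ij}\}$. A closed quantum subgroup $G\subset O_N^*$ is a compact matrix quantum group whose algebra $C(G)$ is a quotient of $C(O_N^* )$, by a morphism sending the standard coordinates to the standard coordinates. On $M_2(C(H))$, $tr\otimes\int_H$ denotes $f\mapsto\int_Htr(f(x))\,dx$, with $tr$ the normalized trace on $M_2(\mathbb C)$. *)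

(* Defs.v *)
From HB Require Import structures.
From mathcomp Require Import all_boot all_order all_algebra.
From mathcomp Require Import complex.
From mathcomp Require Import all_classical all_reals all_analysis.

Set Implicit Arguments.
Unset Strict Implicit.
Unset Printing Implicit Defensive.

Import Order.TTheory GRing.Theory Num.Theory.
Import numFieldNormedType.Exports.

Local Open Scope classical_set_scope.
Local Open Scope ring_scope.
Local Open Scope complex_scope.

(* The norm is a field of the structure, and not that of a [normedModType], as
   Hierarchy Builder refuses a new join of the normed modules and the rings,
   which already have [numDomainType] as their join. *)
HB.mixin Record isCStarAlgebra (R : realType) A of GRing.Algebra R[i] A := {
  star : A -> A ;
  starK : involutive star ;
  starD : {morph star : a b / a + b} ;
  starZ : forall (c : R[i]) (a : A), star (c *: a) = c^* *: star a ;
  starM : forall a b : A, star (a * b) = star b * star a ;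
  cnorm : A -> R ;
  cnorm0_eq0 : forall a : A, cnorm a = 0 -> a = 0 ;
  cnormD : forall a b : A, cnorm (a + b) <= cnorm a + cnorm b ;
  cnormZ : forall (c : R[i]) (a : A),
    (cnorm (c *: a))%:C = `|c| * (cnorm a)%:C ;
  cnormM : forall a b : A, cnorm (a * b) <= cnorm a * cnorm b ;
  cnorm_complete : forall x : nat -> A,
    (forall e : R, 0 < e ->
       exists k, forall m n, (k <= m)%N -> (k <= n)%N ->
         cnorm (x m - x n) < e) ->
    exists l, forall e : R, 0 < e ->
       exists k, forall n, (k <= n)%N -> cnorm (x n - l) < e ;
  cnorm_cstar : forall a : A, cnorm (star a * a) = cnorm a ^+ 2
}.

#[short(type="cstarAlgType")]
HB.structure Definition CStarAlgebra (R : realType) :=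
  {A of isCStarAlgebra R A & GRing.Algebra R[i] A}.

Section CStarAlgebras.
Variable R : realType.
Implicit Types A B : cstarAlgType R.

Definition adjmx (T : Type) (s : T -> T) (n : nat) (M : 'M[T]_n) : 'M[T]_n :=
  map_mx s M^T.

(* Unital *-homomorphisms; continuity is automatic. *)
Definition cstar_morphism A B (f : A -> B) : Prop :=
  [/\ linear f, f 1 = 1, {morph f : a b / a * b} & {morph f : a / star a}].

Definition cstar_character A (f : A -> R[i]) : Prop :=
  [/\ scalar f, f 1 = 1, {morph f : a b / a * b}
    & forall a, f (star a) = (f a)^*].

Definition cstar_antimorphism A B (f : A -> B) : Prop :=
  [/\ linear f, f 1 = 1, forall a b, f (a * b) = f b * f a
    & {morph f : a / star a}].

Definition cstar_state A (h : A -> R[i]) : Prop :=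
  [/\ scalar h, forall a, 0 <= h (star a * a) & h 1 = 1].

Definition cclosure A (S : set A) : set A :=
  [set a | forall e : R, 0 < e -> exists2 s, S s & cnorm (a - s) < e].

Definition closed_star_subalgebra A (S : set A) : Prop :=
  [/\ cclosure S `<=` S, S 1,
      forall (c : R[i]) a b, S a -> S b -> S (c *: a + b),
      forall a b, S a -> S b -> S (a * b) & forall a, S a -> S (star a)].

Definition cstar_generated A (X : set A) : Prop :=
  forall S, closed_star_subalgebra S -> X `<=` S -> S = setT.

Definition closed_ideal A (I : set A) : Prop :=
  [/\ cclosure I `<=` I, I 0, forall a b, I a -> I b -> I (a + b)
    & forall a b, I b -> I (a * b) /\ I (b * a)].

(* [p : A -> B] is the quotient of A by the relations r = 0, r in X. *)
Definition cstar_quotient A B (X : set A) (p : A -> B) : Prop :=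
  [/\ cstar_morphism p, forall b, exists a, p a = b
    & forall a, p a = 0 <-> (forall I, closed_ideal I -> X `<=` I -> I a)].

(* [tens] exhibits T as a C*-completion of the algebraic tensor product of A
   and B. No particular C*-norm is singled out. The penultimate clause says
   that only the sums which vanish in the algebraic tensor product are sent to
   zero in T; the last one is density. *)
Definition cstar_tensor_product A B (T : cstarAlgType R)
    (tens : A -> B -> T) : Prop :=
  (forall b, linear (tens ^~ b)) /\ (forall a, linear (tens a)) /\
  tens 1 1 = 1 /\
  (forall a a' b b', tens a b * tens a' b' = tens (a * a') (b * b')) /\
  (forall a b, star (tens a b) = tens (star a) (star b)) /\
  (forall n (a : 'I_n -> A) (b : 'I_n -> B), \sum_k tens (a k) (b k) = 0 ->
     forall (V : lmodType R[i]) (beta : A -> B -> V),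
       (forall y, linear (beta ^~ y)) -> (forall x, linear (beta x)) ->
       \sum_k beta (a k) (b k) = 0) /\
  cclosure [set t : T | exists n (a : 'I_n -> A) (b : 'I_n -> B),
                         t = \sum_k tens (a k) (b k)] = setT.

End CStarAlgebras.

Section QuantumGroups.
Variables (R : realType) (N : nat).

Definition matrix_entries (T : Type) (u : 'M[T]_N) : set T :=
  [set a | exists i j, a = u i j].

Definition unitary_matrix (A : cstarAlgType R) (u : 'M[A]_N) : Prop :=
  u *m adjmx star u = 1%:M /\ adjmx star u *m u = 1%:M.

Record compactMatrixQuantumGroup := CompactMatrixQuantumGroup {
  cqg_alg : cstarAlgType R ;
  fund : 'M[cqg_alg]_N ;
  fund_generates : cstar_generated (matrix_entries fund) ;
  fund_unitary : unitary_matrix fund ;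
  tensor_square : cstarAlgType R ;
  tens : cqg_alg -> cqg_alg -> tensor_square ;
  tensP : cstar_tensor_product tens ;
  comult : cqg_alg -> tensor_square ;
  comult_morphism : cstar_morphism comult ;
  comult_fund : forall i j,
    comult (fund i j) = \sum_k tens (fund i k) (fund k j) ;
  counit : cqg_alg -> R[i] ;
  counit_character : cstar_character counit ;
  counit_fund : forall i j, counit (fund i j) = (i == j)%:R ;
  antipode : cqg_alg -> cqg_alg ;
  antipode_antimorphism : cstar_antimorphism antipode ;
  antipode_fund : forall i j, antipode (fund i j) = star (fund j i)
}.

(* The invariance (h (x) id) Delta = h(.)1 = (id (x) h) Delta is required at
   the elements a such that Delta(a) is in the algebraic tensor product. They
   include the dense *-subalgebra generated by the u_ij, so by continuity this
   is invariance on the whole of C(G), but no slice map has to be defined on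
   the completed tensor product. *)
Definition haar_state (G : compactMatrixQuantumGroup)
    (h : cqg_alg G -> R[i]) : Prop :=
  cstar_state h /\
  forall (a : cqg_alg G) n (b c : 'I_n -> cqg_alg G),
    comult a = \sum_k tens (b k) (c k) ->
    \sum_k h (b k) *: c k = h a *: 1 /\ \sum_k h (c k) *: b k = h a *: 1.

Definition Oplus_relations (A : cstarAlgType R) (u : 'M[A]_N) : Prop :=
  (forall i j, star (u i j) = u i j) /\ unitary_matrix u.

(* (A, u) is C(O_N^+) with its standard coordinates. *)
Definition is_C_Oplus (A : cstarAlgType R) (u : 'M[A]_N) : Prop :=
  [/\ cstar_generated (matrix_entries u), Oplus_relations u
    & forall (B : cstarAlgType R) (v : 'M[B]_N), Oplus_relations v ->
      exists f : A -> B, cstar_morphism f /\ forall i j, f (u i j) = v i j].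

Definition half_commutators (A : cstarAlgType R) (u : 'M[A]_N) : set A :=
  [set x | exists a b c, [/\ matrix_entries u a, matrix_entries u b,
                             matrix_entries u c & x = a * b * c - c * b * a]].

(* (A, u) is C(O_N^* ) with its standard coordinates. *)
Definition is_C_Ostar (A : cstarAlgType R) (u : 'M[A]_N) : Prop :=
  exists (P : cstarAlgType R) (w : 'M[P]_N) (p : P -> A),
    [/\ is_C_Oplus w, cstar_quotient (half_commutators w) p
      & forall i j, p (w i j) = u i j].

Definition closed_subgroup_Ostar (G : compactMatrixQuantumGroup) : Prop :=
  exists (Q : cstarAlgType R) (w : 'M[Q]_N) (q : Q -> cqg_alg G),
    [/\ is_C_Ostar w, cstar_morphism q, forall a, exists x, q x = a
      & forall i j, q (w i j) = fund G i j].

End QuantumGroups.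

HB.mixin Record isTopologicalGroup T
    of monoid.Group T & PointedTopological T := {
  mulg_continuous : continuous (fun xy : T * T => (xy.1 * xy.2)%g) ;
  invg_continuous : continuous (fun x : T => (x^-1)%g)
}.

#[short(type="topologicalGroupType")]
HB.structure Definition TopologicalGroup :=
  {T of isTopologicalGroup T & monoid.Group T & PointedTopological T}.

Section LieGroups.
Variable R : realType.

(* f is of class C^k on the open set U, for V finite-dimensional: iterated
   directional derivatives up to order k exist and are continuous on U. *)
Fixpoint Ck (V W : normedModType R) (k : nat) (U : set V) (f : V -> W) : Prop :=
  (forall x, U x -> {for x, continuous f}) /\
  match k with
  | 0%N => True
  | k'.+1 => forall v, (forall x, U x -> derivable f x v) /\ Ck k' U ('D_v f)
  end.

Definition smooth_on (V W : normedModType R) (U : set V) (f : V -> W) : Prop :=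
  forall k, Ck k U f.

Section Charts.
Variables (H : topologicalType) (d : nat).

(* A chart is given by total functions; only the values of [chart_coord]
   on [chart_dom] and those of its inverse [chart_param] on [chart_img] are relevant. *)
Record chart := Chart {
  chart_dom : set H ;
  chart_coord : H -> 'rV[R]_d ;
  chart_param : 'rV[R]_d -> H
}.

Definition chart_img (c : chart) : set 'rV[R]_d := chart_coord c @` chart_dom c.

Definition is_chart (c : chart) : Prop :=
  [/\ open (chart_dom c), open (chart_img c),
      forall x, chart_dom c x -> {for x, continuous (chart_coord c)},
      forall y, chart_img c y -> {for y, continuous (chart_param c)}
    & forall x, chart_dom c x -> chart_param c (chart_coord c x) = x].

Definition smooth_atlas (Phi : set chart) : Prop :=
  [/\ forall c, Phi c -> is_chart c,
      forall x, exists2 c, Phi c & chart_dom c x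
    & forall c c', Phi c -> Phi c' ->
        smooth_on [set y | chart_img c y /\ chart_dom c' (chart_param c y)]
                  (fun y => chart_coord c' (chart_param c y))].

End Charts.

Definition lie_atlas (H : topologicalGroupType) d (Phi : set (chart H d)) :=
  [/\ smooth_atlas Phi,
      forall c1 c2 c3, Phi c1 -> Phi c2 -> Phi c3 ->
        smooth_on
          [set y : 'rV[R]_d * 'rV[R]_d |
            [/\ chart_img c1 y.1, chart_img c2 y.2
              & chart_dom c3 (chart_param c1 y.1 * chart_param c2 y.2)%g]]
          (fun y => chart_coord c3 (chart_param c1 y.1 * chart_param c2 y.2)%g)
    & forall c1 c2, Phi c1 -> Phi c2 ->
        smooth_on
          [set y | chart_img c1 y /\ chart_dom c2 (chart_param c1 y)^-1%g]
                  (fun y => chart_coord c2 (chart_param c1 y)^-1%g)].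

Definition compact_Lie_group (H : topologicalGroupType) : Prop :=
  [/\ compact [set: H], hausdorff_space H
    & exists (d : nat) (Phi : set (chart H d)), lie_atlas Phi].

Definition borel (H : topologicalGroupType) := g_sigma_algebraType (@open H).

Definition haar_probability (H : topologicalGroupType)
    (mu : probability (borel H) R) : Prop :=
  forall (x : H) (B : set (borel H)), measurable B ->
    mu [set (x * y)%g | y in (B : set H)] = mu B.

End LieGroups.

Section Models.
Variables (R : realType) (H : topologicalGroupType).

Definition CH := continuousType H R[i]^o.

Definition mx_eval (f : 'M[CH]_2) (x : H) : 'M[R[i]]_2 :=
  map_mx (fun g : CH => g x) f.

(* The operations of the C*-algebra M_2(C(H)) are those of M_2(C), at each
   point of H. *)
Definition model_morphism (A : cstarAlgType R) (pi : A -> 'M[CH]_2) : Prop :=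
  forall x : H,
    [/\ linear (fun a => mx_eval (pi a) x), mx_eval (pi 1) x = 1%:M,
        forall a b,
          mx_eval (pi (a * b)) x = mx_eval (pi a) x *m mx_eval (pi b) x
      & forall a, mx_eval (pi (star a)) x = adjmx (@conjc R) (mx_eval (pi a) x)].

Definition normalized_trace (M : 'M[R[i]]_2) : R[i] := 2%:R^-1 * \tr M.

Definition trace_integral (mu : probability (borel H) R)
    (f : 'M[CH]_2) : R[i] :=
  let t (x : borel H) := normalized_trace (mx_eval f x) in
  Rintegral mu setT (fun x => complex.Re (t x))
  +i* Rintegral mu setT (fun x => complex.Im (t x)).

End Models.

(* Main.v *)
From HB Require Import structures.
Require Import Defs.
From mathcomp Require Import all_boot all_order all_algebra.
From mathcomp Require Import complex.
From mathcomp Require Import all_classical all_reals all_analysis.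
From mathcomp Require Import ring lra.

Set Implicit Arguments.
Unset Strict Implicit.
Unset Printing Implicit Defensive.

Import Order.TTheory GRing.Theory Num.Theory.
Import numFieldNormedType.Exports.

Local Open Scope classical_set_scope.
Local Open Scope ring_scope.
Local Open Scope complex_scope.

(** Let A = C(G), with self-adjoint half-commuting coordinates u_ij. The products
    u_ij u_kl commute with each other, and diagonalizing them approximately along
    an ultrafilter shows that the elements of A are separated by characters and by
    the two-dimensional representations u_ij |-> [[0, v_ij], [conj v_ij, 0]], where
    v is a unitary matrix. The convolution of the representations attached to v and
    w is the sum of those attached to v w and v (conj w), and the antipode gives
    the adjoint of v; so the matrices v which occur form a closed subgroup H of
    U_N, as soon as there is one of them. Then v |-> rho_v is an embedding of A in
    M_2(C(H)), because a character o is seen in the representation attached to the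
    matrix o(u) = o(u) v v^*. If there is no v, then A is separated by
    its characters and H is the group of characters, acting diagonally.

    Convolutions have to be bounded for an arbitrary C*-norm on the tensor product.
    This is done by excision: a pure state f has cut-offs F such that F b F is close
    to f(b) F^2, whence |sum f(b_k) g(c_k)| <= |sum b_k (x) c_k|.

    The trace of the convolution formula and the invariance of the measure of H
    under translations show that the trace integral is invariant; conversely an
    invariant state agrees with it on the dense subalgebra of the elements with an
    algebraic coproduct.

    The measure of H is obtained from a limit of normalized covering numbers, by
    Caratheodory's construction. For the Lie group structure, the tangent cone of H
    at 1 is a linear space, the orthogonal projection to it is a coordinate near 1,
    and its inverse g solves D_v g = g . L(g)^-1 v with L(g) depending linearly on
    g, so that g is smooth. *)

(** * Positivity and square roots in C*-algebras *)

(** Two obstacles shape the proof. The coproduct takes values in an arbitrary C*-completion of the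
    algebraic tensor product, and a pair of representations of A does not visibly extend to it; so
    convolutions are first defined on the elements with an algebraic coproduct and then extended by
    an a priori bound. Moreover no Hilbert space is at hand: A acts by left multiplication on
    bounded sequences of A modulo the sequences that are null along the ultrafilter, and a sequence
    on which central elements act by scalars replaces a vector in a fibre. Positivity means being
    the square of a self-adjoint element, with a convergent iteration for square roots, so that
    spectra never appear. The two cases at the end are different in nature: without any v there is
    no group of matrices v, while a single v gives 1 = v v^* by convolution with its adjoint. For
    fixed indices of the second leg, the trace over the first leg of the convolution of v and w is
    one diagonal entry at v w plus the other one at v (conj w); translations of H absorb w and conj
    w separately, and this makes the trace integral invariant. *)

Section FreeAlgebra.
Variables (K : comNzRingType) (A : algType K).

(** Polynomials in noncommuting variables are compared through their expansion into words. The
    coefficients lie in an abstract ring, so words can be merged by computation while coefficients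
    cannot be tested: [nc_null] leaves one scalar equation for each word. *)
Inductive nc_expr :=
| NCvar of nat | NCadd of nc_expr & nc_expr | NCopp of nc_expr
| NCmul of nc_expr & nc_expr | NCscale of K & nc_expr | NCzero | NCone.

Fixpoint nc_eval (s : seq A) (e : nc_expr) : A :=
  match e with
  | NCvar n => nth 0 s n
  | NCadd e f => nc_eval s e + nc_eval s f
  | NCopp e => - nc_eval s e
  | NCmul e f => nc_eval s e * nc_eval s f
  | NCscale c e => c *: nc_eval s e
  | NCzero => 0
  | NCone => 1
  end.

Definition nc_word (s : seq A) (w : seq nat) : A :=
  foldr (fun n a => nth 0 s n * a) 1 w.

Definition nc_sum (s : seq A) (l : seq (K * seq nat)) : A :=
  foldr (fun cw a => cw.1 *: nc_word s cw.2 + a) 0 l.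

Definition nc_times (c : K) (w : seq nat) (l : seq (K * seq nat)) :=
  [seq (c * cw.1, w ++ cw.2) | cw <- l].

Fixpoint nc_norm (e : nc_expr) : seq (K * seq nat) :=
  match e with
  | NCvar n => [:: (1, [:: n])]
  | NCadd e f => nc_norm e ++ nc_norm f
  | NCopp e => nc_times (-1) [::] (nc_norm e)
  | NCmul e f => flatten [seq nc_times cw.1 cw.2 (nc_norm f) | cw <- nc_norm e]
  | NCscale c e => nc_times c [::] (nc_norm e)
  | NCzero => [::]
  | NCone => [:: (1, [::])]
  end.

Fixpoint seqnat_eqb (s t : seq nat) : bool :=
  match s, t with
  | [::], [::] => true
  | x :: s, y :: t => if eqn x y then seqnat_eqb s t else false
  | _, _ => false
  end.

Fixpoint nc_insert (c : K) (w : seq nat) (l : seq (K * seq nat)) :=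
  match l with
  | [::] => [:: (c, w)]
  | (d, v) :: l => if seqnat_eqb w v then (d + c, v) :: l else (d, v) :: nc_insert c w l
  end.

Fixpoint nc_collect (l : seq (K * seq nat)) :=
  match l with
  | [::] => [::]
  | (c, w) :: l => nc_insert c w (nc_collect l)
  end.

Fixpoint nc_null (l : seq (K * seq nat)) : Prop :=
  match l with
  | [::] => True
  | (c, w) :: l => c = 0 /\ nc_null l
  end.

Lemma seqnat_eqbP s t : seqnat_eqb s t -> s = t.
Proof.
elim: s t => [|x s ih] [|y t] //=; case: eqnP => // -> /ih -> //.
Qed.

Lemma nc_sum_cat s l1 l2 : nc_sum s (l1 ++ l2) = nc_sum s l1 + nc_sum s l2.
Proof. by elim: l1 => [|cw l ih] /=; rewrite ?add0r// ih addrA. Qed.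

Lemma nc_word_cat s v w : nc_word s (v ++ w) = nc_word s v * nc_word s w.
Proof. by elim: v => [|n v ih] /=; rewrite ?mul1r// ih mulrA. Qed.

Lemma nc_sum_times s c w l :
  nc_sum s (nc_times c w l) = (c *: nc_word s w) * nc_sum s l.
Proof.
elim: l => [|[d v] l ih] /=; first by rewrite mulr0.
by rewrite ih mulrDr nc_word_cat; congr (_ + _); rewrite -scalerAl -scalerAr scalerA.
Qed.

Lemma nc_normE s e : nc_sum s (nc_norm e) = nc_eval s e.
Proof.
elim: e => [n|e he f hf|e he|e he f hf|c e he||] //=.
- by rewrite scale1r mulr1 addr0.
- by rewrite nc_sum_cat he hf.
- by rewrite nc_sum_times he /= -scalerAl mul1r scaleN1r.
- rewrite -he -hf; elim: (nc_norm e) => [|[c w] l ih] /=; first by rewrite mul0r.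
  by rewrite nc_sum_cat ih nc_sum_times mulrDl.
- by rewrite nc_sum_times he /= -scalerAl mul1r.
- by rewrite scale1r addr0.
Qed.

Lemma nc_collectE s l : nc_sum s (nc_collect l) = nc_sum s l.
Proof.
elim: l => [//|[c w] l ih] /=; rewrite -ih.
elim: (nc_collect l) => [//|[d v] k ihk] /=.
case: ifP => [/seqnat_eqbP ->|_] /=; last by rewrite ihk addrCA.
by rewrite scalerDl -addrA [RHS]addrCA.
Qed.

Lemma nc_eqP s e f :
  nc_null (nc_collect (nc_norm (NCadd e (NCopp f)))) -> nc_eval s e = nc_eval s f.
Proof.
move=> h; apply/subr0_eq; rewrite -[LHS]/(nc_eval s (NCadd e (NCopp f))).
rewrite -nc_normE -nc_collectE; move: h.
by elim: (nc_collect _) => [//|[c w] l ih] /= [-> /ih ->]; rewrite scale0r addr0.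
Qed.

End FreeAlgebra.

Ltac nc_find x s :=
  lazymatch s with
  | x :: _ => constr:(Some O)
  | _ :: ?t => let r := nc_find x t in
      lazymatch r with Some ?n => constr:(Some (S n)) | None => constr:(@None nat) end
  | _ => constr:(@None nat)
  end.

Ltac nc_app s x :=
  lazymatch s with
  | ?y :: ?t => let r := nc_app t x in constr:(y :: r)
  | _ => constr:([:: x])
  end.

Ltac nc_len s := lazymatch s with _ :: ?t => let r := nc_len t in constr:(S r) | _ => constr:(O) end.

Ltac nc_reify K t s k :=
  lazymatch t with
  | (?a + ?b)%R => nc_reify K a s ltac:(fun e s1 => nc_reify K b s1 ltac:(fun f s2 => k constr:(NCadd e f) s2))
  | (- ?a)%R => nc_reify K a s ltac:(fun e s1 => k constr:(NCopp e) s1)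
  | (?a * ?b)%R => nc_reify K a s ltac:(fun e s1 => nc_reify K b s1 ltac:(fun f s2 => k constr:(NCmul e f) s2))
  | (?c *: ?a)%R => nc_reify K a s ltac:(fun e s1 => k constr:(@NCscale K c e) s1)
  | 0%R => k constr:(NCzero K) s
  | 1%R => k constr:(NCone K) s
  | _ => let r := nc_find t s in
      lazymatch r with
      | Some ?n => k constr:(NCvar K n) s
      | None => let n := nc_len s in let s' := nc_app s t in k constr:(NCvar K n) s'
      end
  end.

(* Decides equalities in noncommutative algebras, up to equalities of scalars. *)
Ltac nc_ring K :=
  lazymatch goal with
  | |- @eq ?T ?l ?r =>
    nc_reify K l (@nil T) ltac:(fun e s => nc_reify K r s ltac:(fun f s' =>
      change (nc_eval s' e = nc_eval s' f);
      apply: nc_eqP;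
      cbv beta iota zeta delta [nc_norm nc_times nc_collect nc_insert nc_null
        seqnat_eqb eqn cat map flatten foldr fst snd];
      repeat split; try by ring))
  end.

Section CstarBasics.
Variable R : realType.
Implicit Type A : cstarAlgType R.
Local Notation C := R[i].

Lemma starN A (a : A) : star (- a) = - star a.
Proof. by rewrite -scaleN1r starZ rmorphN rmorph1 scaleN1r. Qed.

Lemma star0 A : star (0 : A) = 0.
Proof. by apply: (@addrI _ (star 0)); rewrite -starD !addr0. Qed.

Lemma starB A (a b : A) : star (a - b) = star a - star b.
Proof. by rewrite starD starN. Qed.

Lemma star1 A : star (1 : A) = 1.
Proof. by have := starM (star 1) (1 : A); rewrite mulr1 starK mulr1 => <-. Qed.

Lemma starZr A (r : R) (a : A) : star (r%:C *: a) = r%:C *: star a.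
Proof. rewrite starZ; congr (_ *: _); exact: conjc_real. Qed.

Lemma star_sum A (I : Type) (s : seq I) (P : pred I) (F : I -> A) :
  star (\sum_(i <- s | P i) F i) = \sum_(i <- s | P i) star (F i).
Proof. exact: (big_morph _ (@starD R A) (star0 A)). Qed.

Lemma cnormZr A (r : R) (a : A) : 0 <= r -> cnorm (r%:C *: a) = r * cnorm a.
Proof.
move=> r0; have := cnormZ r%:C a; rewrite ger0_norm ?ler0c //.
by rewrite -rmorphM => /complexI.
Qed.

Lemma cnorm0 A : cnorm (0 : A) = 0.
Proof. by rewrite -(scale0r (0 : A)) -[0 in LHS](rmorph0 (real_complex R)) cnormZr // mul0r. Qed.

Lemma cnormN A (a : A) : cnorm (- a) = cnorm a.
Proof.
have := cnormZ (-1) a; rewrite scaleN1r normrN1 mul1r.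
by move/complexI.
Qed.

Lemma cnormBC A (a b : A) : cnorm (a - b) = cnorm (b - a).
Proof. by rewrite -cnormN opprB. Qed.

Lemma cnorm_ge0 A (a : A) : 0 <= cnorm a.
Proof.
have := cnormD a (- a); rewrite subrr cnorm0 cnormN -mulr2n.
by rewrite pmulrn_lge0.
Qed.

#[local] Hint Extern 0 (is_true (0 <= cnorm _)) => exact: cnorm_ge0 : core.

Lemma cnormB A (a b : A) : cnorm (a - b) <= cnorm a + cnorm b.
Proof. by rewrite -(cnormN b); exact: cnormD. Qed.

Lemma cnorm_sub A (c a b : A) : cnorm (a - b) <= cnorm (a - c) + cnorm (c - b).
Proof. by rewrite -[in leLHS](subrK c a) -addrA; exact: cnormD. Qed.

Lemma cnorm_sum A (I : Type) (s : seq I) (P : pred I) (F : I -> A) :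
  cnorm (\sum_(i <- s | P i) F i) <= \sum_(i <- s | P i) cnorm (F i).
Proof.
elim/big_ind2 : _ => [|a x b y ha hb|//]; first by rewrite cnorm0.
by rewrite (le_trans (cnormD _ _)) // lerD.
Qed.

Lemma cnorm1 A : cnorm (1 : A) = 1.
Proof.
have := cnorm_cstar (1 : A); rewrite star1 mulr1 expr2 => h.
have n0 : cnorm (1 : A) != 0.
  by apply/eqP => /cnorm0_eq0/eqP; rewrite oner_eq0.
by apply: (mulfI n0); rewrite -h mulr1.
Qed.

Lemma cnorm_star A (a : A) : cnorm (star a) = cnorm a.
Proof.
have le b : cnorm b <= cnorm (star b) :> R.
  have [->|b0] := eqVneq (cnorm b) 0; first exact: cnorm_ge0.
  have bp : 0 < cnorm b by rewrite lt_def b0 cnorm_ge0.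
  by rewrite -(ler_pM2r bp) -expr2 -cnorm_cstar cnormM.
by apply/eqP; rewrite eq_le le andbT -{2}(starK a) le.
Qed.

End CstarBasics.

#[local] Hint Extern 0 (is_true (0 <= cnorm _)) => exact: cnorm_ge0 : core.

Section CstarSqrt.
Variable R : realType.
Implicit Type A : cstarAlgType R.
Local Notation C := R[i].

Lemma cnorm_small A (a : A) : (forall e : R, 0 < e -> cnorm a <= e) -> a = 0.
Proof.
move=> h; apply: cnorm0_eq0; apply/eqP; rewrite eq_le cnorm_ge0 andbT.
by apply/ler_addgt0Pr => e e0; rewrite add0r h.
Qed.

Lemma commrZ A (k : C) (a b : A) : GRing.comm a b -> GRing.comm a (k *: b).
Proof. by rewrite /GRing.comm -scalerAr -scalerAl => ->. Qed.

Let half : C := (2^-1 : R)%:C.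

(** The root is 1 - l, where l is the fixed point of y |-> (z + y^2) / 2. The iterates are
    polynomials in z, hence commute with whatever commutes with z. The same iteration started from z
    = 1 in the reals is increasing and bounded by 1, and dominates both the norms and the increments
    of the iterates; this gives convergence even when z has norm 1. *)
Lemma sqrt_one_minus A (z : A) : cnorm z <= 1 ->
  exists s : A, [/\ s * s = 1 - z, cnorm (1 - s) <= 1,
    star z = z -> star s = s & forall c, GRing.comm c z -> GRing.comm c s].
Proof.
move=> z1.
have [y [y0 yS]] : exists y : nat -> A,
    y 0%N = 0 /\ forall n, y n.+1 = half *: (z + y n * y n).
  by exists (fix y n := if n is k.+1 then half *: (z + y k * y k) else 0).
have [s [s0 sS]] : exists s : nat -> R,
    s 0%N = 0 /\ forall n, s n.+1 = 2^-1 * (1 + s n ^+ 2).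
  by exists (fix s n := if n is k.+1 then 2^-1 * (1 + s k ^+ 2) else 0).
have yc c : GRing.comm c z -> forall n, GRing.comm c (y n).
  move=> cz; elim=> [|n ih]; first by rewrite /GRing.comm y0 mulr0 mul0r.
  rewrite yS; apply: commrZ; apply: commrD => //; exact: commrM.
have s01 n : 0 <= s n <= 1.
  elim: n => [|n /andP[h0 h1]]; first by rewrite s0 lexx ler01.
  rewrite sS; apply/andP; split; nra.
have sinc n : s n <= s n.+1 by rewrite sS; have := s01 n; nra.
have smono m n : (m <= n)%N -> s m <= s n.
  move=> /subnK <-; elim: (n - m)%N => // k; rewrite addSn => ih.
  exact: le_trans ih (sinc _).
have ys n : cnorm (y n) <= s n.
  elim: n => [|n ih]; first by rewrite y0 s0 cnorm0.
  rewrite yS sS cnormZr ?invr_ge0// ler_wpM2l ?invr_ge0//.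
  rewrite (le_trans (cnormD _ _))// lerD// (le_trans (cnormM _ _))//.
  by rewrite expr2 ler_pM.
have yself n : star z = z -> star (y n) = y n.
  move=> hz; elim: n => [|n ih]; first by rewrite y0 star0.
  by rewrite yS starZr starD starM ih hz.
have yd n : cnorm (y n.+1 - y n) <= s n.+1 - s n.
  elim: n => [|n ih].
    rewrite yS sS y0 s0 subr0 mul0r addr0 expr0n /= addr0 subr0.
    by rewrite cnormZr ?invr_ge0// ler_wpM2l ?invr_ge0.
  have -> : y n.+2 - y n.+1 = half *: ((y n.+1 - y n) * (y n.+1 + y n)).
    rewrite (yS n.+1) [X in _ - X = _]yS -scalerBr; congr (_ *: _).
    have cy : y n.+1 * y n = y n * y n.+1.
      exact: (yc _ (commr_sym (yc _ (commr_refl z) _)) _).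
    by rewrite mulrDr !mulrBl cy opprD addrACA subrr add0r addrA subrK.
  rewrite cnormZr ?invr_ge0//.
  rewrite (@le_trans _ _ (2^-1 * ((s n.+1 - s n) * (s n.+1 + s n)))) //.
    rewrite ler_wpM2l ?invr_ge0// (le_trans (cnormM _ _))// ler_pM//.
    by rewrite (le_trans (cnormD _ _))// lerD.
  by rewrite (sS n.+1) [X in _ <= _ - X]sS; lra.
have ymn m n : (m <= n)%N -> cnorm (y n - y m) <= s n - s m.
  move=> /subnK <-; elim: (n - m)%N => [|k ih]; first by rewrite !subrr cnorm0.
  rewrite addSn (le_trans (cnorm_sub (y (k + m)%N) _ _))//.
  have := yd (k + m)%N; lra.
have [k sk] : exists S : R, (forall n, s n <= S) /\ forall e, 0 < e -> exists k, S - e < s k.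
  pose E := [set s n | n in setT].
  have sE : has_sup E.
    split; first by exists (s 0%N), 0%N.
    by exists 1 => _ [n _ <-]; have /andP[] := s01 n.
  exists (sup E); split; first by move=> n; apply: ub_le_sup; [case: sE|exists n].
  by move=> e e0; have [_ [n _ <-] h] := sup_adherent e0 sE; exists n.
case: sk => sS' sk.
have [l hl] : exists l, forall e : R, 0 < e ->
       exists k, forall n, (k <= n)%N -> cnorm (y n - l) < e.
  apply: cnorm_complete => e e0; have [k0 hk0] := sk _ e0.
  exists k0 => m n km kn.
  wlog mn : m n km kn / (n <= m)%N => [h|].
    by case/orP: (leq_total n m) => ?; [|rewrite cnormBC]; apply: h.
  rewrite (le_lt_trans (ymn _ _ mn))//.
  have := smono _ _ kn; have := sS' m; lra.
have l1 : cnorm l <= 1.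
  apply/ler_addgt0Pr => e e0; have [k0 h] := hl _ e0.
  have := h _ (leqnn _); rewrite cnormBC => /ltW h'.
  have := ys k0; have /andP[_] := s01 k0; have := cnorm_sub (y k0) l 0.
  rewrite !subr0; lra.
have leq : l = half *: (z + l * l).
  apply/subr0_eq/cnorm_small => e e0.
  have e40 : 0 < e / 4 by rewrite divr_gt0.
  have [k0 h] := hl _ e40.
  have h1 := ltW (h _ (leqnSn k0)); have h0 := ltW (h _ (leqnn k0)).
  rewrite (le_trans (cnorm_sub (y k0.+1) _ _))//.
  rewrite yS in h1 *; rewrite cnormBC.
  rewrite -scalerBr opprD addrACA subrr add0r.
  have -> : y k0 * y k0 - l * l = y k0 * (y k0 - l) + (y k0 - l) * l.
    by rewrite mulrBr mulrBl addrA subrK.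
  have : cnorm (half *: (y k0 * (y k0 - l) + (y k0 - l) * l)) <= e / 2.
    rewrite cnormZr ?invr_ge0//.
    have : cnorm (y k0 * (y k0 - l) + (y k0 - l) * l) <= e / 4 + e / 4.
      rewrite (le_trans (cnormD _ _))// lerD// (le_trans (cnormM _ _))//.
        rewrite -[leRHS]mul1r ler_pM//; have /andP[_] := s01 k0; exact: le_trans.
      by rewrite -[leRHS]mulr1 ler_pM.
    lra.
  lra.
exists (1 - l); split.
- have l2 : l + l = z + l * l.
    rewrite [in LHS]leq -scalerDl -rmorphD /=.
    have -> : (2^-1 : R) + 2^-1 = 1 by lra.
    by rewrite rmorph1 scale1r.
  rewrite mulrBl mul1r mulrBr mulr1 opprB [l * l - l]addrC addrA.
  rewrite -[_ - l - l]addrA -opprD l2 opprD addrA.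
  by rewrite addrNK.
- by rewrite opprB addrC subrK.
- move=> hz; rewrite starB star1; congr (1 - _).
  apply/subr0_eq/cnorm_small => e e0.
  have e40 : 0 < e / 2 by rewrite divr_gt0.
  have [k0 h] := hl _ e40; have h0 := ltW (h _ (leqnn k0)).
  rewrite (le_trans (cnorm_sub (y k0) _ _))// -{1}(yself k0 hz) -starB cnorm_star.
  rewrite cnormBC; lra.
move=> c cz; apply: commrB; first exact: commr1.
apply/subr0_eq/cnorm_small => e e0.
pose M := cnorm c + 1; have M0 : 0 < M by rewrite /M ltr_wpDl.
have e40 : 0 < e / 2 / M by rewrite !divr_gt0.
have [k0 h] := hl _ e40; have h0 := ltW (h _ (leqnn k0)).
have -> : c * l - l * c = (y k0 - l) * c - c * (y k0 - l).
  by rewrite mulrBl -(yc _ cz k0); nc_ring (R[i]).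
have cM : cnorm c <= M by rewrite /M lerDl.
rewrite (le_trans (cnormB _ _))// [leRHS](_ : e = (e / 2 / M) * M + M * (e / 2 / M)).
  by rewrite lerD// (le_trans (cnormM _ _))// ler_pM.
by rewrite [M * _]mulrC divfK ?gt_eqF//; lra.
Qed.

End CstarSqrt.

Section CstarPositive.
Variable R : realType.
Implicit Type A : cstarAlgType R.
Local Notation C := R[i].

Lemma starZc A (c : C) (a : A) : star (c *: a) = conjc c *: star a.
Proof. exact: starZ. Qed.

Lemma cnormZVr A (r : R) (a : A) : 0 < r -> cnorm (r^-1%:C *: a) = r^-1 * cnorm a.
Proof. by move=> r0; rewrite cnormZr// invr_ge0 ltW. Qed.

Definition cpos A (x : A) : Prop := exists2 s, star s = s & x = s * s.

Lemma cpos_sa A (x : A) : cpos x -> star x = x.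
Proof. by case=> s hs ->; rewrite starM hs. Qed.

Lemma cpos_sq A (s : A) : star s = s -> cpos (s * s).
Proof. by move=> hs; exists s. Qed.

Lemma cpos1 A : cpos (1 : A).
Proof. by exists 1; rewrite ?star1 ?mulr1. Qed.

Lemma cposZ A (r : R) (x : A) : 0 <= r -> cpos x -> cpos (r%:C *: x).
Proof.
move=> r0 [s hs ->]; exists ((Num.sqrt r)%:C *: s); first by rewrite starZr hs.
by rewrite -scalerAl -scalerAr scalerA -rmorphM -[Num.sqrt r * _]expr2 sqr_sqrtr.
Qed.

Lemma cpos_scal A (r : R) : 0 <= r -> cpos (r%:C *: (1 : A)).
Proof. by move=> r0; apply: cposZ => //; exact: cpos1. Qed.

Lemma cpos0 A : cpos (0 : A).
Proof. by have := cpos_scal A (lexx 0); rewrite scale0r. Qed.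

Lemma scaleKr A (r : R) (x : A) : 0 < r -> r%:C *: (r^-1%:C *: x) = x.
Proof. by move=> r0; rewrite scalerA -rmorphM /= divff ?gt_eqF// scale1r. Qed.

Lemma cnorm_unitary A (v : A) : star v * v = 1 -> cnorm v <= 1.
Proof.
move=> h; have := cnorm_cstar v; rewrite h cnorm1 => h1.
by rewrite -(@ler_pXn2r _ 2) ?nnegrE// expr1n -h1.
Qed.

Let ci : C := Complex 0 1.

Let conj_ci : conjc ci = - ci.
Proof. by apply/eqP; rewrite eq_complex /= oppr0 !eqxx. Qed.

Let mul_ci : ci * ci = -1.
Proof. by apply/eqP; rewrite eq_complex /= !mul0r !mulr0 mul1r !addr0 add0r oppr0 !eqxx. Qed.

Let norm_ci : `|ci| = 1.
Proof. by rewrite normc_def /= expr0n expr1n add0r sqrtr1. Qed.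

Lemma cnorm_cos_sin A (a s : A) : star a = a -> star s = s ->
  GRing.comm a s -> a * a + s * s = 1 -> cnorm s <= 1.
Proof.
move=> ha hs hc h1.
pose v := a + ci *: s.
have hv : star v = a - ci *: s.
  by rewrite starD starZc ha hs conj_ci scaleNr.
have : cnorm v <= 1.
  apply: cnorm_unitary; rewrite hv -h1 /v mulrBl !mulrDr.
  rewrite -!scalerAl -!scalerAr scalerA mul_ci scaleN1r hc opprD opprK.
  by nc_ring (R[i]).
have -> : s = (- ci / 2%:R) *: (v - star v).
  have -> : v - star v = (ci * 2%:R) *: s by rewrite hv /v; nc_ring (R[i]).
  rewrite scalerA mulrACA mulNr mul_ci opprK mulVf ?pnatr_eq0// mulr1.
  by rewrite scale1r.
move=> v1; rewrite -lecR cnormZ normrM normrN normfV normr_nat.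
rewrite norm_ci.
have -> : (1 / 2%:R : C) = (2^-1 : R)%:C by rewrite rmorphV ?unitfE// rmorph_nat mul1r.
rewrite -rmorphM lecR; have := cnormB v (star v); rewrite cnorm_star; lra.
Qed.

Lemma one_minus_sq A (a : A) : star a = a -> cnorm a <= 1 ->
  cnorm (1 - a * a) <= 1.
Proof.
move=> ha a1.
have a2 : cnorm (a * a) <= 1.
  by rewrite (le_trans (cnormM _ _))// mulr_ile1.
have [s [ss _ hs sc]] := sqrt_one_minus a2.
have saa : star (a * a) = a * a by rewrite starM ha.
have s1 : cnorm s <= 1.
  apply: (cnorm_cos_sin ha (hs saa)).
    by apply: sc; rewrite /GRing.comm mulrA.
  by rewrite ss addrC subrK.
by rewrite -ss (le_trans (cnormM _ _))// mulr_ile1.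
Qed.

Lemma near1_root A (y : A) : star y = y -> cnorm (1 - y) <= 1 ->
  exists s, [/\ star s = s, s * s = y, cnorm (1 - s) <= 1
              & forall c, GRing.comm c y -> GRing.comm c s].
Proof.
move=> hy y1; have [s [ss s1 hs sc]] := sqrt_one_minus y1.
exists s; split => //.
- by apply: hs; rewrite starB star1 hy.
- by rewrite ss opprB addrC subrK.
- by move=> c cy; apply: sc; apply: commrB => //; exact: commr1.
Qed.

Lemma near1_cpos A (y : A) : star y = y -> cnorm (1 - y) <= 1 -> cpos y.
Proof. by move=> hy /(near1_root hy)[s [hs <- _ _]]; exact: cpos_sq. Qed.

(** Together with [near1_cpos], this describes the positive elements of norm at most r by membership
    in a ball, which is a convex condition. The stability of positivity under sums, [cposD], comes
    from there. *)
Lemma cpos_near1 A (x : A) (r : R) : cpos x -> 0 < r -> cnorm x <= r ->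
  cnorm (1 - r^-1%:C *: x) <= 1.
Proof.
move=> [s hs ->] r0 sr.
have -> : r^-1%:C *: (s * s) =
    ((Num.sqrt r)^-1%:C *: s) * ((Num.sqrt r)^-1%:C *: s).
  rewrite -scalerAl -scalerAr scalerA -rmorphM -invfM.
  by rewrite -[Num.sqrt r * _]expr2 sqr_sqrtr// ltW.
apply: one_minus_sq; first by rewrite starZr hs.
have q0 : 0 < Num.sqrt r by rewrite sqrtr_gt0.
rewrite cnormZVr// ler_pdivrMl// mulr1.
rewrite -(@ler_pXn2r _ 2) ?nnegrE ?sqrtr_ge0// (sqr_sqrtr (ltW r0)).
by rewrite -cnorm_cstar hs.
Qed.

Lemma cpos_root A (x : A) : cpos x ->
  exists s, [/\ cpos s, s * s = x & forall c, GRing.comm c x -> GRing.comm c s].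
Proof.
move=> px; have hx := cpos_sa px.
pose r := cnorm x + 1; have r0 : 0 < r by rewrite ltr_wpDl.
have xr : cnorm x <= r by rewrite lerDl.
have /near1_root[|s [hs ss s1 sc]] := cpos_near1 px r0 xr.
  by rewrite starZr hx.
exists ((Num.sqrt r)%:C *: s); split.
- by apply: cposZ; [exact: sqrtr_ge0|exact: near1_cpos].
- rewrite -scalerAl -scalerAr scalerA -rmorphM -[Num.sqrt r * _]expr2.
  by rewrite sqr_sqrtr ?ltW// ss scaleKr.
- by move=> c cx; apply: commrZ; apply: sc; exact: commrZ.
Qed.

Lemma cposD A (x y : A) : cpos x -> cpos y -> cpos (x + y).
Proof.
move=> px py.
pose r := cnorm x + cnorm y + 1.
have r0 : 0 < r by rewrite ltr_wpDl// addr_ge0.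
have xr : cnorm x <= r by rewrite /r -addrA lerDl addr_ge0.
have yr : cnorm y <= r by rewrite /r addrAC lerDr addr_ge0.
have h1 := cpos_near1 px r0 xr; have h2 := cpos_near1 py r0 yr.
have h3 : cpos ((2^-1)%:C *: (r^-1%:C *: x + r^-1%:C *: y)).
  apply: near1_cpos.
    by rewrite starZr starD !starZr (cpos_sa px) (cpos_sa py).
  have -> : 1 - (2^-1)%:C *: (r^-1%:C *: x + r^-1%:C *: y) =
     (2^-1)%:C *: ((1 - r^-1%:C *: x) + (1 - r^-1%:C *: y)).
    rewrite addrACA -opprD scalerBr; congr (_ - _).
    rewrite -[1 + 1](scaler_nat 2 (1 : A)) scalerA -(rmorph_nat (real_complex R)).
    by rewrite -rmorphM /= mulVf ?pnatr_eq0// scale1r.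
  rewrite cnormZr ?invr_ge0//.
  have := cnormD (1 - r^-1%:C *: x) (1 - r^-1%:C *: y); lra.
have -> : x + y = (2 * r)%:C *: ((2^-1)%:C *: (r^-1%:C *: x + r^-1%:C *: y)).
  rewrite -scalerDr [RHS]scalerA -rmorphM mulrAC divff ?pnatr_eq0// mul1r.
  by rewrite scaleKr.
by apply: cposZ => //; rewrite mulr_ge0 ?ltW.
Qed.

Lemma cnorm_leP A (x : A) (r : R) : star x = x -> cnorm x <= r -> cpos (r%:C *: 1 - x).
Proof.
move=> hx xr.
have : 0 <= r by rewrite (le_trans _ xr).
rewrite le_eqVlt => /orP[/eqP r0|r0].
  have -> : x = 0 by apply: cnorm0_eq0; apply/eqP; rewrite eq_le cnorm_ge0 r0 xr.
  by rewrite -r0 scale0r subrr; exact: cpos0.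
have -> : r%:C *: 1 - x = r%:C *: (1 - r^-1%:C *: x).
  by rewrite scalerBr scaleKr.
apply: cposZ; first exact: ltW.
apply: near1_cpos; first by rewrite starB star1 starZr hx.
rewrite opprB addrC subrK cnormZVr//.
by rewrite ler_pdivrMl// mulr1.
Qed.

(** The roots of x and 1 - x commute and their squares add up to 1, so they are a sine and a
    cosine. *)
Lemma cpos_le1 A (x : A) : cpos x -> cpos (1 - x) -> cnorm x <= 1.
Proof.
move=> px p1; have [d [pd dd dc]] := cpos_root px.
have [e [pe ee ec]] := cpos_root p1.
have hd := cpos_sa pd; have he := cpos_sa pe.
have : cnorm d <= 1.
  apply: (@cnorm_cos_sin _ e d) => //; last by rewrite ee dd subrK.
  apply: dc; apply: commr_sym; apply: ec; apply: commrB; [exact: commr1|].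
  exact: commr_refl.
move=> d1; rewrite -dd (le_trans (cnormM _ _))// mulr_ile1//.
Qed.

Lemma scale1_inv A (r : R) (x : A) : 0 < r -> r^-1%:C *: (r%:C *: 1 - x) = 1 - r^-1%:C *: x.
Proof.
by move=> r0; rewrite scalerBr scalerA -rmorphM /= mulVf ?gt_eqF// scale1r.
Qed.

Lemma cpos_le A (x : A) (r : R) : 0 <= r -> cpos x -> cpos (r%:C *: 1 - x) -> cnorm x <= r.
Proof.
move=> r0 px pr; apply/ler_addgt0Pr => e e0.
have t0 : 0 < r + e by rewrite ltr_wpDl.
have := @cpos_le1 _ ((r + e)^-1%:C *: x).
rewrite cnormZVr// ler_pdivrMl// mulr1; apply.
  by apply: cposZ; rewrite // invr_ge0 ltW.
rewrite -scale1_inv//; apply: cposZ; first by rewrite invr_ge0 ltW.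
rewrite rmorphD scalerDl addrAC; apply: cposD => //; apply: cpos_scal; exact: ltW.
Qed.

Lemma cnorm_mono A (x y : A) : cpos x -> cpos (y - x) -> cnorm x <= cnorm y.
Proof.
move=> px pyx; apply: cpos_le => //.
have py : cpos y by have := cposD px pyx; rewrite addrC subrK.
have := cposD (cnorm_leP (cpos_sa py) (lexx _)) pyx.
by rewrite addrA subrK.
Qed.

Lemma cpos_anti A (x : A) : cpos x -> cpos (- x) -> x = 0.
Proof.
move=> px pn; apply: cnorm0_eq0; apply/eqP; rewrite eq_le cnorm_ge0 andbT.
by apply: cpos_le => //; rewrite scale0r add0r.
Qed.

Lemma cposM A (x y : A) : cpos x -> cpos y -> GRing.comm x y -> cpos (x * y).
Proof.
move=> px py cxy; have [d [pd dd dc]] := cpos_root px.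
have [e [pe ee ec]] := cpos_root py.
have hd := cpos_sa pd; have he := cpos_sa pe.
have cde : GRing.comm d e by apply: ec; apply: commr_sym; apply: dc; exact: commr_sym.
exists (d * e); first by rewrite starM hd he cde.
by rewrite -dd -ee !mulrA -(mulrA d e d) -cde !mulrA.
Qed.

Lemma sa_sq_eq0 A (x : A) : star x = x -> x * x = 0 -> x = 0.
Proof.
move=> hx x0; apply: cnorm0_eq0; apply/eqP.
by rewrite -(sqrf_eq0 (cnorm x)) -cnorm_cstar hx x0 cnorm0.
Qed.

(** As p n = 0, the cube of p is p (p + n) p, and a root r of p + n that commutes with p turns it
    into the square of r p. The positivity of p itself is not yet known at this stage. *)
Let cube_pos A (p n : A) : star p = p -> GRing.comm p n -> p * n = 0 ->
  cpos (p + n) -> exists r, [/\ star r = r, GRing.comm p r,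
    forall c, GRing.comm c p -> GRing.comm c n -> GRing.comm c r
    & p * p * p = (r * p) * (r * p)].
Proof.
move=> hp cpn pn /cpos_root[r [pr rr rc]].
have cpr : GRing.comm p r by apply: rc; apply: commrD => //; exact: commr_refl.
exists r; split=> //; first exact: cpos_sa.
  by move=> c cp cn; apply: rc; exact: commrD.
by rewrite !mulrA -(mulrA r p r) cpr mulrA rr mulrDl -cpn pn addr0.
Qed.

Let half_parts A (x : A) : star x = x -> exists p n : A,
  [/\ x = p - n, star p = p /\ star n = n, p * n = 0 /\ n * p = 0, cpos (p + n)
    & forall c, GRing.comm c x -> GRing.comm c p /\ GRing.comm c n].
Proof.
move=> hx; have [m [pm mm mc]] := cpos_root (cpos_sq hx).
have hm := cpos_sa pm.
have cm c : GRing.comm c x -> GRing.comm c m.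
  by move=> cx; apply: mc; apply: commrM.
have cxm : x * m = m * x by apply: cm; exact: commr_refl.
pose k : C := (2^-1)%:C.
have kk : k + k = 1 by rewrite /k -rmorphD -(rmorph1 (real_complex R)); congr (_ %:C); lra.
exists (k *: (m + x)), (k *: (m - x)); split.
- by rewrite -[LHS]scale1r -kk; nc_ring (R[i]).
- by rewrite !starZr starD starB hm hx.
- rewrite -!scalerAl -!scalerAr !mulrDl !mulrDr !mulNr !mulrN mm cxm.
  by split; nc_ring (R[i]).
- by rewrite -scalerDr addrACA subrr addr0 scalerDr -scalerDl kk scale1r.
by move=> c cx; split; apply: commrZ; [apply: commrD|apply: commrB] => //; apply: cm.
Qed.

(** Decompose p once more, as p' - n'. Then n'^2 p^3 = - n'^5; the left side is the square of n' r p
    by [cube_pos], and n'^5 is positive because n'^3 is a square. So n'^5 and its opposite are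
    positive, n' vanishes, and p = p' + n'. *)
Let part_pos A (p n : A) : star p = p -> GRing.comm p n -> p * n = 0 ->
  cpos (p + n) -> cpos p.
Proof.
move=> hp cpn pn ppn.
have [r [hr cpr cr r3]] := cube_pos hp cpn pn ppn.
have [p' [n' [pE [hp' hn'] [pn' np'] ppn' pc]]] := half_parts hp.
have [_ cpn'] := pc p (commr_refl p).
have [_ cnn'] := pc n (commr_sym cpn).
have cnr' : GRing.comm n' r by apply: cr; apply: commr_sym.
have e1 : n' * p = - (n' * n') by rewrite pE mulrBr np' sub0r.
have e5 : n' * n' * (p * p * p) = - (n' * n' * n' * n' * n').
  have e2 z : z * n' * p = - (z * n' * n') by rewrite -mulrA e1 mulrN mulrA.
  by rewrite !mulrA !(e2, mulNr) !opprK.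
have n0 : n' * n' * n' * n' * n' = 0.
  apply: cpos_anti; last first.
    rewrite -e5 r3; exists (n' * (r * p)).
      rewrite starM starM hn' hr hp -cpr; apply: commr_sym.
      by apply: commrM => //; rewrite /GRing.comm -cpn'.
    have c1 : n' * (r * p) = (r * p) * n'.
      by apply: commrM => //; rewrite /GRing.comm -cpn'.
    by rewrite -[RHS]mulrA [X in _ = n' * X]mulrA -c1 !mulrA.
  have cnp' : GRing.comm n' p' by rewrite /GRing.comm np' pn'.
  rewrite addrC in ppn'.
  have [r' [hr' cpr' _ r3']] := cube_pos hn' cnp' np' ppn'.
  rewrite (_ : _ * n' = n' * (n' * n' * n') * n'); last by rewrite !mulrA.
  rewrite r3'; exists (n' * r' * n').
    by rewrite !starM hn' hr' mulrA.
  by rewrite -{2}cpr' !mulrA.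
have n'0 : n' = 0.
  apply: sa_sq_eq0 => //; apply: sa_sq_eq0; first by rewrite starM hn'.
  apply: sa_sq_eq0; first by rewrite !starM hn' !mulrA.
  by rewrite !mulrA n0 !mul0r.
by rewrite pE n'0 subr0 -[p']addr0 -n'0.
Qed.

Lemma pos_neg_parts A (x : A) : star x = x -> exists p n : A,
  [/\ x = p - n, cpos p /\ cpos n, p * n = 0 /\ n * p = 0, cpos (p + n)
    & forall c, GRing.comm c x -> GRing.comm c p /\ GRing.comm c n].
Proof.
move=> hx; have [p [n [xE [hp hn] [pn np] ppn xc]]] := half_parts hx.
exists p, n; split => //; split.
  by apply: (part_pos hp _ pn) => //; rewrite /GRing.comm pn np.
by apply: (part_pos hn _ np); rewrite /GRing.comm ?pn ?np// addrC.
Qed.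

Let complex_parts A (d : A) : exists a b : A,
  [/\ star a = a, star b = b & star d * d + d * star d = 2%:R *: (a * a + b * b)].
Proof.
pose k : C := (2^-1)%:C.
have k2 : 2%:R * k = 1 by rewrite /k -(rmorph_nat (real_complex R)) -rmorphM /= divff ?pnatr_eq0.
exists (k *: (d + star d)), (k *: (ci *: (d - star d))); split.
- by rewrite starZr starD starK addrC.
- by rewrite starZr starZc starB starK conj_ci scaleNr -scalerN opprB.
by nc_ring (R[i]); apply/eqP; rewrite eq_complex /=; apply/andP; split; apply/eqP; lra.
Qed.

(** Kaplansky's argument. If n is the negative part of c^* c and d = c n, then d^* d = - n^3,
    whereas d d^* is positive because d^* d + d d^* is twice a sum of squares of self-adjoint
    elements. This forces d = 0, hence n^3 = 0 and n = 0. *)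
Lemma cpos_star A (c : A) : cpos (star c * c).
Proof.
have hx : star (star c * c) = star c * c by rewrite starM starK.
have [p [n [xE [pp pn] [pn0 np0] _ _]]] := pos_neg_parts hx.
have hn := cpos_sa pn.
pose d := c * n.
have [r [pr rr rc]] := cpos_root pn.
have crn : GRing.comm n r by apply: rc; exact: commr_refl.
have dd : star d * d = - (n * n * n).
  by rewrite /d starM hn mulrA -(mulrA n (star c)) xE mulrBr np0 sub0r mulNr.
have pn3 : cpos (n * n * n).
  exists (r * n); first by rewrite starM hn (cpos_sa pr) crn.
  by rewrite -[RHS]mulrA (mulrA n) crn mulrA mulrA rr.
have pdd : cpos (d * star d).
  have [a [b [ha hb e]]] := complex_parts d.
  have -> : d * star d = 2%:R *: (a * a + b * b) + n * n * n.
    by rewrite -e dd addrAC addNr add0r.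
  apply: cposD => //; rewrite -(rmorph_nat (real_complex R)); apply: cposZ => //.
  by apply: cposD; exact: cpos_sq.
(* Instead of comparing the spectra of d^* d and d d^*, normalize d to f and put Y = f f^*. As - f^*
   f is positive of norm at most 1, Y + Y^2 = f (1 + f^* f) f^* has norm at most 1. But Y - Y^2 is
   positive, so Y + Y^2 dominates 2 Y^2, whose norm is 2. *)
have d0 : d = 0.
  apply: cnorm0_eq0; apply/eqP/negPn/negP => dn0.
  have dp : 0 < cnorm d by rewrite lt_def dn0 cnorm_ge0.
  pose t := (cnorm d)^-1; pose f := t%:C *: d.
  have t0 : 0 <= t by rewrite invr_ge0.
  have f1 : cnorm f = 1 by rewrite cnormZr// mulVf.
  have tt0 : 0 <= t * t by rewrite mulr_ge0.
  have pf : cpos (f * star f).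
    rewrite /f starZr -scalerAl -scalerAr scalerA -rmorphM; exact: cposZ.
  have nf : cpos (- (star f * f)).
    rewrite /f starZr -scalerAl -scalerAr scalerA -rmorphM -scalerN dd opprK.
    exact: cposZ.
  pose Y := f * star f.
  have Y1 : cnorm Y <= 1 by rewrite (le_trans (cnormM _ _))// cnorm_star f1 mulr1.
  have hY : star Y = Y by rewrite starM starK.
  have W1 : cnorm (- (star f * f)) <= 1.
    by rewrite cnormN cnorm_cstar f1 expr1n.
  have h1 : cnorm (Y + Y * Y) <= 1.
    have -> : Y + Y * Y = f * (1 - - (star f * f)) * star f.
      by rewrite opprK mulrDr mulr1 mulrDl /Y !mulrA.
    have := cpos_near1 nf ltr01 W1; rewrite invr1 scale1r => h.
    rewrite (le_trans (cnormM _ _))// cnorm_star f1 mulr1.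
    by rewrite (le_trans (cnormM _ _))// f1 mul1r.
  have h2 : cpos (Y - Y * Y).
    have -> : Y - Y * Y = Y * (1 - Y) by rewrite mulrBr mulr1.
    apply: cposM => //.
      by have := cnorm_leP hY Y1; rewrite scale1r.
    by apply: commrB; [exact: commr1|exact: commr_refl].
  have h3 : cnorm (2%:C *: (Y * Y)) <= cnorm (Y + Y * Y).
    apply: cnorm_mono; first by apply: cposZ => //; exact: cpos_sq.
    have -> // : Y + Y * Y - 2%:C *: (Y * Y) = Y - Y * Y.
    by nc_ring (R[i]); apply/eqP; rewrite eq_complex /=; apply/andP; split; apply/eqP; lra.
  have h4 : cnorm (Y * Y) = 1.
    have e : Y = star (star f) * star f by rewrite starK.
    have -> : cnorm (Y * Y) = cnorm Y ^+ 2 by rewrite -cnorm_cstar hY.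
    by rewrite e cnorm_cstar cnorm_star f1 !expr1n.
  move: h3; rewrite cnormZr// h4; lra.
have n3 : n * n * n = 0 by rewrite -[LHS]opprK -dd d0 mulr0 oppr0.
have n0 : n = 0.
  apply: sa_sq_eq0 => //; apply: sa_sq_eq0; first by rewrite starM hn.
  by rewrite mulrA n3 mul0r.
by rewrite xE n0 subr0.
Qed.

Lemma cpos_congr A (c x : A) : cpos x -> cpos (star c * x * c).
Proof.
case=> s hs ->; have -> : star c * (s * s) * c = star (s * c) * (s * c).
  by rewrite starM hs !mulrA.
exact: cpos_star.
Qed.

End CstarPositive.

(** * Ultralimits and states *)

Section UltraLimits.
Variables (R : realType) (T : Type) (F : set_system T).
Hypothesis FU : UltraFilter F.

Lemma ultra_fmap (S : Type) (f : T -> S) : UltraFilter (f @ F).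
Proof.
split=> [|G GF FG]; first exact: fmap_proper_filter.
apply/seteqP; split=> // P GP.
have [//|FnP] := in_ultra_setVsetC (f @^-1` P) FU.
have GnP : G (~` P) by exact: FG.
by have [x []] := filter_ex (filterI GP GnP).
Qed.

Lemma bounded_ultralimit (u : T -> R) (M : R) : (forall n, `|u n| <= M) ->
  exists l, forall e : R, 0 < e -> F [set n | `|u n - l| < e].
Proof.
move=> uM.
have := @segment_compact R (- M) M; rewrite compact_ultra.
have UF := ultra_fmap u.
move=> /(_ (u @ F) UF)[].
  by apply: (@filterE T F) => n; rewrite /= in_itv /= -ler_norml.
move=> l [_ ul]; exists l => e e0.
have /= := ul _ (nbhsx_ballx l e e0).
move=> h; have : F (u @^-1` ball l e) by exact: h.
by apply: filterS => n; rewrite /= distrC.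
Qed.

End UltraLimits.

Section ComplexNorm.
Variable R : realType.
Local Notation C := R[i].
Implicit Types z w : C.

(** The modulus as a real number, to be compared with [cnorm]; the norm of the library takes its
    values in [R[i]]. *)
Definition cn z : R := complex.Re `|z|.

Lemma cnE z : `|z| = (cn z)%:C.
Proof. by rewrite /cn normc_def. Qed.

Lemma cn_ge0 z : 0 <= cn z.
Proof. by rewrite -ler0c -cnE normr_ge0. Qed.

Lemma cnM z w : cn (z * w) = cn z * cn w.
Proof. by apply: complexI; rewrite rmorphM /= -!cnE normrM. Qed.

Lemma cnD z w : cn (z + w) <= cn z + cn w.
Proof. by rewrite -lecR rmorphD /= -!cnE ler_normD. Qed.

Lemma cnN z : cn (- z) = cn z.
Proof. by apply: complexI; rewrite -!cnE normrN. Qed.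

Lemma cn0 : cn 0 = 0.
Proof. by apply: complexI; rewrite -cnE normr0. Qed.

Lemma cn1 : cn 1 = 1.
Proof. by apply: complexI; rewrite -cnE normr1. Qed.

Lemma cn_eq0 z : cn z = 0 -> z = 0.
Proof. by move=> h; apply/eqP; rewrite -normr_eq0 cnE h. Qed.

Lemma cnJ z : cn (conjc z) = cn z.
Proof. by apply: complexI; rewrite -!cnE normcJ. Qed.

Lemma cn_sq z : z * conjc z = (cn z ^+ 2)%:C.
Proof. by rewrite -sqr_normc cnE -rmorphXn. Qed.

Lemma cnB z w : cn (z - w) <= cn z + cn w.
Proof. by rewrite -(cnN w); exact: cnD. Qed.

Lemma cnBC z w : cn (z - w) = cn (w - z).
Proof. by rewrite -cnN opprB. Qed.

Lemma cn_sub u z w : cn (z - w) <= cn (z - u) + cn (u - w).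
Proof. by rewrite -[in leLHS](subrK u z) -addrA; exact: cnD. Qed.

Lemma cn_Re z : `|complex.Re z| <= cn z.
Proof. by rewrite -lecR -cnE normc_ge_Re. Qed.

Lemma cn_Im z : `|complex.Im z| <= cn z.
Proof.
rewrite -(@ler_pXn2r _ 2) ?nnegrE ?cn_ge0// real_normK ?num_real//.
rewrite -lecR [X in _ <= X]rmorphXn /= -cnE -add_Re2_Im2 lecR.
by rewrite lerDr sqr_ge0.
Qed.

Lemma cn_ReIm z : cn z <= `|complex.Re z| + `|complex.Im z|.
Proof.
rewrite -(@ler_pXn2r _ 2) ?nnegrE ?cn_ge0 ?addr_ge0//.
rewrite -lecR [X in X <= _]rmorphXn /= -cnE -add_Re2_Im2 lecR.
rewrite sqrrD !real_normK ?num_real// lerD2r lerDl.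
by rewrite mulrn_wge0 ?mulr_ge0.
Qed.

Lemma cn_small z : (forall e : R, 0 < e -> cn z <= e) -> z = 0.
Proof.
move=> h; apply: cn_eq0; apply/eqP; rewrite eq_le cn_ge0 andbT.
by apply/ler_addgt0Pr => e e0; rewrite add0r h.
Qed.

End ComplexNorm.

#[local] Hint Extern 0 (is_true (0 <= cn _)) => exact: cn_ge0 : core.

Section Ultrafilter.

(** One free ultrafilter serves for the whole proof. Every bounded sequence converges along it, and
    limits of several sequences are automatically compatible, which replaces successive extractions
    of subsequences. *)
Definition ufilter : set_system nat :=
  projT1 (cid (ultraFilterLemma eventually_filter)).

#[export] Instance ufilter_ultra : UltraFilter ufilter.
Proof. by rewrite /ufilter; case: cid => U /= []. Qed.

Lemma ufilter_eventually (P : set nat) (k : nat) :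
  (forall n, (k <= n)%N -> P n) -> ufilter P.
Proof.
move=> h; rewrite /ufilter; case: cid => U /= [] _; apply.
by exists k.
Qed.

Lemma ufilter_all (P : set nat) : (forall n, P n) -> ufilter P.
Proof. by move=> h; apply: (@ufilter_eventually _ 0%N) => n _. Qed.

Lemma ufilter_not (P : set nat) : ~ ufilter P -> ufilter (~` P).
Proof. by have [|//] := in_ultra_setVsetC P ufilter_ultra. Qed.

Variable R : realType.
Local Notation C := R[i].

Definition ucvg (u : nat -> C) (l : C) :=
  forall e : R, 0 < e -> ufilter [set n | cn (u n - l) < e].

Lemma complex_ultralimit (u : nat -> C) (M : R) :
  (forall n, cn (u n) <= M) -> exists l, ucvg u l.
Proof.
move=> uM.
have [a ha] := @bounded_ultralimit R nat ufilter ufilter_ultra (fun n => complex.Re (u n)) M (fun n => le_trans (cn_Re _) (uM n)).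
have [b hb] := @bounded_ultralimit R nat ufilter ufilter_ultra (fun n => complex.Im (u n)) M (fun n => le_trans (cn_Im _) (uM n)).
exists (Complex a b) => e e0; have e2 : 0 < e / 2 by rewrite divr_gt0.
apply: filterS2 (ha _ e2) (hb _ e2) => n /= h1 h2.
rewrite (le_lt_trans (cn_ReIm _))//.
have -> : complex.Re (u n - Complex a b) = complex.Re (u n) - a by case: (u n).
have -> : complex.Im (u n - Complex a b) = complex.Im (u n) - b by case: (u n).
by rewrite (splitr e) ltrD.
Qed.

Lemma ucvg_unique u (l l' : C) : ucvg u l -> ucvg u l' -> l = l'.
Proof.
move=> h h'; apply/subr0_eq/cn_small => e e0; have e2 : 0 < e / 2 by rewrite divr_gt0.
have [n /= [h1 h2]] := filter_ex (filterI (h _ e2) (h' _ e2)).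
rewrite (le_trans (cn_sub (u n) _ _))// cnBC (splitr e) lerD// ltW//.
Qed.

Lemma ucvg_cst l : ucvg (fun=> l) l.
Proof. by move=> e e0; apply: ufilter_all => n /=; rewrite subrr cn0. Qed.

Lemma ucvgD u v l m : ucvg u l -> ucvg v m -> ucvg (fun n => u n + v n) (l + m).
Proof.
move=> h h' e e0; have e2 : 0 < e / 2 by rewrite divr_gt0.
apply: filterS2 (h _ e2) (h' _ e2) => n /= h1 h2.
by rewrite opprD addrACA (le_lt_trans (cnD _ _))// (splitr e) ltrD.
Qed.

Lemma ucvgM u v l m : ucvg u l -> ucvg v m -> ucvg (fun n => u n * v n) (l * m).
Proof.
move=> h h' e e0.
pose K := cn l + cn m + 1; have K0 : 0 < K by rewrite ltr_wpDl// addr_ge0.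
pose d := Num.min 1 (e / 2 / K).
have d0 : 0 < d by rewrite lt_min ltr01 !divr_gt0.
have dK : d * K <= e / 2 by rewrite -ler_pdivlMr// ge_min lexx orbT.
have d1 : d <= 1 by rewrite ge_min lexx.
apply: filterS2 (h _ d0) (h' _ d0) => n /= h1 h2.
have -> : u n * v n - l * m = (u n - l) * v n + l * (v n - m) by ring.
have hv : cn (v n) <= 1 + cn m.
  by rewrite -[in leLHS](subrK m (v n)) (le_trans (cnD _ _))// lerD2r (le_trans (ltW h2)).
have t1 : cn ((u n - l) * v n) <= d * (1 + cn m).
  by rewrite cnM ler_pM// ltW.
have t2 : cn (l * (v n - m)) <= cn l * d by rewrite cnM ler_pM// ltW.
rewrite (le_lt_trans (cnD _ _))//.
have : d * (1 + cn m) + cn l * d = d * K by rewrite /K; ring.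
lra.
Qed.

Lemma ucvg_conj u l : ucvg u l -> ucvg (fun n => conjc (u n)) (conjc l).
Proof. by move=> h e e0; apply: filterS (h _ e0) => n /=; rewrite -rmorphB cnJ. Qed.

Lemma ucvg_sum (I : Type) (s : seq I) (u : I -> nat -> C) (l : I -> C) :
  (forall i, ucvg (u i) (l i)) ->
  ucvg (fun n => \sum_(i <- s) u i n) (\sum_(i <- s) l i).
Proof.
move=> h; elim: s => [|i s ih].
  by rewrite big_nil; under eq_fun do rewrite big_nil; exact: ucvg_cst.
by rewrite big_cons; under eq_fun do rewrite big_cons; exact: ucvgD.
Qed.

Lemma ucvg_le u l (K : R) : ucvg u l -> (forall n, cn (u n) <= K) -> cn l <= K.
Proof.
move=> h uK; apply/ler_addgt0Pr => e e0.
have [n /= h1] := filter_ex (h _ e0).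
rewrite -[in leLHS](subrK (u n) l) addrC (le_trans (cnD _ _))// lerD//.
by rewrite cnBC ltW.
Qed.

Lemma ucvg_ext u v l : (forall n, u n = v n) -> ucvg u l -> ucvg v l.
Proof. by move=> /funext ->. Qed.

Lemma ucvg_close u v l : ucvg u l ->
  (forall e : R, 0 < e -> ufilter [set n | cn (v n - u n) < e]) -> ucvg v l.
Proof.
move=> h h' e e0; have e2 : 0 < e / 2 by rewrite divr_gt0.
apply: filterS2 (h _ e2) (h' _ e2) => n /= h1 h2.
by rewrite (le_lt_trans (cn_sub (u n) _ _))// (splitr e) ltrD.
Qed.

Lemma ufilter_inv (e : R) : 0 < e -> ufilter [set n | n.+1%:R^-1 < e].
Proof.
move=> e0; apply: (@ufilter_eventually _ (Num.truncn e^-1)) => n /= h.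
rewrite invf_plt ?posrE// (lt_le_trans (truncnS_gt _))// ler_nat ltnS//.
Qed.

End Ultrafilter.

Section States.
Variable R : realType.
Local Notation C := R[i].
Implicit Type A B : cstarAlgType R.

Lemma ge0_real (z : C) : 0 <= z -> z = (cn z)%:C.
Proof. by move=> z0; rewrite -cnE ger0_norm. Qed.

Section State.
Variables (A : cstarAlgType R) (f : A -> C).
Hypothesis fS : cstar_state f.

Lemma stateZD c a b : f (c *: a + b) = c * f a + f b.
Proof. by case: fS => h _ _; rewrite h. Qed.

Lemma state0 : f 0 = 0.
Proof. by have := stateZD (-1) 0 0; rewrite scaleN1r addNr mulN1r addNr. Qed.

Lemma stateZ c a : f (c *: a) = c * f a.
Proof. by rewrite -[_ *: a]addr0 stateZD state0 addr0. Qed.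

Lemma stateD a b : f (a + b) = f a + f b.
Proof. by rewrite -[a]scale1r stateZD mul1r scale1r. Qed.

Lemma stateB a b : f (a - b) = f a - f b.
Proof. by rewrite -scaleN1r stateD stateZ mulN1r. Qed.

Lemma state1 : f 1 = 1. Proof. by case: fS. Qed.

Lemma state_sum (I : Type) (s : seq I) (P : pred I) (F : I -> A) :
  f (\sum_(i <- s | P i) F i) = \sum_(i <- s | P i) f (F i).
Proof. exact: (big_morph _ stateD state0). Qed.

Lemma state_pos x : cpos x -> 0 <= f x.
Proof. by case: fS => _ h _ [s hs ->]; rewrite -{1}hs h. Qed.

Lemma state_sa_real x : star x = x -> conjc (f x) = f x.
Proof.
move=> hx; have := state_pos (cnorm_leP hx (lexx _)).
rewrite stateB stateZ state1 mulr1 => /ge0_real h.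
have -> : f x = (cnorm x)%:C - (cn ((cnorm x)%:C - f x))%:C by rewrite -h opprB addrC subrK.
by rewrite rmorphB /= !oppr0.
Qed.

Lemma state_star a : f (star a) = conjc (f a).
Proof.
have h1 : conjc (f (a + star a)) = f (a + star a).
  by apply: state_sa_real; rewrite starD starK addrC.
have h2 : conjc (f (Complex 0 1 *: (a - star a))) = f (Complex 0 1 *: (a - star a)).
  apply: state_sa_real; rewrite starZc starB starK -(opprB a) scalerN -scaleNr.
  by congr (_ *: _); apply/eqP; rewrite eq_complex /= opprK !oppr0 !eqxx.
move: h1 h2; rewrite stateZ stateB stateD.
case: (f a) (f (star a)) => [x y] [x' y'].
move=> /eqP; rewrite eq_complex /= => /andP[/eqP h1 /eqP h2].
move=> /eqP; rewrite eq_complex /= => /andP[/eqP h3 /eqP h4].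
by apply/eqP; rewrite eq_complex /=; apply/andP; split; apply/eqP; lra.
Qed.

Lemma state_mono x y : cpos (y - x) -> f x <= f y.
Proof. by move=> /state_pos; rewrite stateB subr_ge0. Qed.

Lemma cnorm_sq_pos (a : A) : cpos ((cnorm a ^+ 2)%:C *: 1 - star a * a).
Proof. by apply: cnorm_leP; rewrite ?cnorm_cstar// starM starK. Qed.

Lemma state_sq_bound a : f (star a * a) <= (cnorm a ^+ 2)%:C.
Proof. by have := state_mono (cnorm_sq_pos a); rewrite stateZ state1 mulr1. Qed.

(** The variance f((a - f(a))^* (a - f(a))) = f(a^* a) - |f(a)|^2 is nonnegative. *)
Lemma state_bound a : cn (f a) <= cnorm a.
Proof.
have := state_pos (cpos_star (a - f a *: 1)).
rewrite starB starZc star1 mulrBl !mulrBr -!scalerAl -!scalerAr !mul1r !mulr1.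
rewrite !stateB !stateZ state_star state1 mulr1 subrr subr0 -[_ * conjc _]mulrC.
rewrite [conjc _ * _]mulrC cn_sq subr_ge0 => h.
have := le_trans h (state_sq_bound a); rewrite lecR.
by rewrite ler_pXn2r ?nnegrE.
Qed.

Lemma state_null_ideal b y : f (star y * y) = 0 -> f (star (b * y) * (b * y)) = 0.
Proof.
move=> h; apply/eqP; rewrite eq_le (state_pos (cpos_star _)) andbT.
have := state_pos (cpos_congr y (cnorm_sq_pos b)).
rewrite mulrBr mulrBl -scalerAr mulr1 -scalerAl stateB stateZ h mulr0 sub0r oppr_ge0.
by rewrite starM !mulrA.
Qed.

End State.

(** A morphism preserves [cpos], so it transports the inequality between a^* a and the scalar |a|^2;
    the C*-identity then gives back the norms. *)
Lemma morphism_contract A B (f : A -> B) : cstar_morphism f ->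
  forall a, cnorm (f a) <= cnorm a.
Proof.
case=> fl f1 fM fS a.
have fB x y : f (x - y) = f x - f y.
  by rewrite addrC -[- y]scaleN1r fl scaleN1r addrC.
have fZ c x : f (c *: x) = c *: f x.
  by have := fl c x 0; rewrite addr0 => ->; have := fB 0 0; rewrite !subrr => ->; rewrite addr0.
have fp x : cpos x -> cpos (f x).
  by case=> s hs ->; exists (f s); rewrite -?fS ?hs ?fM.
rewrite -(@ler_pXn2r _ 2) ?nnegrE// -!cnorm_cstar -fS -fM.
apply: cpos_le => //; first by apply: fp; exact: cpos_star.
rewrite -f1 -fZ -fB; apply: fp; apply: cnorm_leP => //.
by rewrite starM starK.
Qed.

End States.

(** * Finite-dimensional representations *)

Section Representations.
Variable R : realType.
Local Notation C := R[i].
Implicit Type A B : cstarAlgType R.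

(** Matrix coefficients are indexed by a finite type, so that tensor products are indexed by [I * J]
    and subrepresentations by an injection of index types. *)
Definition rep A (I : finType) (rho : A -> I -> I -> C) : Prop :=
  [/\ forall c a b i j, rho (c *: a + b) i j = c * rho a i j + rho b i j,
      forall i j, rho 1 i j = (i == j)%:R,
      forall a b i j, rho (a * b) i j = \sum_k rho a i k * rho b k j
    & forall a i j, rho (star a) i j = conjc (rho a j i)].

Section Rep.
Variables (A : cstarAlgType R) (I : finType) (rho : A -> I -> I -> C).
Hypothesis hrho : rep rho.

Lemma repZD c a b i j : rho (c *: a + b) i j = c * rho a i j + rho b i j.
Proof. by case: hrho. Qed.

Lemma rep1 i j : rho 1 i j = (i == j)%:R.
Proof. by case: hrho. Qed.

Lemma repM a b i j : rho (a * b) i j = \sum_k rho a i k * rho b k j.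
Proof. by case: hrho. Qed.

Lemma rep_star a i j : rho (star a) i j = conjc (rho a j i).
Proof. by case: hrho. Qed.

Lemma rep0 i j : rho 0 i j = 0.
Proof. by have := repZD (-1) 0 0 i j; rewrite scaleN1r addNr mulN1r addNr. Qed.

Lemma repZ c a i j : rho (c *: a) i j = c * rho a i j.
Proof. by rewrite -[_ *: a]addr0 repZD rep0 addr0. Qed.

Lemma repD a b i j : rho (a + b) i j = rho a i j + rho b i j.
Proof. by rewrite -[a]scale1r repZD mul1r scale1r. Qed.

Lemma repB a b i j : rho (a - b) i j = rho a i j - rho b i j.
Proof. by rewrite -scaleN1r repD repZ mulN1r. Qed.

Lemma rep_sqE a i : rho (star a * a) i i = (\sum_k cn (rho a k i) ^+ 2)%:C.
Proof.
rewrite repM rmorph_sum /=; apply: eq_bigr => k _.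
by rewrite rep_star mulrC cn_sq.
Qed.

Lemma rep_state i : cstar_state (fun a => rho a i i).
Proof.
split; first by move=> c a b; exact: repZD.
  by move=> a; rewrite rep_sqE ler0c sumr_ge0// => k _; rewrite sqr_ge0.
by rewrite rep1 eqxx.
Qed.

Lemma rep_bound a i j : cn (rho a i j) <= cnorm a.
Proof.
have := state_sq_bound (rep_state j) a; rewrite rep_sqE lecR (bigD1 i)//= => h.
rewrite -(@ler_pXn2r _ 2) ?nnegrE//; apply: le_trans h.
by rewrite lerDl sumr_ge0// => k _; rewrite sqr_ge0.
Qed.

End Rep.

Lemma closed_zero A (f : A -> C) (K : R) : (forall a b, f (a - b) = f a - f b) ->
  (forall a, cn (f a) <= K * cnorm a) -> cclosure [set a | f a = 0] `<=` [set a | f a = 0].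
Proof.
move=> fB fK a ha; apply: cn_small => e e0.
pose M := `|K| + 1; have M0 : 0 < M by rewrite ltr_wpDl.
have [b /= fb hb] := ha _ (divr_gt0 e0 M0).
have -> : f a = f (a - b) by rewrite fB fb subr0.
rewrite (le_trans (fK _))// (@le_trans _ _ (M * cnorm (a - b)))//.
  by rewrite ler_wpM2r// (le_trans (ler_norm _))// lerDl.
by rewrite mulrC -ler_pdivlMr// ltW.
Qed.

Lemma cgen_rep A (X : set A) (P : set A) :
  cstar_generated X -> closed_star_subalgebra P -> X `<=` P -> forall a, P a.
Proof. by move=> h hP XP a; rewrite (h P). Qed.

Lemma rep_uniq A (I : finType) (X : set A) (rho sigma : A -> I -> I -> C) :
  cstar_generated X -> rep rho -> rep sigma ->
  (forall x, X x -> forall i j, rho x i j = sigma x i j) ->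
  forall a i j, rho a i j = sigma a i j.
Proof.
move=> hX hr hs hx; apply: (cgen_rep hX) => //; split.
- move=> a ha i j; apply/subr0_eq.
  apply: (@closed_zero A (fun a => rho a i j - sigma a i j) 2) => //.
  + by move=> x y; rewrite (repB hr) (repB hs); ring.
  + move=> x; rewrite (le_trans (cnB _ _))//.
    by rewrite mulr2n mulrDl mul1r lerD ?(rep_bound hr) ?(rep_bound hs).
  + by move=> e e0; have [b hb ?] := ha e e0; exists b => //=; rewrite hb subrr.
- by move=> i j; rewrite (rep1 hr) (rep1 hs).
- by move=> c a b ha hb i j; rewrite (repZD hr) (repZD hs) ha hb.
- move=> a b ha hb i j; rewrite (repM hr) (repM hs); apply: eq_bigr => k _.
  by rewrite ha hb.
- by move=> a ha i j; rewrite (rep_star hr) (rep_star hs) ha.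
Qed.

Definition star_subalgebra A (S : set A) : Prop :=
  [/\ S 1, forall (c : C) a b, S a -> S b -> S (c *: a + b),
      forall a b, S a -> S b -> S (a * b) & forall a, S a -> S (star a)].

Lemma closure_subalgebra A (S : set A) : star_subalgebra S ->
  closed_star_subalgebra (cclosure S).
Proof.
case=> S1 SD SM SS; split.
- move=> a ha e e0; have e2 : 0 < e / 2 by rewrite divr_gt0.
  have [b hb ab] := ha _ e2; have [c hc bc] := hb _ e2; exists c => //.
  by rewrite (le_lt_trans (cnorm_sub b _ _))// (splitr e) ltrD.
- by move=> e e0; exists 1 => //; rewrite subrr cnorm0.
- move=> c a b ha hb e e0.
  have e2 : 0 < e / 2 by rewrite divr_gt0.
  have e3 : 0 < e / 2 / (cn c + 1) by rewrite !divr_gt0// ltr_wpDl.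
  have [a' Sa aa] := ha _ e3; have [b' Sb bb] := hb _ e2.
  exists (c *: a' + b'); first exact: SD.
  rewrite opprD addrACA -scalerBr (le_lt_trans (cnormD _ _))// (splitr e) ltr_leD// ?ltW//.
  have -> : cnorm (c *: (a - a')) = cn c * cnorm (a - a').
    by apply: complexI; rewrite cnormZ cnE rmorphM.
  rewrite (@le_lt_trans _ _ ((cn c + 1) * cnorm (a - a')))//.
    by rewrite ler_wpM2r// lerDl.
  by rewrite mulrC -ltr_pdivlMr// ltr_wpDl.
- move=> a b ha hb e e0.
  pose K := cnorm a + cnorm b + 1; have K0 : 0 < K by rewrite ltr_wpDl// addr_ge0.
  pose d := Num.min 1 (e / 2 / K).
  have d0 : 0 < d by rewrite lt_min ltr01 !divr_gt0.
  have dK : d * K <= e / 2 by rewrite -ler_pdivlMr// ge_min lexx orbT.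
  have d1 : d <= 1 by rewrite ge_min lexx.
  have [a' Sa aa] := ha _ d0; have [b' Sb bb] := hb _ d0.
  exists (a' * b'); first exact: SM.
  have -> : a * b - a' * b' = (a - a') * b + a' * (b - b') by nc_ring (R[i]).
  have na : cnorm a' <= 1 + cnorm a.
    rewrite -[in leLHS](subrK a a') (le_trans (cnormD _ _))// lerD2r cnormBC.
    by rewrite (le_trans (ltW aa)).
  have t1 : cnorm ((a - a') * b) <= d * cnorm b.
    by rewrite (le_trans (cnormM _ _))// ler_wpM2r// ltW.
  have t2 : cnorm (a' * (b - b')) <= (1 + cnorm a) * d.
    by rewrite (le_trans (cnormM _ _))// ler_pM// ltW.
  rewrite (le_lt_trans (cnormD _ _))//.
  have : d * cnorm b + (1 + cnorm a) * d = d * K by rewrite /K; ring.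
  lra.
- move=> a ha e e0; have [b Sb ab] := ha _ e0; exists (star b); first exact: SS.
  by rewrite -starB cnorm_star.
Qed.

Lemma dense_subalgebra A (X S : set A) : cstar_generated X ->
  star_subalgebra S -> X `<=` S -> forall a, cclosure S a.
Proof.
move=> hX hS XS; apply: (cgen_rep hX); first exact: closure_subalgebra.
by move=> x /XS Sx e e0; exists x => //; rewrite subrr cnorm0.
Qed.

Lemma dense_seq A (S : set A) (a : A) : cclosure S a ->
  exists x : nat -> A, (forall n, S (x n)) /\ forall n, cnorm (a - x n) < n.+1%:R^-1.
Proof.
move=> ha.
have h n : {s | S s /\ cnorm (a - s) < n.+1%:R^-1}.
  by apply: cid; have [|s ? ?] := ha n.+1%:R^-1; [rewrite invr_gt0|exists s].
by exists (fun n => projT1 (h n)); split=> n; case: (projT2 (h n)).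
Qed.

(* [G] is the graph of a densely defined *-representation. *)
Lemma rep_extend A (I : finType) (X : set A) (G : A -> (I -> I -> C) -> Prop) (K : R) :
  cstar_generated X ->
  G 1 (fun i j => (i == j)%:R) ->
  (forall c a b M N, G a M -> G b N -> G (c *: a + b) (fun i j => c * M i j + N i j)) ->
  (forall a b M N, G a M -> G b N -> G (a * b) (fun i j => \sum_k M i k * N k j)) ->
  (forall a M, G a M -> G (star a) (fun i j => conjc (M j i))) ->
  (forall a M, G a M -> forall i j, cn (M i j) <= K * cnorm a) ->
  (forall x, X x -> exists M, G x M) ->
  exists2 rho : A -> I -> I -> C, rep rho & forall a M, G a M -> rho a = M.
Proof.
move=> hX G1 GD GM GS GK Gx.
have dG a : cclosure [set a | exists M, G a M] a.
  apply: (dense_subalgebra hX) => //; split.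
  - by exists (fun i j => (i == j)%:R).
  - by move=> c x y [M xM] [N yN]; exists (fun i j => c * M i j + N i j); exact: GD.
  - move=> x y [M xM] [N yN]; exists (fun i j => \sum_k M i k * N k j); exact: GM.
  - by move=> x [M xM]; exists (fun i j => conjc (M j i)); exact: GS.
pose close a (x : nat -> A) := forall e : R, 0 < e -> ufilter [set n | cnorm (a - x n) < e].
have xG a : exists2 x : nat -> A, close a x /\ exists K, forall n, cnorm (x n) <= K &
    exists M, forall n, G (x n) (M n).
  have [x [xM xa]] := dense_seq (dG a).
  exists x.
    split.
      by move=> e e0; apply: filterS (ufilter_inv e0) => n /=; exact: lt_trans.
    exists (cnorm a + 1) => n; rewrite -[x n](subrK a) addrC (le_trans (cnormD _ _))//.
    rewrite lerD2l cnormBC (le_trans (ltW (xa n)))// invf_le1 ?ler1n//.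
  by have [M hM] := choice xM; exists M.
have K0 : 0 <= `|K| by [].
(* Independence of the approximating sequence: the graph is linear, so the bound by K applies to x n
   - y n, which is null. The same bound gives the uniqueness of M for a given a. *)
have Gl a (x : nat -> A) (M : nat -> I -> I -> C) : close a x -> (forall n, G (x n) (M n)) ->
    forall y N, close a y -> (forall n, G (y n) (N n)) ->
    forall i j e, 0 < e -> ufilter [set n | cn (M n i j - N n i j) < e].
  move=> ax xM y N ay yN i j e e0.
  pose L := `|K| + 1; have L0 : 0 < L by rewrite ltr_wpDl.
  have e2 : 0 < e / 2 / L by rewrite !divr_gt0.
  apply: filterS2 (ax _ e2) (ay _ e2) => n /= h1 h2.
  have := GK _ _ (GD (-1) _ _ _ _ (yN n) (xM n)) i j.
  rewrite mulN1r scaleN1r [- _ + _]addrC => h; rewrite (le_lt_trans h)//.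
  rewrite addrC (@le_lt_trans _ _ (L * cnorm (x n - y n)))//.
    by rewrite ler_wpM2r// (le_trans (ler_norm _))// lerDl.
  rewrite mulrC -ltr_pdivlMr// (le_lt_trans (cnorm_sub a _ _))//.
  by rewrite (splitr e) mulrDl ltrD// cnormBC.
have ex a : exists f : I -> I -> C, forall x M, close a x -> (forall n, G (x n) (M n)) ->
    forall i j, ucvg (fun n => M n i j) (f i j).
  have [x [ax [L xL]] [M xM]] := xG a.
  have h ij : exists l, ucvg (fun n => M n ij.1 ij.2) l.
    apply: (@complex_ultralimit _ _ (`|K| * L)) => n.
    rewrite (le_trans (GK _ _ (xM n) _ _))// (@le_trans _ _ (`|K| * cnorm (x n)))//.
      by rewrite ler_wpM2r// ler_norm.
    by rewrite ler_wpM2l.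
  have [f hf] := choice h; exists (fun i j => f (i, j)) => y N ay yN i j.
  apply: (ucvg_close (hf (i, j))) => e e0; exact: (Gl a _ _ ay yN _ _ ax xM).
have [rho hrho] := choice ex.
have cst a : close a (fun=> a).
  by move=> e e0; apply: ufilter_all => n /=; rewrite subrr cnorm0.
have rhoG a M : G a M -> rho a = M.
  move=> aM; apply/funext => i; apply/funext => j.
  apply: (@ucvg_unique _ (fun=> M i j)); last exact: ucvg_cst.
  exact: (hrho a _ _ (cst a) (fun=> aM)).
exists rho => //; split.
- move=> c a b i j.
  have [x [ax _] [M xM]] := xG a; have [y [ay _] [N yN]] := xG b.
  have := hrho (c *: a + b) (fun n => c *: x n + y n) (fun n i j => c * M n i j + N n i j).
  move=> /(_ _ (fun n => GD _ _ _ _ _ (xM n) (yN n)) i j) h.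
  apply: ucvg_unique (h _) _.
    move=> e e0; have e2 : 0 < e / 2 by rewrite divr_gt0.
    have e3 : 0 < e / 2 / (cn c + 1) by rewrite !divr_gt0// ltr_wpDl.
    apply: filterS2 (ax _ e3) (ay _ e2) => n /= h1 h2.
    rewrite opprD addrACA -scalerBr (le_lt_trans (cnormD _ _))// (splitr e) ltr_leD// ?ltW//.
    have -> : cnorm (c *: (a - x n)) = cn c * cnorm (a - x n).
      by apply: complexI; rewrite cnormZ cnE rmorphM.
    rewrite (@le_lt_trans _ _ ((cn c + 1) * cnorm (a - x n)))//.
      by rewrite ler_wpM2r// lerDl.
    by rewrite mulrC -ltr_pdivlMr// ltr_wpDl.
  apply: ucvgD; last exact: (hrho b _ _ ay yN).
  apply: ucvgM; first exact: ucvg_cst.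
  exact: (hrho a _ _ ax xM).
- by move=> i j; rewrite (rhoG _ _ G1).
- move=> a b i j.
  have [x [ax [L xL]] [M xM]] := xG a; have [y [ay _] [N yN]] := xG b.
  have := hrho (a * b) (fun n => x n * y n) (fun n i j => \sum_k M n i k * N n k j).
  move=> /(_ _ (fun n => GM _ _ _ _ (xM n) (yN n)) i j) h.
  apply: ucvg_unique (h _) _.
    move=> e e0.
    have L0 : 0 <= L by exact: le_trans (xL 0%N).
    have e2 : 0 < e / 2 / (cnorm b + 1) by rewrite !divr_gt0// ltr_wpDl.
    have e3 : 0 < e / 2 / (L + 1) by rewrite !divr_gt0// ltr_wpDl.
    apply: filterS2 (ax _ e2) (ay _ e3) => n /= h1 h2.
    have -> : a * b - x n * y n = (a - x n) * b + x n * (b - y n) by nc_ring (R[i]).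
    rewrite (le_lt_trans (cnormD _ _))// (splitr e) ltrD//.
      rewrite (le_lt_trans (cnormM _ _))//.
      rewrite (@le_lt_trans _ _ (cnorm (a - x n) * (cnorm b + 1)))//.
        by rewrite ler_wpM2l// lerDl.
      by rewrite -ltr_pdivlMr// ltr_wpDl.
    rewrite (le_lt_trans (cnormM _ _))//.
    rewrite (@le_lt_trans _ _ ((L + 1) * cnorm (b - y n)))//.
      by rewrite ler_wpM2r// (le_trans (xL n))// lerDl.
    by rewrite mulrC -ltr_pdivlMr// ltr_wpDl.
  apply: ucvg_sum => k; apply: ucvgM; first exact: (hrho a _ _ ax xM).
  exact: (hrho b _ _ ay yN).
- move=> a i j.
  have [x [ax [L xL]] [M xM]] := xG a.
  have := hrho (star a) (fun n => star (x n)) (fun n i j => conjc (M n j i)).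
  move=> /(_ _ (fun n => GS _ _ (xM n)) i j) h.
  apply: ucvg_unique (h _) _.
    by move=> e e0; apply: filterS (ax _ e0) => n /=; rewrite -starB cnorm_star.
  apply: ucvg_conj; exact: (hrho a _ _ ax xM).
Qed.

End Representations.

(** * Excision and the tensor product *)

Section Excision.
Variable R : realType.
Local Notation C := R[i].
Implicit Type A B : cstarAlgType R.

Lemma cnormZc A (c : C) (a : A) : cnorm (c *: a) = cn c * cnorm a.
Proof. by apply: complexI; rewrite cnormZ cnE rmorphM. Qed.

Lemma cpos_sum A (I : Type) (s : seq I) (P : pred I) (F : I -> A) :
  (forall i, P i -> cpos (F i)) -> cpos (\sum_(i <- s | P i) F i).
Proof.
move=> h; elim/big_rec : _ => [|i a Pi pa]; first exact: cpos0.
by apply: cposD => //; exact: h.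
Qed.

(** With z the sum of the y^* y, take for F the positive part of e - z. Then F (e - z) F = F^3 is
    positive, so F z F is below e F^2, and each summand is below z. Since f(z) = 0, f(F) is at least
    e. *)
Lemma excise_null A (f : A -> C) (I : finType) (y : I -> A) (e : R) :
  cstar_state f -> (forall i, f (star (y i) * y i) = 0) -> 0 < e ->
  exists F : A, [/\ star F = F, f F != 0
    & forall i, cpos (e%:C *: (F * F) - F * (star (y i) * y i) * F)].
Proof.
move=> fS fy e0; pose z := \sum_i star (y i) * y i.
have hx : star (e%:C *: 1 - z) = e%:C *: 1 - z.
  rewrite starB starZr star1 star_sum; congr (_ - _); apply: eq_bigr => i _.
  by rewrite starM starK.
have [p [n [xE [pp pn] [pn0 np0] _ _]]] := pos_neg_parts hx.
have hp := cpos_sa pp.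
exists p; split=> //.
  have : f p = e%:C + f n.
    have -> : p = (e%:C *: 1 - z) + n by rewrite xE subrK.
    rewrite (stateD fS) (stateB fS) (stateZ fS) (state1 fS) mulr1.
    by rewrite (state_sum fS) (eq_bigr (fun=> 0)) ?sumr_const ?mul0rn ?subr0.
  move=> ->; rewrite gt_eqF// ltr_wpDr ?ltcR//.
  exact: (state_pos fS).
move=> i.
have -> : e%:C *: (p * p) - p * (star (y i) * y i) * p =
    p * p * p + p * (z - star (y i) * y i) * p.
  have -> : p * p * p = p * (e%:C *: 1 - z) * p.
    by rewrite xE mulrBr pn0 subr0.
  by nc_ring (R[i]).
apply: cposD; first by rewrite -{1}hp; exact: cpos_congr.
rewrite -{1}hp; apply: cpos_congr.
rewrite /z (bigD1 i)//= addrAC subrr add0r.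
by apply: cpos_sum => j _; exact: cpos_star.
Qed.

(* For a representation, [p] acts as the projection onto the vector of the vector
   state [f]. *)
Definition excisable A (f : A -> C) : Prop :=
  cstar_state f /\ exists p, f (star (1 - p) * (1 - p)) = 0 /\
    forall a, f a = 0 -> f (star (star p * a * p) * (star p * a * p)) = 0.

(** For a = b - f(b) one has a = (1 - p)^* a p + a (1 - p) + p^* a p. The second term and the
    adjoint of the first are left multiples of 1 - p, hence in the left kernel of f; the third one
    is there by the hypothesis on p. Only the adjoint of the first term is controlled, whence the
    form [star (y None)]. *)
Lemma excise A (f : A -> C) n (b : 'I_n -> A) (e : R) : excisable f -> 0 < e ->
  exists F : A, [/\ star F = F, f F != 0
    & forall k, exists y : option bool -> A,
      b k - f (b k) *: 1 = star (y None) + y (Some true) + y (Some false) /\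
      forall i, cpos (e%:C *: (F * F) - F * (star (y i) * y i) * F)].
Proof.
move=> [fS [p [fp fN]]] e0.
pose a k := b k - f (b k) *: 1.
pose y (ki : 'I_n * option bool) := match ki.2 with
  | None => star p * star (a ki.1) * (1 - p)
  | Some true => a ki.1 * (1 - p)
  | Some false => star p * a ki.1 * p end.
have [|F [hF fF Fy]] := @excise_null A f _ y e fS _ e0.
  case=> k [[]|]; rewrite /y /=.
  - exact: state_null_ideal.
  - apply: fN; rewrite (stateB fS) (stateZ fS) (state1 fS) mulr1 subrr//.
  - exact: state_null_ideal.
exists F; split=> // k; exists (fun i => y (k, i)); split; last by move=> i; exact: Fy.
rewrite -/(a k) /y /= !starM !starK starB star1.
by nc_ring (R[i]).
Qed.

Section Tensor.
Variables (A B T : cstarAlgType R) (tens : A -> B -> T).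
Hypothesis tensP : cstar_tensor_product tens.

Lemma tens_linl b : linear (tens ^~ b). Proof. by case: tensP. Qed.
Lemma tens_linr a : linear (tens a). Proof. by case: tensP => _ []. Qed.
Lemma tens11 : tens 1 1 = 1. Proof. by case: tensP => _ [_ []]. Qed.
Lemma tensM a a' b b' : tens a b * tens a' b' = tens (a * a') (b * b').
Proof. by case: tensP => _ [_ [_ []]]. Qed.
Lemma tens_star a b : star (tens a b) = tens (star a) (star b).
Proof. by case: tensP => _ [_ [_ [_ []]]]. Qed.

Lemma tens0l b : tens 0 b = 0.
Proof. by have := tens_linl b (-1) 0 0; rewrite scaleN1r addNr scaleN1r addNr. Qed.

Lemma tens0r a : tens a 0 = 0.
Proof. by have := tens_linr a (-1) 0 0; rewrite scaleN1r addNr scaleN1r addNr. Qed.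

Lemma tensZl c a b : tens (c *: a) b = c *: tens a b.
Proof. by have := tens_linl b c a 0; rewrite !addr0 tens0l addr0. Qed.

Lemma tensZr c a b : tens a (c *: b) = c *: tens a b.
Proof. by have := tens_linr a c b 0; rewrite !addr0 tens0r addr0. Qed.

Lemma tensDl a a' b : tens (a + a') b = tens a b + tens a' b.
Proof. by have := tens_linl b 1 a a'; rewrite !scale1r. Qed.

Lemma tensDr a b b' : tens a (b + b') = tens a b + tens a b'.
Proof. by have := tens_linr a 1 b b'; rewrite !scale1r. Qed.

Lemma tensBl a a' b : tens (a - a') b = tens a b - tens a' b.
Proof. by rewrite tensDl -scaleN1r tensZl scaleN1r. Qed.

Lemma tensBr a b b' : tens a (b - b') = tens a b - tens a b'.
Proof. by rewrite tensDr -scaleN1r tensZr scaleN1r. Qed.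

Lemma tens_neq0 (f : A -> C) (g : B -> C) x y : cstar_state f -> cstar_state g ->
  f x != 0 -> g y != 0 -> tens x y != 0.
Proof.
move=> fS gS fx gy; apply/eqP => h.
have [_ [_ [_ [_ [_ [inj _]]]]]] := tensP.
have := inj 1%N (fun=> x) (fun=> y); rewrite big_ord1 => /(_ h (R[i])^o (fun a b => f a * g b)).
rewrite big_ord1 => e; have : f x * g y = 0.
  apply: e.
    by move=> b c a a'; rewrite (stateZD fS) mulrDl -mulrA.
  by move=> a c b b'; rewrite (stateZD gS) mulrDr mulrCA.
by move/eqP; rewrite mulf_eq0 (negbTE fx) (negbTE gy).
Qed.

Lemma tens_cpos a b : cpos a -> star b = b -> cpos (tens a (b * b)).
Proof.
move=> [s hs ->] hb; exists (tens s b); first by rewrite tens_star hs hb.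
by rewrite tensM.
Qed.

(* Both factors being cut down near a point of their spectrum, the tensor
   product becomes a scalar; faithfulness on simple tensors keeps the cut-off
   nonzero. *)
Lemma excisable_tens (f : A -> C) (g : B -> C) : excisable f -> excisable g ->
  forall n (b : 'I_n -> A) (c : 'I_n -> B),
    cn (\sum_k f (b k) * g (c k)) <= cnorm (\sum_k tens (b k) (c k)).
Proof.
move=> fE gE n b c; set t := \sum_k tens _ _.
(* The difference between b (x) c and f(b) g(c) is (1 (x) c)((b - f(b)) (x) 1) + f(b) (1 (x) (c -
   g(c))), and [excise] cuts each of the two errors into three pieces. *)
pose L := \sum_k (3 * cnorm (tens 1 (c k)) + 3 * cn (f (b k))).
have L0 : 0 <= L by apply: sumr_ge0 => k _; rewrite addr_ge0// mulr_ge0.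
apply/ler_addgt0Pr => e e0.
pose d := e / (L + 1); have d0 : 0 < d by rewrite divr_gt0// ltr_wpDl.
have dd0 : 0 < d ^+ 2 by rewrite exprn_gt0.
have [F [hF fF Fb]] := excise b fE dd0.
have [H [hH gH Hc]] := excise c gE dd0.
pose P := tens F H.
have P0 : 0 < cnorm P.
  rewrite lt_def cnorm_ge0 andbT; apply: contra (tens_neq0 fE.1 gE.1 fF gH).
  by move=> /eqP/cnorm0_eq0/eqP.
have dP : 0 <= d * cnorm P by rewrite mulr_ge0// ltW.
have hP : star P = P by rewrite tens_star hF hH.
have yl y : cpos ((d ^+ 2)%:C *: (F * F) - F * (star y * y) * F) ->
    cnorm (tens y 1 * P) <= d * cnorm P.
  move=> py; rewrite -(@ler_pXn2r _ 2) ?nnegrE// exprMn -!cnorm_cstar.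
  rewrite starM hP -(cnormZr _ (ltW dd0)).
  rewrite !tens_star !star1 !(tensM, mulr1, mul1r) -tensZl.
  apply: cnorm_mono; rewrite ?mulrA -?tensBl; apply: tens_cpos => //.
    rewrite -mulrA -{1}hF; have -> : star F * star y * (y * F) = star (y * F) * (y * F).
      by rewrite starM.
    exact: cpos_star.
  by move: py; rewrite !mulrA.
have yr y : cpos ((d ^+ 2)%:C *: (H * H) - H * (star y * y) * H) ->
    cnorm (tens 1 y * P) <= d * cnorm P.
  move=> py; rewrite -(@ler_pXn2r _ 2) ?nnegrE// exprMn -!cnorm_cstar.
  rewrite starM hP -(cnormZr _ (ltW dd0)).
  rewrite !tens_star !star1 !(tensM, mulr1, mul1r) -tensZr.
  have tc x w : star x = x -> cpos w -> cpos (tens (x * x) w).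
    move=> hx [s hs ->]; exists (tens x s); first by rewrite tens_star hs hx.
    by rewrite tensM.
  apply: cnorm_mono; rewrite ?mulrA -?tensBr; apply: tc => //.
    rewrite -mulrA -{1}hH; have -> : star H * star y * (y * H) = star (y * H) * (y * H).
      by rewrite starM.
    exact: cpos_star.
  by move: py; rewrite !mulrA.
(* The cut-off P makes y2 and y3 small from the right, but y1 only from the left, through its
   adjoint. So y1 has to be moved in front of m, which explains the commutation hypothesis. *)
have three (m : T) (y1 y2 y3 : T) (K : R) : GRing.comm m y1 -> 
    cnorm m <= K -> cnorm (star y1 * P) <= d * cnorm P ->
    cnorm (y2 * P) <= d * cnorm P -> cnorm (y3 * P) <= d * cnorm P ->
    cnorm (P * (m * (y1 + y2 + y3)) * P) <= 3 * K * d * cnorm P ^+ 2.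
  move=> cm mK h1 h2 h3.
  have K0 : 0 <= K by exact: le_trans mK.
  have -> : P * (m * (y1 + y2 + y3)) * P =
      star (star y1 * P) * (m * P) + (P * m) * (y2 * P) + (P * m) * (y3 * P).
    by rewrite starM starK hP !mulrDr !mulrDl cm; nc_ring (R[i]).
  have a1 : cnorm (star (star y1 * P) * (m * P)) <= d * cnorm P * (K * cnorm P).
    rewrite (le_trans (cnormM _ _))// cnorm_star ler_pM//.
    by rewrite (le_trans (cnormM _ _))// ler_wpM2r.
  have a2 y : cnorm (y * P) <= d * cnorm P ->
      cnorm ((P * m) * (y * P)) <= cnorm P * K * (d * cnorm P).
    move=> hy; rewrite (le_trans (cnormM _ _))// ler_pM//.
    by rewrite (le_trans (cnormM _ _))// ler_wpM2l.
  have := a2 _ h2; have := a2 _ h3; have := cnormD (star (star y1 * P) * (m * P) + (P * m) * (y2 * P)) ((P * m) * (y3 * P)).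
  have := cnormD (star (star y1 * P) * (m * P)) ((P * m) * (y2 * P)).
  have -> : 3 * K * d * cnorm P ^+ 2 = d * cnorm P * (K * cnorm P) + cnorm P * K * (d * cnorm P) + cnorm P * K * (d * cnorm P) by ring.
  lra.
have term k : cnorm (P * tens (b k) (c k) * P - (f (b k) * g (c k)) *: (P * P)) <=
    (3 * cnorm (tens 1 (c k)) + 3 * cn (f (b k))) * d * cnorm P ^+ 2.
  have [y [yE yF]] := Fb k; have [w [wE wH]] := Hc k.
  have -> : P * tens (b k) (c k) * P - (f (b k) * g (c k)) *: (P * P) =
    P * (tens 1 (c k) * (tens (star (y None)) 1 + tens (y (Some true)) 1 + tens (y (Some false)) 1)) * P
    + P * (f (b k) *: 1 * (tens 1 (star (w None)) + tens 1 (w (Some true)) + tens 1 (w (Some false)))) * P.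
    rewrite -!tensDl -yE -!tensDr -wE tensM mul1r mulr1.
    rewrite tensBl tensZl tensBr tensZr tens11; set c1 := tens 1 (c k).
    by nc_ring (R[i]).
  have -> : (3 * cnorm (tens 1 (c k)) + 3 * cn (f (b k))) * d * cnorm P ^+ 2 =
    3 * cnorm (tens 1 (c k)) * d * cnorm P ^+ 2 + 3 * cn (f (b k)) * d * cnorm P ^+ 2 by ring.
  rewrite (le_trans (cnormD _ _))// lerD//; apply: three => //.
  - by rewrite /GRing.comm !tensM !mul1r !mulr1.
  - by rewrite tens_star starK star1; apply: yl; exact: yF.
  - by apply: yl; exact: yF.
  - by apply: yl; exact: yF.
  - by apply: commr_sym; apply: commrZ; exact: commr1.
  - by rewrite cnormZc cnorm1 mulr1.
  - by rewrite tens_star starK star1; apply: yr; exact: wH.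
  - by apply: yr; exact: wH.
  - by apply: yr; exact: wH.
have P2 : cnorm (P * P) = cnorm P ^+ 2 by rewrite -cnorm_cstar hP.
have tot : cn (\sum_k f (b k) * g (c k)) * cnorm P ^+ 2 <= (cnorm t + d * L) * cnorm P ^+ 2.
  rewrite -{1}P2 -cnormZc.
  have -> : (\sum_k f (b k) * g (c k)) *: (P * P) = P * t * P -
      \sum_k (P * tens (b k) (c k) * P - (f (b k) * g (c k)) *: (P * P)).
    by rewrite sumrB -scaler_suml -mulr_suml -mulr_sumr opprB addrC subrK.
  rewrite (le_trans (cnormB _ _))// mulrDl lerD//.
    rewrite (le_trans (cnormM _ _))// expr2 mulrA ler_wpM2r//.
    by rewrite (le_trans (cnormM _ _))// mulrC.
  rewrite (le_trans (cnorm_sum _ _ _))// /L mulr_sumr mulr_suml ler_sum// => k _.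
  by rewrite [d * _]mulrC.
rewrite ler_pM2r ?exprn_gt0// in tot.
apply: le_trans tot _; rewrite lerD2l /d mulrAC ler_pdivrMr ?ltr_wpDl//.
by rewrite mulrDr mulr1 lerDl ltW.
Qed.

End Tensor.
End Excision.

Section TensorReps.
Variable R : realType.
Local Notation C := R[i].
Implicit Type A B : cstarAlgType R.

(* The functionals which convolve boundedly for every C*-norm on the tensor
   product. *)
Inductive tame A : (A -> C) -> Prop :=
| tame_excisable f x y : excisable f -> tame (fun a => f (x * a * y))
| tame_lin c f g : tame f -> tame g -> tame (fun a => c * f a + g a).

Lemma big_ord_finType (V : nmodType) (K : finType) (F : K -> V) :
  \sum_k F k = \sum_(i < #|K|) F (enum_val i).
Proof.
rewrite (reindex (@enum_val K predT)) //.
by apply: onW_bij; exact: enum_val_bij.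
Qed.

Lemma tame_tensor A B (T : cstarAlgType R) (tens : A -> B -> T) f g :
  cstar_tensor_product tens -> tame f -> tame g ->
  exists L : R, forall (K : finType) (b : K -> A) (c : K -> B),
    cn (\sum_k f (b k) * g (c k)) <= L * cnorm (\sum_k tens (b k) (c k)).
Proof.
move=> tP tf tg; elim: tf => {f} [f x y fE|c f1 f2 _ [L1 h1] _ [L2 h2]]; last first.
  exists (cn c * L1 + L2) => K b d.
  under eq_bigr do rewrite mulrDl -mulrA.
  rewrite big_split -mulr_sumr/= (le_trans (cnD _ _))// mulrDl lerD//.
  by rewrite cnM -mulrA ler_wpM2l.
elim: tg => {g} [g x' y' gE|c g1 g2 _ [L1 h1] _ [L2 h2]]; last first.
  exists (cn c * L1 + L2) => K b d.
  under eq_bigr do rewrite mulrDr mulrCA.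
  rewrite big_split -mulr_sumr/= (le_trans (cnD _ _))// mulrDl lerD//.
  by rewrite cnM -mulrA ler_wpM2l.
exists (cnorm (tens x x') * cnorm (tens y y')) => K b c.
rewrite big_ord_finType (le_trans (excisable_tens tP fE gE _ _))//.
rewrite -(big_ord_finType (fun k => tens (x * b k * y) (x' * c k * y'))).
have -> : \sum_k tens (x * b k * y) (x' * c k * y') =
    tens x x' * (\sum_k tens (b k) (c k)) * tens y y'.
  by rewrite mulr_sumr mulr_suml; apply: eq_bigr => k _; rewrite !(tensM tP).
rewrite (le_trans (cnormM _ _))// mulrAC ler_wpM2r//.
by rewrite (le_trans (cnormM _ _)).
Qed.

Lemma sum_embed (V : nmodType) (I J : finType) (e : J -> I) (F : I -> V) :
  injective e -> (forall i, (forall j, e j <> i) -> F i = 0) ->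
  \sum_i F i = \sum_j F (e j).
Proof.
move=> ei F0; rewrite -(big_imset _ (in2W ei)) /= big_mkcond [RHS]big_mkcond /=.
apply: eq_bigr => i _; case: ifPn => // /imsetP h; apply: F0 => j ej.
by apply: h; exists j.
Qed.

Lemma rep_off_block A (I : finType) (X : set A) (rho : A -> I -> I -> C) (c : I -> bool) :
  cstar_generated X -> rep rho ->
  (forall x, X x -> forall i j, c i != c j -> rho x i j = 0) ->
  forall a i j, c i != c j -> rho a i j = 0.
Proof.
move=> hX hr h a; move: a; apply: (cgen_rep hX) => //; split.
- move=> a ha i j cij.
  apply: (@closed_zero _ A (fun a => rho a i j) 1) => //.
  + by move=> x y; rewrite (repB hr).
  + by move=> x; rewrite mul1r (rep_bound hr).
  + by move=> d d0; have [a' /= ha' ?] := ha d d0; exists a' => //=; exact: ha'.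
- by move=> i j cij; rewrite (rep1 hr); case: (eqVneq i j) cij => // ->; rewrite eqxx.
- by move=> k a a' ha ha' i j cij; rewrite (repZD hr) ha// ha'// mulr0 addr0.
- move=> a a' ha ha' i j cij; rewrite (repM hr) big1// => k _.
  have [cik|cik] := eqVneq (c i) (c k); last by rewrite ha// mul0r.
  by rewrite ha' ?mulr0// -cik.
- by move=> a ha i j cij; rewrite (rep_star hr) ha ?conjc0// eq_sym.
Qed.

(** A colouring of the indices that the generators respect is respected by all of A, so a colour
    class carries a subrepresentation. This isolates the two summands in the tensor product of two
    pair representations. *)
Lemma rep_block A (I J : finType) (X : set A) (rho : A -> I -> I -> C)
    (c : I -> bool) (b : bool) (e : J -> I) :
  cstar_generated X -> rep rho ->
  (forall x, X x -> forall i j, c i != c j -> rho x i j = 0) ->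
  injective e -> (forall j, c (e j) = b) -> (forall i, c i = b -> exists j, e j = i) ->
  rep (fun a j k => rho a (e j) (e k)).
Proof.
move=> hX hr h ei ce ec; have {}h := rep_off_block hX hr h.
split.
- by move=> k a a' i j; rewrite (repZD hr).
- by move=> i j; rewrite (rep1 hr) (inj_eq ei).
- move=> a a' i j; rewrite (repM hr); apply: sum_embed => // k hk.
  rewrite h ?mul0r// ce; apply/eqP => /esym /ec[j' ej']; exact: (hk j').
- by move=> a i j; rewrite (rep_star hr).
Qed.

Section Comultiplication.
Variables (N : nat) (G : compactMatrixQuantumGroup R N).
Local Notation A := (cqg_alg G).

Let dl := fun c a b => let: And4 h _ _ _ := comult_morphism G in h c a b.
Let d1 : comult 1 = 1 :> tensor_square G := let: And4 _ h _ _ := comult_morphism G in h.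

(** This is the composition of rho (x) sigma with the coproduct. It is given by a formula only where
    the coproduct is algebraic; that the formula does not depend on the chosen sum and extends to A
    both follow from the estimate [tame_tensor], since the coproduct is contractive. *)
Lemma rep_conv (I J : finType) (rho : A -> I -> I -> C) (sigma : A -> J -> J -> C) :
  rep rho -> rep sigma ->
  (forall i j, tame (fun a => rho a i j)) -> (forall i j, tame (fun a => sigma a i j)) ->
  exists2 kappa : A -> I * J -> I * J -> C, rep kappa
    & forall a (K : finType) (b c : K -> A), comult a = \sum_k tens (b k) (c k) ->
      forall x y, kappa a x y = \sum_k rho (b k) x.1 y.1 * sigma (c k) x.2 y.2.
Proof.
move=> hr hs tr ts; have tP := @tensP R N G.
pose D a (M : I * J -> I * J -> C) := exists (K : finType) (b c : K -> A),
  comult a = \sum_k tens (b k) (c k) /\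
  M = fun x y => \sum_k rho (b k) x.1 y.1 * sigma (c k) x.2 y.2.
have bd (xy : (I * J) * (I * J)) : exists L : R, forall (K : finType) (b c : K -> A),
    cn (\sum_k rho (b k) xy.1.1 xy.2.1 * sigma (c k) xy.1.2 xy.2.2) <=
    L * cnorm (\sum_k tens (b k) (c k)).
  exact: (tame_tensor tP (tr _ _) (ts _ _)).
have {bd}[L hL] := choice bd.
have := @rep_extend R A (I * J)%type (matrix_entries (fund G)) D (\sum_xy `|L xy|)
  (@fund_generates R N G).
case=> [||||||kappa hk kD].
- exists unit, (fun=> 1), (fun=> 1); split.
    by rewrite d1 (big_pred1 tt) ?(tens11 tP)//; case.
  apply/funext => -[i j]; apply/funext => -[i' j'] /=.
  rewrite (big_pred1 tt); last by case.
  by rewrite (rep1 hr) (rep1 hs) -natrM mulnb xpair_eqE.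
- move=> k a b M M' [K1 [b1 [c1 [e1 ->]]]] [K2 [b2 [c2 [e2 ->]]]].
  exists (K1 + K2)%type, (fun x => match x with inl x => k *: b1 x | inr x => b2 x end),
    (fun x => match x with inl x => c1 x | inr x => c2 x end); split.
    rewrite dl e1 e2 big_sumType /= scaler_sumr; congr (_ + _).
    by apply: eq_bigr => i _; rewrite (tensZl tP).
  apply/funext => x; apply/funext => y; rewrite big_sumType /= mulr_sumr; congr (_ + _).
  by apply: eq_bigr => i _; rewrite (repZ hr) mulrA.
- move=> a b M M' [K1 [b1 [c1 [e1 ->]]]] [K2 [b2 [c2 [e2 ->]]]].
  exists (K1 * K2)%type, (fun x => b1 x.1 * b2 x.2), (fun x => c1 x.1 * c2 x.2); split.
    have [_ _ dM _] := comult_morphism G.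
    rewrite dM e1 e2 mulr_suml -(pair_bigA _ (fun i j => tens (b1 i * b2 j) (c1 i * c2 j)))/=.
    apply: eq_bigr => i _; rewrite mulr_sumr; apply: eq_bigr => j _.
    by rewrite (tensM tP).
  apply/funext => x; apply/funext => y.
  under eq_bigr do rewrite mulr_suml.
  under eq_bigr do under eq_bigr do rewrite mulr_sumr.
  rewrite exchange_big/= -(pair_bigA _ (fun i j => rho (b1 i * b2 j) x.1 y.1 * sigma (c1 i * c2 j) x.2 y.2))/=.
  apply: eq_bigr => i _; rewrite exchange_big/=; apply: eq_bigr => j _.
  rewrite (repM hr) (repM hs) mulr_suml.
  rewrite -(pair_bigA _ (fun p q => rho (b1 i) x.1 p * sigma (c1 i) x.2 q *
    (rho (b2 j) p y.1 * sigma (c2 j) q y.2)))/=.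
  apply: eq_bigr => p _; rewrite mulr_sumr; apply: eq_bigr => q _.
  by rewrite mulrACA.
- move=> a M [K1 [b1 [c1 [e1 ->]]]].
  exists K1, (fun k => star (b1 k)), (fun k => star (c1 k)); split.
    have [_ _ _ dS] := comult_morphism G.
    by rewrite dS e1 star_sum; apply: eq_bigr => k _; rewrite (tens_star tP).
  apply/funext => x; apply/funext => y; rewrite rmorph_sum; apply: eq_bigr => k _.
  by rewrite rmorphM (rep_star hr) (rep_star hs).
- move=> a M [K1 [b1 [c1 [e1 ->]]]] x y.
  rewrite (le_trans (hL (x, y) _ _ _))// -e1.
  have L0 : 0 <= \sum_xy `|L xy| by exact: sumr_ge0.
  apply: (@le_trans _ _ (`|L (x, y)| * cnorm (comult a))).
    by rewrite ler_wpM2r// ler_norm.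
  rewrite ler_pM//; last exact: (morphism_contract (comult_morphism G)).
  by rewrite (bigD1 (x, y))//= lerDl sumr_ge0.
- move=> _ [i [j ->]]; eexists; exists 'I_N, (fun k => fund G i k), (fun k => fund G k j).
  by split; [exact: comult_fund|].
by exists kappa => // a K b c e x y; rewrite (kD a _ (ex_intro _ K (ex_intro _ b (ex_intro _ c (conj e erefl))))).
Qed.

End Comultiplication.
End TensorReps.

(** * Approximate eigenvectors of half-commuting coordinates *)

Section NullSequences.
Variables (R : realType) (A : cstarAlgType R).
Local Notation C := R[i].
Implicit Types x y : nat -> A.

(** Sequences of A modulo these form a left A-module in which approximate eigenvectors become
    eigenvectors. *)
Definition unull x := forall e : R, 0 < e -> ufilter [set n | cnorm (x n) < e].

Lemma unullD x y : unull x -> unull y -> unull (fun n => x n + y n).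
Proof.
move=> hx hy e e0; have e2 : 0 < e / 2 by rewrite divr_gt0.
apply: filterS2 (hx _ e2) (hy _ e2) => n /= h1 h2.
by rewrite (le_lt_trans (cnormD _ _))// (splitr e) ltrD.
Qed.

Lemma unull_ext x y : (forall n, x n = y n) -> unull x -> unull y.
Proof. by move=> /funext ->. Qed.

Lemma unullM (a : A) x : unull x -> unull (fun n => a * x n).
Proof.
move=> hx e e0; have K0 : 0 < cnorm a + 1 by rewrite ltr_wpDl.
apply: filterS (hx _ (divr_gt0 e0 K0)) => n /= h.
rewrite (le_lt_trans (cnormM _ _))// (@le_lt_trans _ _ ((cnorm a + 1) * cnorm (x n)))//.
  by rewrite ler_wpM2r// lerDl.
by rewrite mulrC -ltr_pdivlMr.
Qed.

Lemma unullZ (c : C) x : unull x -> unull (fun n => c *: x n).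
Proof.
by move=> hx; apply: (unull_ext _ (unullM (c *: 1) hx)) => n; rewrite -scalerAl mul1r.
Qed.

Lemma unullB x y : unull x -> unull y -> unull (fun n => x n - y n).
Proof.
move=> hx hy; apply: (unull_ext _ (unullD hx (unullZ (-1) hy))) => n.
by rewrite scaleN1r.
Qed.

Lemma unull0 : unull (fun=> 0).
Proof. by move=> e e0; apply: ufilter_all => n; rewrite /= cnorm0. Qed.

Lemma unull_sum (I : Type) (s : seq I) (x : I -> nat -> A) :
  (forall i, unull (x i)) -> unull (fun n => \sum_(i <- s) x i n).
Proof.
move=> h; elim: s => [|i s ih].
  by apply: (unull_ext _ unull0) => n; rewrite big_nil.
by apply: (unull_ext _ (unullD (h i) ih)) => n; rewrite big_cons.
Qed.

Lemma unull_dom x (y : nat -> A) (K : R) : (forall n, cnorm (y n) <= K * cnorm (x n)) ->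
  unull x -> unull y.
Proof.
move=> yx hx e e0; have K0 : 0 < `|K| + 1 by rewrite ltr_wpDl.
apply: filterS (hx _ (divr_gt0 e0 K0)) => n /= h.
rewrite (le_lt_trans (yx n))// (@le_lt_trans _ _ ((`|K| + 1) * cnorm (x n)))//.
  by rewrite ler_wpM2r// (le_trans (ler_norm _))// lerDl.
by rewrite mulrC -ltr_pdivlMr.
Qed.

Lemma unull_sq x : unull (fun n => star (x n) * x n) -> unull x.
Proof.
move=> h e e0; apply: filterS (h _ (exprn_gt0 2 e0)) => n /=.
by rewrite cnorm_cstar ltr_pXn2r ?nnegrE// ltW.
Qed.

Lemma not_unull x : ~ unull x -> exists2 d : R, 0 < d & ufilter [set n | d <= cnorm (x n)].
Proof.
move=> /existsNP[d /not_implyP[d0 h]]; exists d => //.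
by apply: filterS (ufilter_not h) => n /=; rewrite leNgt => /negP.
Qed.

Lemma unull_cst_eq0 x (c : C) : ~ unull x -> unull (fun n => c *: x n) -> c = 0.
Proof.
move=> nx cx; apply/eqP/negPn/negP => c0; apply: nx.
by apply: (unull_ext _ (unullZ c^-1 cx)) => n; rewrite scalerA mulVf// scale1r.
Qed.

Definition ueigen (b : A) x (c : C) := unull (fun n => b * x n - c *: x n).

Lemma ueigenM a b x (c d : C) : ueigen a x c -> ueigen b x d -> ueigen (a * b) x (c * d).
Proof.
move=> ha hb; apply: (unull_ext _ (unullD (unullM a hb) (unullZ d ha))) => n.
by nc_ring (R[i]).
Qed.

Lemma ueigenD a b x (c d : C) : ueigen a x c -> ueigen b x d -> ueigen (a + b) x (c + d).
Proof.
move=> ha hb; apply: (unull_ext _ (unullD ha hb)) => n.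
by nc_ring (R[i]).
Qed.

Lemma ueigenZ a x (k c : C) : ueigen a x c -> ueigen (k *: a) x (k * c).
Proof.
move=> ha; apply: (unull_ext _ (unullZ k ha)) => n.
by nc_ring (R[i]).
Qed.

Lemma ueigen1 x : ueigen 1 x 1.
Proof. by apply: (unull_ext _ unull0) => n; rewrite mul1r scale1r subrr. Qed.

Lemma ueigen_uniq a x c d : ~ unull x -> ueigen a x c -> ueigen a x d -> c = d.
Proof.
move=> nx hc hd; apply/subr0_eq/(unull_cst_eq0 nx).
apply: (unull_ext _ (unullB hd hc)) => n; by nc_ring (R[i]).
Qed.

Lemma ueigen_comm a b x c : GRing.comm a b -> ueigen a x c -> ueigen a (fun n => b * x n) c.
Proof.
move=> ab h; apply: (unull_ext _ (unullM b h)) => n.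
by rewrite [in RHS]mulrA ab; nc_ring (R[i]).
Qed.

(** Compare x^* (a^* x) with the adjoint of x^* (a x). The bound on x keeps the errors null after
    multiplication by x^*. *)
Lemma ueigen_conj a x c d (M : R) : (forall n, cnorm (x n) <= M) -> ~ unull x ->
  ueigen a x c -> ueigen (star a) x d -> d = conjc c.
Proof.
move=> xM nx hc hd; apply/esym/subr0_eq.
have M0 : 0 <= M by exact: le_trans (xM 0%N).
have bd (y : nat -> A) : unull y -> unull (fun n => star (x n) * y n).
  apply: (@unull_dom _ _ M) => n; rewrite (le_trans (cnormM _ _))// cnorm_star.
  by rewrite ler_wpM2r.
have bs (y : nat -> A) : unull y -> unull (fun n => star (y n)).
  by apply: (@unull_dom _ _ 1) => n; rewrite cnorm_star mul1r.
have nxx : ~ unull (fun n => star (x n) * x n) by move=> /unull_sq.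
apply: (unull_cst_eq0 nxx).
apply: (unull_ext _ (unullB (bd _ hd) (bs _ (bd _ hc)))) => n.
rewrite !starM !starK starB starM starZc.
by nc_ring (R[i]).
Qed.

(** For negative c, the square of s^2 - c is above c^2, so the norm of (s^2 - c) x is at least - c
    times that of x, and x would be null. *)
Lemma ueigen_ge0 s x (c : R) : star s = s -> ~ unull x -> ueigen (s * s) x c%:C -> 0 <= c.
Proof.
move=> hs nx h; rewrite leNgt; apply/negP => c0; apply: nx.
apply: (@unull_dom _ _ (- c)^-1 _ h) => n.
have nc0 : 0 < - c by rewrite oppr_gt0.
rewrite ler_pdivlMl//.
rewrite -(@ler_pXn2r _ 2) ?nnegrE ?mulr_ge0 ?(ltW nc0)// exprMn -!cnorm_cstar.
rewrite -cnormZr ?sqr_ge0//; apply: cnorm_mono.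
  by apply: cposZ; [exact: sqr_ge0|exact: cpos_star].
have -> : s * s * x n - c%:C *: x n = (s * s - c%:C *: 1) * x n by nc_ring (R[i]).
have hw : star (s * s - c%:C *: 1) = s * s - c%:C *: 1.
  by rewrite starB starM hs starZr star1.
rewrite starM hw.
have -> : star (x n) * (s * s - c%:C *: 1) * ((s * s - c%:C *: 1) * x n) -
  ((- c) ^+ 2)%:C *: (star (x n) * x n) =
  star (x n) * (s * s * (s * s) + (2 * - c)%:C *: (s * s)) * x n.
  have -> : ((- c) ^+ 2)%:C = c%:C * c%:C by rewrite sqrrN expr2 rmorphM.
  have -> : (2 * - c)%:C = - c%:C - c%:C by rewrite mulr2n mulrDl !mul1r rmorphD rmorphN.
  by nc_ring (R[i]).
apply: cpos_congr; apply: cposD; first by apply: cpos_sq; rewrite starM hs.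
by apply: cposZ; [rewrite mulr_ge0// ltW|exact: cpos_sq].
Qed.

End NullSequences.

(** * Joint approximate eigenvectors of central elements *)

Section CentralSpectrum.
Variables (R : realType) (A : cstarAlgType R).
Local Notation C := R[i].
Implicit Types (c X : A).

Definition central c := forall a : A, GRing.comm a c.

Lemma sa_cube_eq0 (p : A) : star p = p -> p * p * p = 0 -> p = 0.
Proof.
move=> hp p3; apply: sa_sq_eq0 => //; apply: sa_sq_eq0; first by rewrite starM hp.
by rewrite mulrA p3 mul0r.
Qed.

Lemma star_sq_eq0 X : star X * X = 0 -> X = 0.
Proof.
by move=> h; apply: cnorm0_eq0; apply/eqP; rewrite -sqrf_eq0 -cnorm_cstar h cnorm0.
Qed.

(* [l] is the supremum of the spectral parameters [t] such that [(c - t)_+] does not kill [X]. *)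
Lemma central_step c X (e : R) : star c = c -> central c -> X != 0 -> 0 < e ->
  exists (G : A) (l : R), [/\ star G = G, central G, G * X != 0, `|l| <= cnorm c + 1
    & cpos ((e ^+ 2)%:C *: (star (G * X) * (G * X)) -
       star (G * X) * ((c - l%:C *: 1) * (c - l%:C *: 1)) * (G * X))].
Proof.
move=> hc cc X0 e0.
have hct t : star (c - t%:C *: 1) = c - t%:C *: 1 by rewrite starB starZr star1 hc.
have cct t : central (c - t%:C *: 1).
  by move=> a; apply: commrB; [exact: cc|apply: commrZ; exact: commr1].
pose dec t p n := [/\ c - t%:C *: 1 = p - n, cpos p /\ cpos n, p * n = 0 /\ n * p = 0
  & central p /\ central n].
have decE t : exists p n, dec t p n.
  have [p [n [h1 h2 h3 _ h4]]] := pos_neg_parts (hct t).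
  exists p, n; split=> //; split=> a; have [] := h4 a _; rewrite //; exact: cct.
pose S := [set t : R | exists p n, dec t p n /\ p * X != 0].
(* For this t, c - t - 1 is positive. If p X = 0, then - X^* X - X^* n X is positive, and therefore
   X = 0. *)
have S1 : S (- cnorm c - 1).
  have [p [n [h1 [h2 h2'] h3 h4]]] := decE (- cnorm c - 1).
  exists p, n; split=> //; apply/negP => /eqP pX; move/negP: X0; apply; apply/eqP.
  apply: star_sq_eq0.
  have h5 : cpos (c - (- cnorm c - 1)%:C *: 1 - 1).
    have := cnorm_leP (x := - c) _ (lexx _); rewrite starN hc cnormN => /(_ erefl).
    have -> // : (cnorm c)%:C *: 1 - - c = c - (- cnorm c - 1)%:C *: 1 - 1.
    by rewrite rmorphB rmorphN rmorph1; nc_ring (R[i]).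
  have := cpos_congr X h5; rewrite h1.
  have -> : star X * (p - n - 1) * X = star X * (p * X) - star X * n * X - star X * X.
    by nc_ring (R[i]).
  rewrite pX mulr0 sub0r -opprD => h6; apply: cpos_anti; first exact: cpos_star.
  have h7 := cpos_congr X h2'.
  by have := cposD h6 h7; rewrite opprD addrC addrA subrr add0r.
have Sub t : S t -> t <= cnorm c.
  move=> [p [n [[h1 [h2 h2'] [h3 h3'] h4] pX]]]; rewrite leNgt; apply/negP => ct.
  move/negP: pX; apply; apply/eqP.
  have hp := cpos_sa h2.
  suff -> : p = 0 by rewrite mul0r.
  apply: sa_cube_eq0 => //.
  have e1 : p * p * p = p * (c - t%:C *: 1) * p by rewrite h1 mulrBr h3 subr0.
  apply: cpos_anti; first by rewrite -{1}hp; exact: cpos_congr.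
  have -> : - (p * p * p) = p * (t%:C *: 1 - c) * p by rewrite e1; nc_ring (R[i]).
  rewrite -{1}hp; apply: cpos_congr.
  by apply: cnorm_leP => //; exact: ltW.
have hS : has_sup S by split; [exists (- cnorm c - 1)|exists (cnorm c) => t /Sub].
pose l := sup S.
have l1 : - cnorm c - 1 <= l by apply: ub_le_sup => //; case: hS.
have l2 : l <= cnorm c by apply: ge_sup => //; case: hS.
have [t1 [p1 [n1 [[a1 [b1 b1'] [c1 c1'] [d1 d1']] p1X]]] lt1] := sup_adherent e0 hS.
have t1l : t1 <= l by apply: ub_le_sup; [case: hS|exists p1, n1].
have [p2 [n2 [a2 [b2 b2'] [c2 c2'] [d2 d2']]]] := decE (l + e).
have p2X : p2 * X = 0.
  apply/eqP/negPn/negP => h; have : S (l + e) by exists p2, n2.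
  by move/(ub_le_sup hS.2); rewrite -/l; lra.
exists p1, l; split=> //; first exact: cpos_sa.
  by rewrite ler_norml; apply/andP; split; lra.
set Y := p1 * X.
have e1 : (c - t1%:C *: 1) * Y = p1 * Y.
  by rewrite a1 mulrBl {2}/Y [n1 * _]mulrA c1' mul0r subr0.
have e2 : (c - (l + e)%:C *: 1) * Y = - (n2 * Y).
  rewrite a2 mulrBl {1}/Y mulrA -(d2 p1) -mulrA p2X mulr0 sub0r//.
(* On Y, e^2 - (c - l)^2 is the product of c - l + e = (c - t1) + d and l + e - c. The former acts
   as p1 + d, with d nonnegative by the choice of t1, and the latter acts as n2 because p2 kills
   X. *)
pose d := (e - (l - t1))%:C.
have e3 : (e ^+ 2)%:C *: Y - (c - l%:C *: 1) * ((c - l%:C *: 1) * Y) = (p1 + d *: 1) * n2 * Y.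
  have -> : (e ^+ 2)%:C *: Y - (c - l%:C *: 1) * ((c - l%:C *: 1) * Y) =
    - (((c - t1%:C *: 1) + d *: 1) * ((c - (l + e)%:C *: 1) * Y)).
    rewrite /d; have -> : (e ^+ 2)%:C = e%:C * e%:C by rewrite expr2 rmorphM.
    have -> : (e - (l - t1))%:C = e%:C - (l%:C - t1%:C) by rewrite !rmorphB.
    by rewrite [(l + e)%:C]rmorphD; nc_ring (R[i]).
  have e4 : (c - t1%:C *: 1 + d *: 1) * Y = (p1 + d *: 1) * Y.
    by rewrite mulrDl e1 -mulrDl.
  by rewrite e2 mulrN opprK mulrA !d2' -!mulrA e4.
have -> : (e ^+ 2)%:C *: (star Y * Y) - star Y * ((c - l%:C *: 1) * (c - l%:C *: 1)) * Y =
   star Y * ((e ^+ 2)%:C *: Y - (c - l%:C *: 1) * ((c - l%:C *: 1) * Y)).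
  by nc_ring (R[i]).
rewrite e3 mulrA; apply: cpos_congr; apply: cposM => //.
by apply: cposD => //; apply: cpos_scal; rewrite -/l in lt1; lra.
Qed.

(** The elements are treated one after the other: replacing G by H G conjugates the previous
    estimates by the central element H, which preserves positivity. *)
Lemma central_approx (K : finType) (c : K -> A) X (e : R) :
  (forall k, star (c k) = c k) -> (forall k, central (c k)) -> X != 0 -> 0 < e ->
  exists (G : A) (l : K -> R), [/\ star G = G, central G, G * X != 0
    & forall k, `|l k| <= cnorm (c k) + 1 /\
      cpos ((e ^+ 2)%:C *: (star (G * X) * (G * X)) -
       star (G * X) * ((c k - (l k)%:C *: 1) * (c k - (l k)%:C *: 1)) * (G * X))].
Proof.
move=> hc cc X0 e0.
suff [G [l [h1 h2 h3 h4]]] : exists (G : A) (l : K -> R), [/\ star G = G, central G, G * X != 0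
    & forall k, k \in enum K -> `|l k| <= cnorm (c k) + 1 /\
      cpos ((e ^+ 2)%:C *: (star (G * X) * (G * X)) -
       star (G * X) * ((c k - (l k)%:C *: 1) * (c k - (l k)%:C *: 1)) * (G * X))].
  by exists G, l; split=> // k; apply: h4; rewrite mem_enum.
elim: (enum K) => [|k s [G [l [h1 h2 h3 h4]]]].
  exists 1, (fun=> 0); split; rewrite ?star1 ?mul1r//; by move=> a; exact: commr1.
have [H [m [g1 g2 g3 g4 g5]]] := central_step (hc k) (cc k) h3 e0.
rewrite mulrA in g3 g5.
exists (H * G), (fun j => if j == k then m else l j); split=> //.
- by rewrite starM h1 g1; exact: g2.
- by move=> a; apply: commrM.
move=> j; rewrite inE; have [->|jk] /= := eqVneq j k; first by [].
move=> /h4[? h5]; split=> //.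
have e1 : H * G * X = (G * X) * H by rewrite -mulrA g2.
rewrite e1 starM g1; set Z := G * X in h5 *; set W := (_ - _) * (_ - _) in h5 *.
have -> : (e ^+ 2)%:C *: (H * star Z * (Z * H)) - H * star Z * W * (Z * H) =
  H * ((e ^+ 2)%:C *: (star Z * Z) - star Z * W * Z) * H by nc_ring (R[i]).
by rewrite -{1}g1; exact: cpos_congr.
Qed.

(** After normalization of G X, the error in [central_approx] at precision 1 / (n + 1) becomes a
    norm estimate. The approximate eigenvalues stay bounded, so they converge along the
    ultrafilter. *)
Lemma central_limit (K : finType) (c : K -> A) X :
  (forall k, star (c k) = c k) -> (forall k, central (c k)) -> X != 0 ->
  exists (F G : nat -> A) (l : K -> C), [/\ forall n, F n = G n * X,
    forall n, star (G n) = G n /\ central (G n), forall n, cnorm (F n) = 1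
    & forall k, ueigen (c k) F (l k)].
Proof.
move=> hc cc X0.
have /choice[GL hGL] : forall n, exists GL : A * (K -> R), let G := GL.1 in let l := GL.2 in
   [/\ star G = G, central G, cnorm (G * X) = 1
    & forall k, `|l k| <= cnorm (c k) + 1 /\ cnorm ((c k - (l k)%:C *: 1) * (G * X)) <= n.+1%:R^-1].
  move=> n; have e0 : 0 < (n.+1%:R^-1 : R) by rewrite invr_gt0.
  have [G [l [h1 h2 h3 h4]]] := central_approx hc cc X0 e0.
  have g0 : 0 < cnorm (G * X).
    by rewrite lt_def cnorm_ge0 andbT; apply: contra h3 => /eqP/cnorm0_eq0/eqP.
  exists ((cnorm (G * X))^-1%:C *: G, l); rewrite /=; split.
  - by rewrite starZr h1.
  - by move=> a; apply: commrZ.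
  - by rewrite -scalerAl cnormZVr// mulVf// gt_eqF.
  move=> k; have [h5 h6] := h4 k; split=> //.
  rewrite -scalerAl -scalerAr cnormZVr// ler_pdivrMl// mulrC.
  rewrite -(@ler_pXn2r _ 2) ?nnegrE ?mulr_ge0 ?(ltW e0)// exprMn -!cnorm_cstar.
  rewrite -cnormZr ?sqr_ge0//.
  have hs : star (c k - (l k)%:C *: 1) = c k - (l k)%:C *: 1 by rewrite starB starZr star1 hc.
  apply: cnorm_mono; first exact: cpos_star.
  by rewrite [star ((c k - _) * _)]starM hs; move: h6; rewrite !mulrA.
pose l k n := (GL n).2 k.
have /choice[L hL] : forall k, exists L, ucvg (fun n => (l k n)%:C) L.
  move=> k; apply: (@complex_ultralimit _ _ (cnorm (c k) + 1)) => n.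
  have [_ _ _ /(_ k)[h _]] := hGL n.
  by rewrite -lecR -cnE normc_def /= expr0n addr0 sqrtr_sqr lecR.
exists (fun n => (GL n).1 * X), (fun n => (GL n).1), L; split=> // [n|n|k]; try by have [] := hGL n.
move=> e e0; have e2 : 0 < e / 2 by rewrite divr_gt0.
apply: filterS2 (ufilter_inv e2) (hL k _ e2) => n /= h1 h2.
have [_ _ h3 /(_ k)[_ h4]] := hGL n.
set F := (GL n).1 * X in h3 h4 *.
have -> : c k * F - L k *: F = (c k - (l k n)%:C *: 1) * F + ((l k n)%:C - L k) *: F.
  by nc_ring (R[i]).
rewrite (le_lt_trans (cnormD _ _))// (splitr e) ltrD//; first exact: le_lt_trans h1.
by rewrite cnormZc h3 mulr1.
Qed.

(* The cut-off [X] of [a* a] above half of its norm keeps [a] away from zero. *)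
Lemma central_limit_nonnull (K : finType) (c : K -> A) (a : A) :
  (forall k, star (c k) = c k) -> (forall k, central (c k)) -> a != 0 ->
  exists (F : nat -> A) (l : K -> C), [/\ forall n, cnorm (F n) = 1,
    ~ unull (fun n => a * F n) & forall k, ueigen (c k) F (l k)].
Proof.
move=> hc cc a0.
pose r := cnorm a ^+ 2 / 2.
have na : 0 < cnorm a by rewrite lt_def cnorm_ge0 andbT; apply: contra a0 => /eqP/cnorm0_eq0 ->.
have r0 : 0 < r by rewrite divr_gt0// exprn_gt0.
have hp : star (star a * a) = star a * a by rewrite starM starK.
have hx : star (star a * a - r%:C *: 1) = star a * a - r%:C *: 1.
  by rewrite starB hp starZr star1.
have [X [n [xE [pX pn] [Xn nX] _ _]]] := pos_neg_parts hx.
have hX := cpos_sa pX.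
have X0 : X != 0.
  apply/eqP => X0; have : cnorm (star a * a) <= r.
    apply: cpos_le; [exact: ltW|exact: cpos_star|].
    by rewrite -opprB xE X0 sub0r opprK.
  by rewrite cnorm_cstar /r; have := exprn_gt0 2 na; lra.
have [F [G [l [FE hG F1 Fl]]]] := central_limit hc cc X0.
exists F, l; split=> // aF.
have h m : r <= cnorm a * cnorm (a * F m).
  have [hGm cG] := hG m.
  have -> : r = cnorm (r%:C *: (star (F m) * F m)).
    by rewrite cnormZr ?(ltW r0)// cnorm_cstar F1 expr1n mulr1.
  apply: (@le_trans _ _ (cnorm (star (F m) * (star a * a) * F m))).
    apply: cnorm_mono; first by apply: cposZ; [exact: ltW|exact: cpos_star].
    have -> : star (F m) * (star a * a) * F m - r%:C *: (star (F m) * F m) =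
       star (F m) * (star a * a - r%:C *: 1) * F m by nc_ring (R[i]).
    have -> : star (F m) * (star a * a - r%:C *: 1) * F m = star (G m) * (X * X * X) * G m.
      rewrite FE starM hX hGm xE -(cG X).
      have e : (X - n) * X = X * X by rewrite mulrBl nX subr0.
      rewrite -[_ * (X - n) * _]mulrA (mulrA (X - n)) e.
      by rewrite (cG X) !mulrA.
    by apply: cpos_congr; rewrite -{1}hX; exact: cpos_congr.
  rewrite -mulrA (le_trans (cnormM _ _))// cnorm_star F1 mul1r -mulrA.
  by rewrite (le_trans (cnormM _ _))// cnorm_star.
have [m /= hm] := filter_ex (aF _ (divr_gt0 r0 na)).
by have := h m; rewrite ltr_pdivlMr// mulrC in hm; lra.
Qed.

End CentralSpectrum.

Section HalfCommuting.
Variables (R : realType) (A : cstarAlgType R) (I : finType) (u : I -> A).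
Local Notation C := R[i].
Hypothesis u_sa : forall i, star (u i) = u i.
Hypothesis u_hc : forall i j k, u i * u j * u k = u k * u j * u i.
Hypothesis u_gen : cstar_generated (range u).
Hypothesis u_sum : forall i : I, exists s : seq I, \sum_(j <- s) u j * u j = 1.

Lemma central_of_gen c : star c = c -> (forall i, GRing.comm (u i) c) -> central c.
Proof.
move=> hc uc a; move: a; apply: (cgen_rep u_gen); last by move=> _ [i _ <-].
split.
- move=> a ha; apply/subr0_eq/cnorm_small => e e0.
  have K0 : 0 < 2 * cnorm c + 1 by rewrite ltr_wpDl// mulr_ge0.
  have [b /= hb ab] := ha _ (divr_gt0 e0 K0).
  have -> : a * c - c * a = (a - b) * c - c * (a - b).
    by rewrite mulrBl hb; nc_ring (R[i]).
  rewrite (le_trans (cnormB _ _))//.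
  have h1 := cnormM (a - b) c; have h2 := cnormM c (a - b).
  rewrite mulrC in h2; rewrite ltr_pdivlMr// in ab.
  have : cnorm (a - b) * (2 * cnorm c + 1) = 2 * (cnorm (a - b) * cnorm c) + cnorm (a - b) by ring.
  have := cnorm_ge0 (a - b); lra.
- exact: commr_sym (commr1 _).
- move=> k a b ha hb; apply: commr_sym; apply: commrD; last exact: commr_sym.
  by apply: commrZ; exact: commr_sym.
- by move=> a b ha hb; apply: commr_sym; apply: commrM; apply: commr_sym.
- by move=> a /(congr1 star); rewrite !starM hc => e; apply: esym.
Qed.

Let ci : C := Complex 0 1.
Let mul_ci : ci * ci = -1.
Proof. by apply/eqP; rewrite eq_complex /= !mul0r !mulr0 mul1r !addr0 add0r oppr0 !eqxx. Qed.
Let conj_ci : conjc ci = - ci.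
Proof. by apply/eqP; rewrite eq_complex /= oppr0 !eqxx. Qed.

(** The anticommutators x are central, by half-commutation. The commutators, made self-adjoint as y,
    anticommute with every coordinate: they are not central, but their products are. *)
Let x (p : I * I) := u p.1 * u p.2 + u p.2 * u p.1.
Let y (p : I * I) := ci *: (u p.1 * u p.2 - u p.2 * u p.1).

Let x_sa p : star (x p) = x p.
Proof. by rewrite starD !starM !u_sa addrC. Qed.

Let y_sa p : star (y p) = y p.
Proof. by rewrite starZc starB !starM !u_sa conj_ci scaleNr -scalerN opprB. Qed.

Let x_central p : central (x p).
Proof.
apply: central_of_gen => // k; rewrite /GRing.comm mulrDr mulrDl !mulrA.
by rewrite (u_hc k p.1) (u_hc k p.2) addrC.
Qed.

Let uy k p : u k * y p = - (y p * u k).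
Proof.
rewrite -scalerAr -scalerAl -scalerN mulrBr mulrBl !mulrA opprB.
by rewrite (u_hc k p.1) (u_hc k p.2).
Qed.

Lemma even_comm i j k l : GRing.comm (u i * u j) (u k * u l).
Proof.
rewrite /GRing.comm !mulrA (u_hc i j k) -[in LHS]mulrA -[in LHS]mulrA.
by rewrite [u j * _]mulrA (u_hc j i l) !mulrA.
Qed.

Let y_comm p q : GRing.comm (y p) (y q).
Proof.
apply: commrZ; apply: commr_sym; apply: commrZ.
by apply: commrB; apply: commr_sym; apply: commrB; exact: even_comm.
Qed.

Let yy_central p q : central (y p * y q).
Proof.
apply: central_of_gen; first by rewrite starM !y_sa; exact: y_comm.
by move=> k; rewrite /GRing.comm mulrA uy mulNr -mulrA uy mulrN opprK mulrA.
Qed.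

Let u_xy i j : u i * u j = (2^-1 : R)%:C *: (x (i, j) + (- ci) *: y (i, j)).
Proof.
rewrite /y scalerA mulNr mul_ci opprK scale1r /x /= addrACA subrr addr0.
have kk : (2^-1 : R)%:C + (2^-1 : R)%:C = 1 :> C.
  by rewrite -rmorphD -(rmorph1 (real_complex R)); congr (_ %:C); lra.
by rewrite -[LHS]scale1r -kk; nc_ring (R[i]).
Qed.

(** Start from a joint eigenvector F of the x and of the products y y. If every y kills F, it is
    already an eigenvector of all y. Otherwise choose y0 with y0 F not null; the eigenvalue of y0^2
    is some s^2 with s nonzero, and (s + y0) F and (- s + y0) F are joint eigenvectors of the y.
    Their difference is 2 s F, so a does not kill both of them. *)
Lemma even_eigen (a : A) : a != 0 ->
  exists (F : nat -> A) (M : R) (b : I -> I -> C), [/\ forall n, cnorm (F n) <= M,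
    ~ unull (fun n => a * F n) & forall i j, ueigen (u i * u j) F (b i j)].
Proof.
move=> a0.
pose c (k : (I * I) + (I * I) * (I * I)) :=
  match k with inl p => x p | inr pq => y pq.1 * y pq.2 end.
have [||F [l [F1 aF Fl]]] := @central_limit_nonnull _ _ _ c _ _ _ a0.
- by case=> [p|[p q]]; rewrite /c //= starM !y_sa; exact: y_comm.
- by case=> [p|[p q]]; [exact: x_central|exact: yy_central].
have fin (H : nat -> A) (M : R) (eta : I * I -> C) : (forall n, cnorm (H n) <= M) ->
    ~ unull (fun n => a * H n) -> (forall p, ueigen (x p) H (l (inl p))) ->
    (forall p, ueigen (y p) H (eta p)) ->
    exists (F : nat -> A) (M : R) (b : I -> I -> C), [/\ forall n, cnorm (F n) <= M,
    ~ unull (fun n => a * F n) & forall i j, ueigen (u i * u j) F (b i j)].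
  move=> HM aH hx hy.
  exists H, M, (fun i j => (2^-1 : R)%:C * (l (inl (i, j)) + (- ci) * eta (i, j))).
  split=> // i j; rewrite u_xy; apply: ueigenZ; apply: ueigenD; first exact: hx.
  by apply: ueigenZ.
have hx p : ueigen (x p) F (l (inl p)) := Fl (inl p).
have hw p q : ueigen (y p * y q) F (l (inr (p, q))) := Fl (inr (p, q)).
have [hy|/existsNP[p0 y0]] := pselect (forall p, unull (fun n => y p * F n)).
  apply: (fin F 1 (fun=> 0)) => //; first by move=> n; rewrite F1.
  by move=> p; apply: (unull_ext _ (hy p)) => n; rewrite scale0r subr0.
pose om := l (inr (p0, p0)).
have om0 : om != 0.
  apply/eqP => om0; apply: y0; apply: unull_sq.
  have := hw p0 p0; rewrite /ueigen -/om om0; apply: (@unull_dom _ _ _ _ 1) => n.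
  rewrite starM y_sa mul1r scale0r subr0 -mulrA (le_trans (cnormM _ _))//.
  by rewrite cnorm_star F1 mul1r mulrA.
pose H t n := (t *: 1 + y p0) * F n.
have HE t q : t * t = om -> ueigen (y q) (H t) (l (inr (q, p0)) / t).
  move=> tt; have t0 : t != 0 by apply: contra om0 => /eqP t0; rewrite -tt t0 mul0r.
  have e1 := hw q p0; have e2 := hw p0 p0; rewrite -/om in e2.
  apply: (unull_ext _ (unullD e1 (unullZ (t / om) (unullB (unullM (y p0) e1) (unullM (y q) e2))))) => n.
  have e3 : y q * (y p0 * y p0 * F n) = y p0 * (y q * y p0 * F n).
    by rewrite !mulrA -(y_comm p0 q).
  rewrite /H [y q * (y p0 * y p0 * F n - _)]mulrBr e3; set w := l _.
  nc_ring (R[i]); by rewrite -?tt; field; rewrite ?t0.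
have Hx t p : ueigen (x p) (H t) (l (inl p)).
  apply: ueigen_comm (hx p); apply: commr_sym; exact: x_central.
pose s := sqrtc om.
have ss : s * s = om by rewrite -expr2 sqr_sqrtc.
have s0 : s != 0 by apply: contra om0 => /eqP s0; rewrite -ss s0 mul0r.
have HM t n : cnorm (H t n) <= cnorm (t *: 1 + y p0).
  by rewrite (le_trans (cnormM _ _))// F1 mulr1.
have [h1|/contrapT h1] := pselect (~ unull (fun n => a * H s n)).
  by apply: (fin (H s) _ (fun q => l (inr (q, p0)) / s)) => // q; exact: HE.
have [h2|/contrapT h2] := pselect (~ unull (fun n => a * H (- s) n)).
  apply: (fin (H (- s)) _ (fun q => l (inr (q, p0)) / - s)) => // q.
  by apply: HE; rewrite mulrNN.
exfalso; apply: aF; apply: (unull_ext _ (unullZ (2 * s)^-1 (unullB h1 h2))) => n.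
rewrite /H; nc_ring (R[i]); by field; rewrite s0.
Qed.

Lemma scalar_bound (F w : nat -> A) (z : C) (d L : R) :
  0 < d -> ufilter [set n | d <= cnorm (F n)] -> (forall n, cnorm (w n) <= L) ->
  unull (fun n => w n - z *: F n) -> cn z <= L / d.
Proof.
move=> d0 Fd wL h; rewrite ler_pdivlMr//; apply/ler_addgt0Pr => e e0.
have [n /= [h1 h2]] := filter_ex (filterI Fd (h _ e0)).
apply: (@le_trans _ _ (cnorm (z *: F n))).
  by rewrite cnormZc ler_wpM2l.
have -> : z *: F n = w n - (w n - z *: F n) by rewrite opprB addrC subrK.
by rewrite (le_trans (cnormB _ _))// lerD// ltW.
Qed.

(** Modulo null sequences, the span of the F j is stable under b, with matrix m. The F j may be
    dependent; the bound assumed in [module_rep] is what makes m unique. *)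
Definition uact (J : finType) (F : J -> nat -> A) (b : A) (m : J -> J -> C) :=
  forall j, unull (fun n => b * F j n - \sum_k m k j *: F k n).

Section ApproximateModule.
Variables (J : finType) (F : J -> nat -> A) (L : R).
Hypothesis FL : forall j n, cnorm (F j n) <= L.

Lemma uact1 : uact F 1 (fun i j => (i == j)%:R).
Proof.
move=> j; apply: (unull_ext _ (unull0 A)) => n; rewrite mul1r (bigD1 j)//= eqxx scale1r.
by rewrite big1 ?addr0 ?subrr// => k /negbTE ->; rewrite scale0r.
Qed.

Lemma uactZD c a b m m' : uact F a m -> uact F b m' ->
  uact F (c *: a + b) (fun i j => c * m i j + m' i j).
Proof.
move=> ha hb j; apply: (unull_ext _ (unullD (unullZ c (ha j)) (hb j))) => n.
under [in RHS]eq_bigr do rewrite scalerDl -scalerA.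
rewrite big_split/= -scaler_sumr; set S1 := \sum_i m i j *: _; set S2 := \sum_i m' i j *: _.
by nc_ring (R[i]).
Qed.

Lemma uactM a b m m' : uact F a m -> uact F b m' ->
  uact F (a * b) (fun i j => \sum_k m i k * m' k j).
Proof.
move=> ha hb j.
have h := unull_sum (enum J) (fun k => unullZ (m' k j) (ha k)).
apply: (unull_ext _ (unullD (unullM a (hb j)) h)) => n.
rewrite big_enum /= mulrBr mulrA mulr_sumr -addrA; congr (_ + _).
under [X in _ + X]eq_bigr do rewrite scalerBr scalerAr.
rewrite big_split/= addrA addNr add0r sumrN; congr (- _).
under [LHS]eq_bigr do rewrite scaler_sumr.
rewrite exchange_big/=; apply: eq_bigr => k _; rewrite scaler_suml.
by apply: eq_bigr => i _; rewrite scalerA mulrC.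
Qed.

Lemma module_rep (K : R) (m : I -> J -> J -> C) :
  (forall b M, uact F b M -> forall i j, cn (M i j) <= K * cnorm b) ->
  (forall i, uact F (u i) (m i)) -> (forall i j k, conjc (m i k j) = m i j k) ->
  exists rho : A -> J -> J -> C, [/\ rep rho, forall i, rho (u i) = m i
    & forall b, uact F b (rho b)].
Proof.
move=> bd um mS.
(* The action of star b cannot be read off from that of b, so the graph records both; otherwise it
   would not be stable under the adjoint. *)
pose D b (M : J -> J -> C) := uact F b M /\ uact F (star b) (fun i j => conjc (M j i)).
have Du i : D (u i) (m i).
  split=> //; rewrite u_sa; have -> // : (fun j k => (m i k j)^*%C) = m i.
  by apply/funext => j; apply/funext => k; exact: mS.
have [||||||rho hr rD] := @rep_extend _ A J (range u) D K u_gen.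
- split; first exact: uact1.
  rewrite star1; have -> : (fun i j : J => ((j == i)%:R : C)^*%C) = (fun i j => (i == j)%:R).
    by apply/funext => i; apply/funext => j; rewrite conjc_nat eq_sym.
  exact: uact1.
- move=> c a b M M' [h1 h2] [h3 h4]; split; first exact: uactZD.
  rewrite starD starZc; have := uactZD (conjc c) h2 h4.
  have -> // : (fun i j : J => (c^*%C * (M j i)^*%C + (M' j i)^*%C)) = (fun i j => (c * M j i + M' j i)^*%C).
  by apply/funext => i; apply/funext => j; rewrite rmorphD rmorphM.
- move=> a b M M' [h1 h2] [h3 h4]; split; first exact: uactM.
  rewrite starM; have := uactM h4 h2.
  have -> // : (fun i j : J => \sum_k (M' k i)^*%C * (M j k)^*%C) = (fun i j => (\sum_k M j k * M' k i)^*%C).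
  apply/funext => i; apply/funext => j; rewrite rmorph_sum; apply: eq_bigr => k _.
  by rewrite rmorphM mulrC.
- move=> b M [h1 h2]; split=> //; rewrite starK.
  by under eq_fun do under eq_fun do rewrite conjcK.
- by move=> b M [h1 _] i j; exact: bd h1 i j.
- by move=> _ [i _ <-]; exists (m i).
have ru i : rho (u i) = m i by exact: rD.
exists rho; split=> //.
suff h b : uact F b (rho b) /\ uact F (star b) (rho (star b)) by move=> b; case: (h b).
have rE a c : (forall i j, rho a i j = c i j) -> rho a = c.
  by move=> h; apply/funext => i; apply/funext => j; exact: h.
move: b; apply: (cgen_rep u_gen); last first.
  by move=> _ [i _ <-]; rewrite /= u_sa ru.
split.
- have cl b : (forall e : R, 0 < e -> exists2 c, uact F c (rho c) & cnorm (b - c) < e) ->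
      uact F b (rho b).
    move=> h j e e0; have L0 : 0 <= L by exact: le_trans (FL j 0%N).
    pose Q := L + \sum_(k : J) L + 1.
    have Q0 : 0 < Q by rewrite ltr_wpDl// addr_ge0// sumr_ge0.
    have [c hc bc] := h _ (divr_gt0 (divr_gt0 e0 (ltr0n _ 2)) Q0).
    apply: filterS (hc j _ (divr_gt0 e0 (ltr0n _ 2))) => n /= hn.
    have -> : b * F j n - \sum_k rho b k j *: F k n = ((b - c) * F j n -
        \sum_k rho (b - c) k j *: F k n) + (c * F j n - \sum_k rho c k j *: F k n).
      under [X in _ = _ - X + _]eq_bigr do rewrite (repB hr) scalerBl.
      rewrite sumrB; set S1 := \sum_k rho b k j *: _; set S2 := \sum_k rho c k j *: _.
      by nc_ring (R[i]).
    rewrite (le_lt_trans (cnormD _ _))// (splitr e) ler_ltD//.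
    rewrite (@le_trans _ _ (cnorm (b - c) * Q))//; last by rewrite -ler_pdivlMr// ltW.
    rewrite (le_trans (cnormB _ _))// /Q mulrDr mulr1 mulrDr -[leLHS]addr0 lerD//.
    rewrite lerD//; first by rewrite (le_trans (cnormM _ _))// ler_wpM2l.
    rewrite (le_trans (cnorm_sum _ _ _))//.
    rewrite mulr_sumr.
    by apply: ler_sum => k _; rewrite cnormZc ler_pM// (rep_bound hr).
  move=> b hb; split; apply: cl => e e0; have [c [h1 h2] bc] := hb _ e0.
    by exists c.
  by exists (star c) => //; rewrite -starB cnorm_star.
- rewrite /= star1; have -> : rho 1 = (fun i j => (i == j)%:R) by apply: rE => i j; rewrite (rep1 hr).
  by split; exact: uact1.
- move=> c a b [h1 h2] [h3 h4] /=; rewrite starD starZc; split.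
    rewrite (rE _ _ (fun i j => repZD hr c a b i j)); exact: uactZD.
  rewrite (rE _ _ (fun i j => repZD hr (conjc c) (star a) (star b) i j)); exact: uactZD.
- move=> a b [h1 h2] [h3 h4] /=; rewrite starM; split.
    rewrite (rE _ _ (fun i j => repM hr a b i j)); exact: uactM.
  rewrite (rE _ _ (fun i j => repM hr (star b) (star a) i j)); exact: uactM.
- by move=> a [h1 h2] /=; rewrite starK; split.
Qed.

End ApproximateModule.

Lemma char_of_eigen (a : A) (F : nat -> A) (M : R) (z : I -> C) :
  (forall n, cnorm (F n) <= M) -> ~ unull (fun n => a * F n) ->
  (forall i, ueigen (u i) F (z i)) ->
  exists rho : A -> unit -> unit -> C, [/\ rep rho, forall i, rho (u i) tt tt = z i
    & rho a tt tt != 0].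
Proof.
move=> FM aF hz.
have nF : ~ unull F by move=> /(unullM a).
have [d d0 Fd] := not_unull nF.
have su (V : nmodType) (f : unit -> V) : \sum_k f k = f tt by rewrite (big_pred1 tt)//; case.
have act b (m : unit -> unit -> C) : uact (fun=> F) b m <-> ueigen b F (m tt tt).
  split=> h; first by apply: (unull_ext _ (h tt)) => n; rewrite su.
  by case; apply: (unull_ext _ h) => n; rewrite su.
have [||||rho [hr ru ra]] := @module_rep unit (fun=> F) M _ (M / d) (fun i _ _ => z i).
- by move=> _; exact: FM.
- move=> b m /act h [] []; rewrite mulrAC [M * _]mulrC.
  apply: (scalar_bound d0 Fd _ h) => n.
  by rewrite (le_trans (cnormM _ _))// ler_wpM2l.
- by move=> i; apply/act; exact: hz.
- move=> i _ _; have := ueigen_conj FM nF (hz i) (d := z i).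
  by rewrite u_sa => /(_ (hz i)).
exists rho; split=> //; first by move=> i; rewrite ru.
have /act ha := ra a; apply/eqP => a0; apply: aF; apply: (unull_ext _ ha) => n.
by rewrite a0 scale0r subr0.
Qed.

Lemma sum_bool (V : nmodType) (f : bool -> V) : \sum_k f k = f true + f false.
Proof. by rewrite big_bool. Qed.

(* The entries of [[0, z], [conj z, 0]], with rows and columns indexed by false,
   true in this order. *)
Definition J2 (z : C) (i j : bool) : C :=
  if i == j then 0 else if j then z else conjc z.

Lemma J2_herm z j k : conjc (J2 z k j) = J2 z j k.
Proof. by case: j; case: k; rewrite /J2 /= ?oppr0// conjcK. Qed.

(** Let b i j be the eigenvalue of u i u j on F. By half-commutation F and u q0 F span a module
    stable under all coordinates, and b has rank one. If b is symmetric, the module is split by the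
    elements t + u q0 with t^2 = b q0 q0, and a survives in one of two characters. Otherwise some
    even product has distinct eigenvalues on F and u q0 F; these are then independent and carry a
    pair representation with v i = b i q0 / r, where r^2 = b q0 q0. *)
Theorem enough_reps (a : A) : a != 0 ->
  (exists2 rho : A -> unit -> unit -> C, rep rho & rho a tt tt != 0) \/
  (exists (rho : A -> bool -> bool -> C) (v : I -> C), [/\ rep rho, forall i, rho (u i) = J2 (v i),
    exists i j, v i * conjc (v j) != conjc (v i) * v j & exists i j, rho a i j != 0]).
Proof.
move=> a0; have [F [M [b [FM aF hb]]]] := even_eigen a0.
have nF : ~ unull F by move=> /(unullM a).
(* Without coordinates there is no row of which the squares add up to 1, hence no q0 to choose. *)
have [I0|/existsNP[i0 _]] := pselect (forall i : I, False).
  left; have [rho [hr _ ra]] := @char_of_eigen a F M (fun=> 0) FM aF (fun i => False_ind _ (I0 i)).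
  by exists rho.
have bC i j : b j i = conjc (b i j).
  by apply: (ueigen_conj FM nF (hb i j)); rewrite starM !u_sa; exact: hb.
have [q0 bo] : exists q0, b q0 q0 != 0.
  apply: contrapT => /forallNP h; have [s us] := u_sum i0.
  have : ueigen (\sum_(j <- s) u j * u j) F 0.
    elim: s {us} => [|j s ih]; first by rewrite big_nil; apply: (unull_ext _ (unull0 A)) => n; rewrite mul0r scale0r subrr.
    have e : ueigen (u j * u j) F 0 by have := hb j j; have /negP/negPn/eqP -> := h j.
    by rewrite big_cons; have := ueigenD e ih; rewrite addr0.
  rewrite us => /(ueigen_uniq nF (ueigen1 F))/eqP; by rewrite oner_eq0.
have bM i j : b i q0 * b q0 j = b i j * b q0 q0.
  apply: (ueigen_uniq nF (ueigenM (hb i q0) (hb q0 j))).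
  have -> : u i * u q0 * (u q0 * u j) = u i * u j * (u q0 * u q0).
    by rewrite !mulrA -2!(mulrA (u i)) u_hc !mulrA.
  exact: ueigenM (hb i j) (hb q0 q0).
have br : exists2 r : R, 0 < r & b q0 q0 = (r * r)%:C.
  have e : b q0 q0 = (complex.Re (b q0 q0))%:C.
    have := bC q0 q0; case: (b q0 q0) => p q /eqP; rewrite eq_complex /= => /andP[_ /eqP h].
    by congr (Complex _ _); lra.
  have h0 : 0 <= complex.Re (b q0 q0).
    by apply: (ueigen_ge0 (u_sa q0) nF); rewrite -e; exact: hb.
  exists (Num.sqrt (complex.Re (b q0 q0))).
    rewrite sqrtr_gt0 lt_def h0 andbT; apply: contra bo => /eqP h; by rewrite e h.
  by rewrite -expr2 sqr_sqrtr.
case: br => r r0 br; pose rc : C := r%:C.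
have rc0 : rc != 0 by rewrite /rc -(rmorph0 (real_complex R)) (inj_eq (@complexI R)) gt_eqF.
have brc : b q0 q0 = rc * rc by rewrite br rmorphM.
(* Half-commutation moves u i across the square of u q0, which is a nonzero scalar on F; so all the
   u i F are proportional to u q0 F. *)
have uF i : unull (fun n => u i * F n - (b q0 i / (rc * rc)) *: (u q0 * F n)).
  apply: (unull_ext _ (unullZ (rc * rc)^-1 (unullB (unullM (u q0) (hb q0 i)) (unullM (u i) (hb q0 q0))))) => n.
  have e : u q0 * (u q0 * u i * F n) = u i * (u q0 * u q0 * F n) by rewrite !mulrA u_hc.
  rewrite !mulrBr e brc; nc_ring (R[i]); by field; rewrite ?rc0.
have Mge0 : 0 <= M by exact: le_trans (FM 0%N).
have [sym|/existsNP[i1 /existsNP[j1 nsym]]] := pselect (forall i j, b i j = b j i).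
  left; pose H t n := (t *: 1 + u q0) * F n.
  have HE t i : t * t = rc * rc -> ueigen (u i) (H t) (b i q0 / t).
    move=> tt; have t0 : t != 0 by apply: contra bo => /eqP t0; rewrite brc -tt t0 mul0r.
    apply: (unull_ext _ (unullD (unullZ t (uF i)) (hb i q0))) => n.
    rewrite /H sym -tt; set w := b i q0; nc_ring (R[i]); by field; rewrite ?t0.
  have HM t n : cnorm (H t n) <= cnorm (t *: 1 + u q0) * M.
    by rewrite (le_trans (cnormM _ _))// ler_wpM2l.
  have fin t : t * t = rc * rc -> ~ unull (fun n => a * H t n) ->
      exists2 rho : A -> unit -> unit -> C, rep rho & rho a tt tt != 0.
    move=> tt aH; have [rho [hr _ ra]] := char_of_eigen (HM t) aH (fun i => HE t i tt).
    by exists rho.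
  have [h1|/contrapT h1] := pselect (~ unull (fun n => a * H rc n)); first exact: fin h1.
  have [h2|/contrapT h2] := pselect (~ unull (fun n => a * H (- rc) n)).
    by apply: fin h2; rewrite mulrNN.
  exfalso; apply: aF; apply: (unull_ext _ (unullZ (2 * rc)^-1 (unullB h1 h2))) => n.
  rewrite /H; nc_ring (R[i]); by field; rewrite rc0.
right; pose v i := b i q0 / rc.
have rcC : conjc rc^-1 = rc^-1 by rewrite conjc_inv conjc_real.
have vC i : conjc (v i) = b q0 i / rc.
  have -> : conjc (v i) = conjc (b i q0) * conjc rc^-1 by exact: rmorphM.
  by rewrite -bC rcC.
pose H (j : bool) n := if j then rc^-1 *: (u q0 * F n) else F n.
have HtE n : H true n = rc^-1 *: (u q0 * F n) by [].
have HfE n : H false n = F n by [].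
pose L := M + cnorm (rc^-1 *: u q0) * M.
have HL j n : cnorm (H j n) <= L.
  case: j; last by rewrite HfE /L (le_trans (FM n))// lerDl mulr_ge0.
  rewrite HtE /L scalerAl (le_trans (cnormM _ _))// -[leLHS]add0r lerD//.
  by rewrite ler_wpM2l.
have L0 : 0 <= L by exact: le_trans (HL true 0%N).
have [d d0 Fd] := not_unull nF.
pose B := u i1 * u j1; pose be := b i1 j1; pose be' := b j1 i1.
have bb0 : be - be' != 0 by rewrite subr_eq0; apply/eqP.
have hB : unull (fun n => B * H false n - be *: H false n) by exact: hb.
have hB' : unull (fun n => B * H true n - be' *: H true n).
  apply: (unull_ext _ (unullZ rc^-1 (unullM (u q0) (hb j1 i1)))) => n.
  have e : B * (u q0 * F n) = u q0 * (u j1 * u i1 * F n) by rewrite /B !mulrA u_hc.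
  rewrite HtE -scalerAr e /be'; by nc_ring (R[i]).
have hu : unull (fun n => u q0 * H true n - rc *: H false n).
  apply: (unull_ext _ (unullZ rc^-1 (hb q0 q0))) => n.
  rewrite HtE HfE brc; nc_ring (R[i]); by field; rewrite ?rc0.
(* B - be' kills H true and multiplies H false by be - be', which isolates the coefficient of H
   false. To isolate that of H true, apply B - be and then u q0, which sends H true back to a
   multiple of F. The two summands of K are the resulting bounds. *)
pose K := cnorm (B - be' *: 1) * L / d / cn (be - be') +
          cnorm (u q0) * cnorm (B - be *: 1) * L / d / cn ((be' - be) * rc).
have cn_gt0 (z : C) : z != 0 -> 0 < cn z.
  by move=> z0; rewrite lt_def cn_ge0 andbT; apply: contra z0 => /eqP/cn_eq0 ->.
have k1 := cn_gt0 _ bb0.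
have k2 : 0 < cn ((be' - be) * rc).
  by apply: cn_gt0; rewrite mulf_neq0// subr_eq0 eq_sym -subr_eq0.
have bd c m : uact H c m -> forall i j, cn (m i j) <= K * cnorm c.
  move=> h i j; have hj := h j.
  have p1 : 0 <= cnorm (B - be' *: 1) * L / d / cn (be - be').
    by rewrite !divr_ge0 ?mulr_ge0// ltW.
  have p2 : 0 <= cnorm (u q0) * cnorm (B - be *: 1) * L / d / cn ((be' - be) * rc).
    by rewrite !divr_ge0 ?mulr_ge0// ltW.
  case: i; last first.
    apply: (@le_trans _ _ (cnorm (B - be' *: 1) * L / d / cn (be - be') * cnorm c)); last first.
      by rewrite ler_wpM2r// lerDl.
    rewrite mulrAC ler_pdivlMr// -cnM mulrAC.
    apply: (@scalar_bound F (fun n => (B - be' *: 1) * (c * H j n))) => //.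
      move=> n; rewrite -mulrA (le_trans (cnormM _ _))// ler_wpM2l// mulrC.
      by rewrite (le_trans (cnormM _ _))// ler_wpM2l.
    apply: (unull_ext _ (unullD (unullM (B - be' *: 1) hj) (unullD (unullZ (m false j) hB) (unullZ (m true j) hB')))) => n.
    rewrite sum_bool -HfE; move: (H false n) (H true n) (H j n) => x1 x2 x3.
  by nc_ring (R[i]).
  apply: (@le_trans _ _ (cnorm (u q0) * cnorm (B - be *: 1) * L / d / cn ((be' - be) * rc) * cnorm c)); last first.
    by rewrite ler_wpM2r// lerDr.
  rewrite mulrAC ler_pdivlMr// -cnM mulrAC.
  apply: (@scalar_bound F (fun n => (u q0 * (B - be *: 1)) * (c * H j n))) => //.
    move=> n; rewrite (le_trans (cnormM _ _))// -[leRHS]mulrA ler_pM//; first exact: cnormM.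
    by rewrite (le_trans (cnormM _ _))// mulrC ler_wpM2r.
  apply: (unull_ext _ (unullD (unullM (u q0 * (B - be *: 1)) hj)
    (unullD (unullZ (m false j) (unullM (u q0) hB))
    (unullD (unullZ (m true j) (unullM (u q0) hB')) (unullZ (m true j * (be' - be)) hu))))) => n.
  rewrite sum_bool -HfE; move: (H false n) (H true n) (H j n) => x1 x2 x3.
  by nc_ring (R[i]).
have [||rho [hr ru ra]] := module_rep HL (m := fun i => J2 (v i)) bd.
- move=> i [].
    apply: (unull_ext _ (unullZ rc^-1 (hb i q0))) => n.
    rewrite sum_bool HtE HfE /J2 !eqxx (_ : (false == true) = false)// /v; nc_ring (R[i]); by field; rewrite ?rc0.
  apply: (unull_ext _ (uF i)) => n; rewrite sum_bool HtE HfE /J2 !eqxx (_ : (true == false) = false)// vC.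
  nc_ring (R[i]); by field; rewrite ?rc0.
- by move=> i j k; exact: J2_herm.
exists rho, v; split=> //.
  exists i1, j1; rewrite !vC /v; apply/eqP => e; apply: nsym.
  have e1 : b i1 j1 = b i1 q0 / rc * (b q0 j1 / rc).
    by rewrite mulrACA bM brc -invfM mulfK// mulf_neq0.
  have e2 : b j1 i1 = b q0 i1 / rc * (b j1 q0 / rc).
    by rewrite mulrACA [b q0 i1 * _]mulrC bM brc -invfM mulfK// mulf_neq0.
  by rewrite e1 e.
apply: contrapT => /forallNP h; apply: aF; apply: (unull_ext _ (ra a false)) => n.
have z i j : rho a i j = 0.
  by apply/eqP/negPn/negP => h'; apply: (h i); exists j.
by rewrite sum_bool !z !scale0r addr0 subr0.
Qed.

End HalfCommuting.

(** * Closed groups of orthogonal matrices *)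

Section Frobenius.
Variables (R : realType) (m : nat).
Implicit Types x y z : 'M[R]_m.

Definition fdot x y : R := \sum_i \sum_j x i j * y i j.

Lemma fdotC x y : fdot x y = fdot y x.
Proof. by apply: eq_bigr => i _; apply: eq_bigr => j _; rewrite mulrC. Qed.

Lemma fdotDl x y z : fdot (x + y) z = fdot x z + fdot y z.
Proof.
rewrite -big_split; apply: eq_bigr => i _; rewrite -big_split; apply: eq_bigr => j _.
by rewrite mxE mulrDl.
Qed.

Lemma fdotZl (a : R) x y : fdot (a *: x) y = a * fdot x y.
Proof.
rewrite mulr_sumr; apply: eq_bigr => i _; rewrite mulr_sumr; apply: eq_bigr => j _.
by rewrite mxE mulrA.
Qed.

Lemma fdotDr x y z : fdot z (x + y) = fdot z x + fdot z y.
Proof. by rewrite fdotC fdotDl !(fdotC z). Qed.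

Lemma fdotZr (a : R) x y : fdot y (a *: x) = a * fdot y x.
Proof. by rewrite fdotC fdotZl fdotC. Qed.

Lemma fdot0l x : fdot 0 x = 0.
Proof. by rewrite -(scale0r 0) fdotZl mul0r. Qed.

Lemma fdotNl x y : fdot (- x) y = - fdot x y.
Proof. by rewrite -scaleN1r fdotZl mulN1r. Qed.

Lemma fdotBl x y z : fdot (x - y) z = fdot x z - fdot y z.
Proof. by rewrite fdotDl fdotNl. Qed.

Lemma fdotBr x y z : fdot z (x - y) = fdot z x - fdot z y.
Proof. by rewrite fdotC fdotBl !(fdotC z). Qed.

Lemma fdot_suml (I : Type) (s : seq I) (P : pred I) (F : I -> 'M[R]_m) y :
  fdot (\sum_(i <- s | P i) F i) y = \sum_(i <- s | P i) fdot (F i) y.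
Proof. by apply: (big_morph (fdot^~ y)) => [a b|]; rewrite ?fdotDl ?fdot0l. Qed.

Lemma fdot_ge0 x : 0 <= fdot x x.
Proof. by apply: sumr_ge0 => i _; apply: sumr_ge0 => j _; rewrite -expr2 sqr_ge0. Qed.

Lemma fdot_entry x i j : x i j ^+ 2 <= fdot x x.
Proof.
rewrite /fdot (bigD1 i)//= (bigD1 j)//= -expr2 -addrA lerDl addr_ge0//.
  by apply: sumr_ge0 => k _; rewrite -expr2 sqr_ge0.
by apply: sumr_ge0 => k _; apply: sumr_ge0 => l _; rewrite -expr2 sqr_ge0.
Qed.

Lemma fdot_tr x y : fdot x y = \tr (x *m y^T).
Proof.
by apply: eq_bigr => i _; rewrite mxE; apply: eq_bigr => j _; rewrite mxE.
Qed.

Definition fnorm x : R := Num.sqrt (fdot x x).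

Lemma fnorm_ge0 x : 0 <= fnorm x. Proof. exact: sqrtr_ge0. Qed.

Lemma fnorm_sq x : fnorm x ^+ 2 = fdot x x.
Proof. by rewrite sqr_sqrtr// fdot_ge0. Qed.

Lemma fnorm_entry x i j : `|x i j| <= fnorm x.
Proof.
rewrite -(@ler_pXn2r _ 2) ?nnegrE ?fnorm_ge0// fnorm_sq real_normK ?num_real//.
exact: fdot_entry.
Qed.

Lemma fnorm_eq0 x : fnorm x = 0 -> x = 0.
Proof.
move=> h; apply/matrixP => i j; rewrite mxE; apply/eqP.
by rewrite -normr_le0 -h fnorm_entry.
Qed.

Lemma fnorm0 : fnorm 0 = 0.
Proof. by rewrite /fnorm fdot0l sqrtr0. Qed.

Lemma fnormZ (a : R) x : fnorm (a *: x) = `|a| * fnorm x.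
Proof.
apply/eqP; rewrite -(@eqrXn2 _ 2) ?fnorm_ge0 ?mulr_ge0 ?fnorm_ge0//.
by rewrite exprMn !fnorm_sq fdotZl fdotZr mulrA -expr2 real_normK ?num_real.
Qed.

Lemma fnormN x : fnorm (- x) = fnorm x.
Proof. by rewrite -scaleN1r fnormZ normrN1 mul1r. Qed.

Lemma fdot_le x y : fdot x y <= fnorm x * fnorm y.
Proof.
have [x0|x0] := eqVneq (fnorm x) 0.
  by rewrite (fnorm_eq0 x0) fdot0l fnorm0 mul0r.
have [y0|y0] := eqVneq (fnorm y) 0.
  by rewrite (fnorm_eq0 y0) fdotC fdot0l fnorm0 mulr0.
have xp : 0 < fnorm x by rewrite lt_def x0 fnorm_ge0.
have yp : 0 < fnorm y by rewrite lt_def y0 fnorm_ge0.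
have := fdot_ge0 ((fnorm x)^-1 *: x - (fnorm y)^-1 *: y).
rewrite fdotBl !fdotBr !fdotZl !fdotZr -!fnorm_sq (fdotC y x).
move: (fdot x y) => p.
have -> : (fnorm x)^-1 * ((fnorm x)^-1 * fnorm x ^+ 2) - (fnorm x)^-1 * ((fnorm y)^-1 * p) -
  ((fnorm y)^-1 * ((fnorm x)^-1 * p) - (fnorm y)^-1 * ((fnorm y)^-1 * fnorm y ^+ 2)) =
  2 - 2 * (p / (fnorm x * fnorm y)) by field; rewrite x0 y0.
move=> h; have : p / (fnorm x * fnorm y) <= 1 by lra.
by rewrite ler_pdivrMr ?mulr_gt0// mul1r.
Qed.

Lemma fnormD x y : fnorm (x + y) <= fnorm x + fnorm y.
Proof.
rewrite -(@ler_pXn2r _ 2) ?nnegrE ?addr_ge0 ?fnorm_ge0// fnorm_sq.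
rewrite fdotDl !fdotDr (fdotC y x) sqrrD !fnorm_sq mulr2n.
have := fdot_le x y; lra.
Qed.

Lemma fnormB x y : fnorm (x - y) <= fnorm x + fnorm y.
Proof. by rewrite -(fnormN y) fnormD. Qed.

Lemma fnormBC x y : fnorm (x - y) = fnorm (y - x).
Proof. by rewrite -fnormN opprB. Qed.

Lemma fnorm_sub z x y : fnorm (x - y) <= fnorm (x - z) + fnorm (z - y).
Proof. by rewrite -[in leLHS](subrK z x) -addrA; exact: fnormD. Qed.

Lemma fnormM x y : fnorm (x *m y) <= fnorm x * fnorm y.
Proof.
rewrite -(@ler_pXn2r _ 2) ?nnegrE ?mulr_ge0 ?fnorm_ge0// exprMn !fnorm_sq.
have cs (u v : 'I_m -> R) : (\sum_k u k * v k) ^+ 2 <= (\sum_k u k ^+ 2) * (\sum_k v k ^+ 2).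
  set a := \sum_k u k ^+ 2; set b := \sum_k v k ^+ 2; set c := \sum_k _.
  have b0 : 0 <= b by apply: sumr_ge0 => k _; rewrite sqr_ge0.
  have [bz|bn] := eqVneq b 0.
    have -> : c = 0.
      rewrite /c big1// => k _; have : v k ^+ 2 <= 0.
        by rewrite -bz /b (bigD1 k)//= lerDl sumr_ge0// => l _; rewrite sqr_ge0.
      by rewrite real_exprn_even_le0 ?num_real//= => /eqP ->; rewrite mulr0.
    by rewrite bz mulr0 expr0n.
  have bp : 0 < b by rewrite lt_def bn b0.
  have : 0 <= \sum_k (b * u k - c * v k) ^+ 2 by apply: sumr_ge0 => k _; rewrite sqr_ge0.
  have -> : \sum_k (b * u k - c * v k) ^+ 2 = b * (a * b - c ^+ 2).
    have e k : (b * u k - c * v k) ^+ 2 = b ^+ 2 * u k ^+ 2 - 2 * b * c * (u k * v k) + c ^+ 2 * v k ^+ 2.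
      by ring.
    under eq_bigr do rewrite e.
    rewrite big_split sumrB/= -!mulr_sumr -/a -/b -/c; ring.
  by rewrite pmulr_rge0// subr_ge0.
rewrite /fdot mulr_suml; apply: ler_sum => i _.
under [X in _ <= _ * X]eq_bigr do under eq_bigr do rewrite -expr2.
rewrite exchange_big/= mulr_sumr; apply: ler_sum => j _.
by rewrite -expr2 mxE (le_trans (cs _ _)).
Qed.

Lemma fnorm_tr x : fnorm x^T = fnorm x.
Proof. by rewrite /fnorm !fdot_tr trmxK mxtrace_mulC. Qed.

Lemma fdot_orthl x y z : x^T *m x = 1%:M -> fdot (x *m y) (x *m z) = fdot y z.
Proof.
by move=> h; rewrite !fdot_tr trmx_mul mxtrace_mulC -!mulmxA (mulmxA _ x) h mul1mx mxtrace_mulC.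
Qed.

Lemma fnorm_orthl x y : x^T *m x = 1%:M -> fnorm (x *m y) = fnorm y.
Proof. by move=> h; rewrite /fnorm fdot_orthl. Qed.

Lemma fnorm_orthr x y : x *m x^T = 1%:M -> fnorm (y *m x) = fnorm y.
Proof.
by move=> h; rewrite -fnorm_tr trmx_mul fnorm_orthl ?fnorm_tr// trmxK.
Qed.

Lemma fnorm_le_sum x (e : R) : (forall i j, `|x i j| <= e) -> fnorm x <= \sum_(i < m) \sum_(j < m) e.
Proof.
move=> h; have s0 : 0 <= \sum_(i < m) \sum_(j < m) `|x i j|.
  by apply: sumr_ge0 => i _; exact: sumr_ge0.
apply: (@le_trans _ _ (\sum_i \sum_j `|x i j|)); last first.
  by apply: ler_sum => i _; apply: ler_sum => j _; exact: h.
rewrite -(@ler_pXn2r _ 2) ?nnegrE ?fnorm_ge0// fnorm_sq expr2 mulr_suml.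
apply: ler_sum => i _; rewrite mulr_suml; apply: ler_sum => j _.
apply: (@le_trans _ _ (`|x i j| * `|x i j|)); first by rewrite -normrM ler_norm.
rewrite ler_wpM2l// (bigD1 i)//= (bigD1 j)//= -addrA lerDl addr_ge0//.
  by apply: sumr_ge0.
by apply: sumr_ge0 => k _; exact: sumr_ge0.
Qed.

Lemma fnorm_ultralimit (T : Type) (F : set_system T) (u : T -> 'M[R]_m) (c : R) :
  UltraFilter F -> (forall n, fnorm (u n) <= c) ->
  exists L, forall e : R, 0 < e -> F [set n | fnorm (u n - L) < e].
Proof.
move=> FU uc; have /choice[l hl] : forall ij : 'I_m * 'I_m, exists l, forall e : R,
    0 < e -> F [set n | `|u n ij.1 ij.2 - l| < e].
  move=> ij; apply: (@bounded_ultralimit R T F FU (fun n => u n ij.1 ij.2) c) => n.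
  exact: le_trans (fnorm_entry _ _ _) (uc n).
exists (\matrix_(i, j) l (i, j)) => e e0.
pose K : R := \sum_(i < m) \sum_(j < m) 1 + 1.
have K0 : 0 < K by rewrite ltr_wpDl// sumr_ge0// => i _; rewrite sumr_ge0.
have eK : 0 < e / K by rewrite divr_gt0.
have : \forall n \near F, forall ij, `|u n ij.1 ij.2 - l ij| < e / K.
  by apply: filter_forall => ij; exact: hl.
apply: filterS => n /= h.
have /fnorm_le_sum h' : forall i j, `|(u n - \matrix_(i, j) l (i, j)) i j| <= e / K.
  by move=> i j; rewrite !mxE ltW// (h (i, j)).
rewrite (le_lt_trans h')//.
have -> : \sum_(i < m) \sum_(j < m) (e / K) = (e / K) * \sum_(i < m) \sum_(j < m) 1.
  rewrite mulr_sumr; apply: eq_bigr => i _; rewrite mulr_sumr.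
  by apply: eq_bigr => j _; rewrite mulr1.
by rewrite mulrAC ltr_pdivrMr// ltr_pM2l// /K ltrDl.
Qed.

End Frobenius.

#[local] Hint Extern 0 (is_true (0 <= fnorm _)) => exact: fnorm_ge0 : core.

(** Both groups of the proof are of this form after realification. The Frobenius norm makes
    translations and inversion isometries, so that the topology, the invariant measure and the
    charts can all be obtained from the distance. *)
Record orthogonal_group (R : realType) (m : nat) := OrthogonalGroup {
  og_set : set 'M[R]_m ;
  og_set1 : og_set 1%:M ;
  og_setM : forall x y, og_set x -> og_set y -> og_set (x *m y) ;
  og_setV : forall x, og_set x -> og_set x^T ;
  og_orth : forall x, og_set x -> x *m x^T = 1%:M ;
  og_closed : forall x, (forall e : R, 0 < e -> exists2 y, og_set y & fnorm (x - y) < e) -> og_set x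
}.

Section OrthogonalGroupType.
Variables (R : realType) (m : nat) (S : orthogonal_group R m).

Record og : Type := Og { og_val : 'M[R]_m ; _ : `[< og_set S og_val >] }.

HB.instance Definition _ := [isSub for og_val].
HB.instance Definition _ := [Choice of og by <:].

Lemma og_valP (x : og) : og_set S (og_val x).
Proof. by case: x => x /= /asboolP. Qed.

Definition og_of x (h : og_set S x) : og := @Og x (introT (asboolP _) h).

Let one := og_of (og_set1 S).
Let mul (x y : og) := og_of (og_setM (og_valP x) (og_valP y)).
Let inv (x : og) := og_of (og_setV (og_valP x)).

Lemma og_mulVmx (x : 'M[R]_m) : og_set S x -> x^T *m x = 1%:M.
Proof. by move=> /og_setV/og_orth; rewrite trmxK. Qed.

Let mulA : associative mul.
Proof. by move=> x y z; apply: val_inj; rewrite /= mulmxA. Qed.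
Let mul1 : left_id one mul.
Proof. by move=> x; apply: val_inj; rewrite /= mul1mx. Qed.
Let mul1r : right_id one mul.
Proof. by move=> x; apply: val_inj; rewrite /= mulmx1. Qed.
Let mulV : left_inverse one inv mul.
Proof. by move=> x; apply: val_inj; rewrite /= og_mulVmx//; exact: og_valP. Qed.
Let mulVr : right_inverse one inv mul.
Proof. by move=> x; apply: val_inj; exact: og_orth (og_valP x). Qed.

HB.instance Definition _ := isPointed.Build og one.
HB.instance Definition _ := monoid.isGroup.Build og mulA mul1 mul1r mulV mulVr.

Let dist (x y : og) := fnorm (og_val x - og_val y).
Let distxx x : dist x x = 0.
Proof. by rewrite /dist subrr fnorm0. Qed.
Let dist_eq0 x y : dist x y = 0 -> x = y.
Proof. by move=> /fnorm_eq0/subr0_eq h; apply: val_inj. Qed.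
Let distC x y : dist x y = dist y x.
Proof. by rewrite /dist fnormBC. Qed.
Let dist_triangle y x z : dist x z <= dist x y + dist y z.
Proof. exact: fnorm_sub. Qed.

HB.instance Definition _ := isMetric.Build R og distxx dist_eq0 distC dist_triangle.

Lemma og_distE (x y : og) : mdist x y = fnorm (og_val x - og_val y).
Proof. by []. Qed.

Lemma og_valM (x y : og) : og_val (x * y)%g = og_val x *m og_val y.
Proof. by []. Qed.

Lemma og_valV (x : og) : og_val (x^-1)%g = (og_val x)^T.
Proof. by []. Qed.

Lemma og_val1 : og_val 1%g = 1%:M.
Proof. by []. Qed.

Lemma og_distMl (z x y : og) : mdist (z * x)%g (z * y)%g = mdist x y.
Proof.
by rewrite !og_distE !og_valM -mulmxBr fnorm_orthl// og_mulVmx//; exact: og_valP.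
Qed.

Lemma og_distMr (z x y : og) : mdist (x * z)%g (y * z)%g = mdist x y.
Proof.
by rewrite !og_distE !og_valM -mulmxBl fnorm_orthr//; exact: og_orth (og_valP z).
Qed.

Lemma og_distV (x y : og) : mdist (x^-1)%g (y^-1)%g = mdist x y.
Proof. by rewrite !og_distE !og_valV -linearB fnorm_tr. Qed.

Let mul_cont : continuous (fun xy : og * og => (xy.1 * xy.2)%g).
Proof.
move=> [x y]; apply/metricType_numDomainType.cvgrPdist_lt => e e0.
have e2 : 0 < e / 2 by rewrite divr_gt0.
exists (ball x (e / 2), ball y (e / 2)); first by split; exact: nbhsx_ballx.
move=> [x' y'] [/=]; rewrite !ballEmdist /= => hx hy.
rewrite (le_lt_trans (metric_triangle _ (x' * y)%g _))// (splitr e) ltrD//.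
  by rewrite og_distMr.
by rewrite og_distMl.
Qed.

Let inv_cont : continuous (fun x : og => (x^-1)%g).
Proof.
move=> x; apply/(@cvg_ballP R og og (nbhs x)) => e e0.
apply: filterS (nbhsx_ballx x e e0) => y.
by rewrite !ballEmdist /= og_distV.
Qed.

HB.instance Definition _ := isTopologicalGroup.Build og mul_cont inv_cont.

Lemma og_fnorm (x : og) : fnorm (og_val x) = fnorm (1%:M : 'M[R]_m).
Proof. by rewrite -[og_val x]mul1mx fnorm_orthr//; exact: og_orth (og_valP x). Qed.

Lemma og_compact : compact [set: og].
Proof.
rewrite compact_ultra => F FU _.
have [L FL] : exists L, forall e : R, 0 < e -> F [set x | fnorm (og_val x - L) < e].
  by apply: fnorm_ultralimit => x; rewrite og_fnorm.
have SL : og_set S L.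
  apply: og_closed => e e0; have [x /= hx] := filter_ex (FL e e0).
  by exists (og_val x); [exact: og_valP|rewrite fnormBC].
exists (og_of SL); split=> //; apply/fcvg_ballP => e e0.
by apply: filterS (FL e e0) => x; rewrite ballEmdist /= og_distE fnormBC.
Qed.

Lemma og_hausdorff : hausdorff_space og.
Proof. exact: metric_hausdorff. Qed.

End OrthogonalGroupType.

(** * Haar measure *)

Section RealUltraLimit.
Variable R : realType.
Implicit Types (u v : nat -> R) (l : R).

Definition ulim u l := forall e : R, 0 < e -> ufilter [set n | `|u n - l| < e].

Lemma ulim_le u v l l' : ulim u l -> ulim v l' ->
  ufilter [set n | u n <= v n] -> l <= l'.
Proof.
move=> ul vl uv; apply/ler_addgt0Pr => e e0.
have e2 : 0 < e / 2 by rewrite divr_gt0.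
have [n [[/= h1 h2] h3]] := filter_ex (filterI (filterI (ul _ e2) (vl _ e2)) uv).
move: h1 h2; rewrite !ltr_norml => /andP[h1 _] /andP[_ h2].
rewrite /= in h3; lra.
Qed.

Lemma ulim_unique u l l' : ulim u l -> ulim u l' -> l = l'.
Proof.
by move=> h h'; apply/le_anti/andP; split;
  [apply: ulim_le h h' _|apply: ulim_le h' h _]; apply: ufilter_all => n /=.
Qed.

Lemma ulimD u v l l' : ulim u l -> ulim v l' -> ulim (fun n => u n + v n) (l + l').
Proof.
move=> ul vl e e0; have e2 : 0 < e / 2 by rewrite divr_gt0.
apply: filterS (filterI (ul _ e2) (vl _ e2)) => n /= [].
by rewrite !ltr_norml => /andP[h1 h2] /andP[h3 h4]; apply/andP; split; lra.
Qed.

End RealUltraLimit.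

Section HaarContent.
Variables (R : realType) (m : nat) (S : orthogonal_group R m).
Local Notation T := (og S).
Implicit Types (A B U V : set T) (e : R).

Definition ball_cover e A (s : seq T) :=
  forall x, A x -> exists2 y, y \in s & mdist y x < e.

Lemma ball_cover_finite e : 0 < e -> exists s, ball_cover e setT s.
Proof.
move=> e0; have /compact_near_coveringP nc := @og_compact R m S.
(* Compactness is used in its near-covering form, with the finite sequences filtered by inclusion as
   parameter: containing one given center settles all the points near it. *)
pose F : set_system (seq T) :=
  [set P | exists s0 : seq T, forall s : seq T, {subset s0 <= s} -> P s].
have FF : Filter F.
  split; first by exists [::].
    move=> P Q [s hs] [t ht]; exists (s ++ t) => r hr; split.
      by apply: hs => x xs; apply: hr; rewrite mem_cat xs.
    by apply: ht => x xs; apply: hr; rewrite mem_cat xs orbT.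
  by move=> P Q PQ [s hs]; exists s => t /hs /PQ.
have [|s hs] := nc _ F (fun s x => exists2 y, y \in s & mdist y x < e) FF.
  move=> x _; exists (ball x e, [set s : seq T | x \in s]) => /=.
    split; first exact: nbhsx_ballx.
    by exists [:: x] => s; apply; rewrite mem_head.
  by move=> [y s] /= [+ xs]; rewrite ballEmdist => xy; exists x.
by exists s => x; exact: (hs s (fun _ => id)).
Qed.

Definition cover_number e A : nat :=
  if pselect (exists n, `[<exists2 s, size s = n & ball_cover e A s>]) is left h
  then ex_minn h else 0%N.

Lemma cover_number_ex e A : 0 < e ->
  exists2 s, size s = cover_number e A & ball_cover e A s.
Proof.
move=> e0; rewrite /cover_number; case: pselect => [h|].
  by case: ex_minnP => n /asboolP.
have [s hs] := ball_cover_finite e0.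
by case; exists (size s); apply/asboolP; exists s => // x _; exact: hs.
Qed.

Lemma cover_number_le e A s : ball_cover e A s -> (cover_number e A <= size s)%N.
Proof.
move=> hs; rewrite /cover_number; case: pselect => // h.
by case: ex_minnP => n _; apply; apply/asboolP; exists s.
Qed.

Lemma cover_number_mono e A B : 0 < e -> A `<=` B ->
  (cover_number e A <= cover_number e B)%N.
Proof.
move=> e0 AB; have [s <- hs] := cover_number_ex B e0.
by apply: cover_number_le => x /AB; exact: hs.
Qed.

Lemma cover_numberU e A B : 0 < e ->
  (cover_number e (A `|` B) <= cover_number e A + cover_number e B)%N.
Proof.
move=> e0; have [s <- hs] := cover_number_ex A e0.
have [t <- ht] := cover_number_ex B e0.
rewrite -size_cat; apply: cover_number_le => x [/hs|/ht] [y ys yx]; exists y => //.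
  by rewrite mem_cat ys.
by rewrite mem_cat ys orbT.
Qed.

Lemma cover_number0 e : cover_number e set0 = 0%N.
Proof. by apply/eqP; rewrite -leqn0; apply: (@cover_number_le e set0 [::]). Qed.

Lemma cover_number_gt0 e : 0 < e -> (0 < cover_number e setT)%N.
Proof.
move=> e0; have [[|x s] <- hs] := cover_number_ex setT e0 => //.
by have [] := hs point I.
Qed.

(** No ball of radius e meets both sets, so a cover of the union splits into covers of the two. *)
Lemma cover_number_sep e A B : 0 < e ->
  (forall x y, A x -> B y -> 2 * e <= mdist x y) ->
  (cover_number e A + cover_number e B <= cover_number e (A `|` B))%N.
Proof.
move=> e0 sep; have [s <- hs] := cover_number_ex (A `|` B) e0.
pose p C (y : T) := `[<exists2 x, C x & mdist y x < e>].
have cov C : C `<=` A `|` B -> (cover_number e C <= count (p C) s)%N.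
  move=> CAB; rewrite -size_filter; apply: cover_number_le => x Cx.
  have [y ys yx] := hs _ (CAB _ Cx); exists y => //.
  by rewrite mem_filter ys andbT; apply/asboolP; exists x.
apply: (leq_trans (leq_add (cov A _) (cov B _))) => //.
rewrite -count_predUI [X in (_ + X)%N](_ : _ = 0)%N ?addn0 ?count_size//.
apply/eqP; rewrite -leqn0 leqNgt -has_count; apply/hasPn => y ys /=.
apply/negP => /andP[/asboolP[x Ax yx] /asboolP[z Bz yz]].
have := sep _ _ Ax Bz; apply/negP; rewrite -ltNge.
apply: (le_lt_trans (metric_triangle x y z)); rewrite (metric_sym x y); lra.
Qed.

Lemma cover_number_isometry e (f : T -> T) A : 0 < e ->
  (forall x y, mdist (f x) (f y) = mdist x y) ->
  (cover_number e (f @` A) <= cover_number e A)%N.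
Proof.
move=> e0 isof; have [s <- hs] := cover_number_ex A e0.
rewrite -(size_map f); apply: cover_number_le => _ [x Ax <-].
by have [y ys yx] := hs _ Ax; exists (f y); rewrite ?isof// map_f.
Qed.

Definition cover_ratio A (n : nat) : R :=
  (cover_number n.+1%:R^-1 A)%:R / (cover_number n.+1%:R^-1 setT)%:R.

Let mesh_gt0 n : 0 < n.+1%:R^-1 :> R. Proof. by rewrite invr_gt0. Qed.

Let den_gt0 n : 0 < (cover_number n.+1%:R^-1 (@setT T))%:R :> R.
Proof. by rewrite ltr0n cover_number_gt0. Qed.

Lemma haar_content_ex A : exists l, ulim (cover_ratio A) l.
Proof.
apply: (@bounded_ultralimit R nat ufilter ufilter_ultra _ 1) => n.
rewrite ger0_norm ?divr_ge0// ler_pdivrMr// mul1r ler_nat.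
exact: cover_number_mono.
Qed.

(** On arbitrary sets this is only subadditive and invariant under isometries; additivity holds for
    sets at a positive distance, as [haar_content_sep] shows. That is what the outer measure
    construction requires. *)
Definition haar_content A : R := projT1 (cid (haar_content_ex A)).
Local Notation phi := haar_content.

Lemma haar_contentP A : ulim (cover_ratio A) (phi A).
Proof. by rewrite /haar_content; case: cid. Qed.

Lemma haar_content_mono A B : A `<=` B -> phi A <= phi B.
Proof.
move=> AB; apply: ulim_le (haar_contentP A) (haar_contentP B) _.
apply: ufilter_all => n /=; rewrite ler_pM2r ?invr_gt0// ler_nat.
exact: cover_number_mono.
Qed.

Lemma haar_content0 : phi set0 = 0.
Proof.
apply: (ulim_unique (haar_contentP _)) => e e0; apply: ufilter_all => n /=.
by rewrite /cover_ratio cover_number0 mul0r subrr normr0.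
Qed.

Lemma haar_contentT : phi setT = 1.
Proof.
apply: (ulim_unique (haar_contentP _)) => e e0; apply: ufilter_all => n /=.
by rewrite /cover_ratio divff ?gt_eqF// subrr normr0.
Qed.

Lemma haar_contentU A B : phi (A `|` B) <= phi A + phi B.
Proof.
apply: ulim_le (haar_contentP _) (ulimD (haar_contentP A) (haar_contentP B)) _.
apply: ufilter_all => n /=; rewrite -mulrDl ler_pM2r ?invr_gt0// -natrD ler_nat.
exact: cover_numberU.
Qed.

Lemma haar_content_sep A B e : 0 < e -> (forall x y, A x -> B y -> e <= mdist x y) ->
  phi A + phi B <= phi (A `|` B).
Proof.
move=> e0 sep.
apply: ulim_le (ulimD (haar_contentP A) (haar_contentP B)) (haar_contentP _) _.
have e2 : 0 < e / 2 by rewrite divr_gt0.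
apply: filterS (ufilter_inv e2) => n /= ne.
rewrite -mulrDl ler_pM2r ?invr_gt0// -natrD ler_nat.
apply: cover_number_sep => // x y Ax By; apply: le_trans (sep _ _ Ax By).
by move: ne; move: (n.+1%:R^-1) => q; lra.
Qed.

Lemma haar_content_isometry (f : T -> T) A :
  (forall x y, mdist (f x) (f y) = mdist x y) -> phi (f @` A) <= phi A.
Proof.
move=> isof; apply: ulim_le (haar_contentP _) (haar_contentP A) _.
apply: ufilter_all => n /=; rewrite ler_pM2r ?invr_gt0// ler_nat.
exact: cover_number_isometry.
Qed.

Definition well_inside A U :=
  exists2 e, 0 < e & forall x y, A x -> mdist x y < e -> U y.

Definition inner_content U : R := sup [set phi A | A in [set A | well_inside A U]].
Local Notation lam := inner_content.

Let has_sup_content U : has_sup [set phi A | A in [set A | well_inside A U]].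
Proof.
split; first by exists (phi set0), set0 => //; exists 1.
by exists 1 => _ [A _ <-]; rewrite -haar_contentT; exact: haar_content_mono.
Qed.

Lemma inner_content_ge A U : well_inside A U -> phi A <= lam U.
Proof. by move=> h; apply: ub_le_sup; [exact: (has_sup_content U).2|exists A]. Qed.

Lemma inner_content_le U (c : R) : (forall A, well_inside A U -> phi A <= c) -> lam U <= c.
Proof.
move=> h; apply: ge_sup; first exact: (has_sup_content U).1.
by move=> _ [A /= /h ? <-].
Qed.

Lemma inner_content_near U e : 0 < e -> exists2 A, well_inside A U & lam U - e < phi A.
Proof.
by move=> e0; have [_ [A h <-] ?] := sup_adherent e0 (has_sup_content U); exists A.
Qed.

Lemma inner_content_ge0 U : 0 <= lam U.
Proof. by rewrite -haar_content0; apply: inner_content_ge; exists 1. Qed.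

Lemma inner_content0 : lam set0 = 0.
Proof.
apply/eqP; rewrite eq_le inner_content_ge0 andbT.
apply: inner_content_le => A [e e0 h].
rewrite -haar_content0; apply: haar_content_mono => x Ax.
by apply: (h x x Ax); rewrite mdistxx.
Qed.

Lemma inner_contentT : lam setT = 1.
Proof.
apply/eqP; rewrite eq_le; apply/andP; split.
  apply: inner_content_le => A _; rewrite -haar_contentT; exact: haar_content_mono.
by rewrite -haar_contentT; apply: inner_content_ge; exists 1.
Qed.

Lemma haar_content_bigU (B : nat -> set T) n :
  phi (\big[setU/set0]_(k < n) B k) <= \sum_(k < n) phi (B k).
Proof.
elim: n => [|n ih]; first by rewrite !big_ord0 haar_content0.
rewrite !big_ord_recr /=; apply: le_trans (haar_contentU _ _) _.
by rewrite lerD2r.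
Qed.

(** A Lebesgue number argument: for some n, each point of A has its ball of radius 1 / (n + 1)
    inside one of the first n sets V k. Near a point outside of U there is nothing to cover, since A
    keeps a margin inside U. The part of A served by V k is well inside V k. *)
Lemma haar_content_cover A U (V : nat -> set T) : well_inside A U ->
  (forall k, open (V k)) -> U `<=` \bigcup_k V k ->
  exists n, phi A <= \sum_(k < n) lam (V k).
Proof.
move=> [e e0 AU] oV UV; have /compact_near_coveringP nc := @og_compact R m S.
have [|n _ hn] := nc _ \oo (fun n x => A x ->
    exists2 k, (k < n)%N & forall y, mdist x y < n.+1%:R^-1 -> V k y) _.
  move=> x _; have [Ux|nUx] := pselect (U x).
    have [k _ Vkx] := UV _ Ux.
    have := open_nbhs_nbhs (conj (oV k) Vkx); rewrite -nbhs_ballE => -[r /= r0 hr].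
    have r2 : 0 < r / 2 by rewrite divr_gt0.
    exists (ball x (r / 2), [set n | (maxn k.+1 (Num.truncn (r / 2)^-1) <= n)%N]) => /=.
      by split; [exact: nbhsx_ballx|exists (maxn k.+1 (Num.truncn (r / 2)^-1))].
    move=> [z n] /= [+ ]; rewrite ballEmdist geq_max => xz /andP[kn rn] _; exists k => // y zy.
    apply: hr; rewrite ballEmdist /=; apply: (le_lt_trans (metric_triangle x z y)).
    have nr : n.+1%:R^-1 < r / 2.
      rewrite invf_plt ?posrE//; apply: (lt_le_trans (truncnS_gt _)).
      by rewrite ler_nat.
    rewrite (splitr r); apply: ltrD => //; exact: lt_trans nr.
  exists (ball x e, setT) => /=; first by split; [exact: nbhsx_ballx|exact: filterT].
  move=> [z n] /= [+ _]; rewrite ballEmdist /= => xz Az; exfalso; apply: nUx.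
  by apply: (AU z) => //; rewrite metric_sym.
exists n; have {}hn := hn n (leqnn n).
pose B k := [set x | A x /\ forall y, mdist x y < n.+1%:R^-1 -> V k y].
have AB : A `<=` \big[setU/set0]_(k < n) B k.
  move=> x Ax; have [k kn hk] := hn x I Ax.
  by rewrite -bigcup_mkord; exists k.
apply: le_trans (haar_content_mono AB) _.
apply: le_trans (haar_content_bigU _ _) _; apply: ler_sum => k _.
apply: inner_content_ge; exists n.+1%:R^-1 => // x y [_]; exact.
Qed.

Lemma inner_content_isometry (f g : T -> T) U : cancel f g -> cancel g f ->
  (forall x y, mdist (f x) (f y) = mdist x y) -> lam (f @` U) <= lam U.
Proof.
move=> fg gf isof; have isog x y : mdist (g x) (g y) = mdist x y.
  by rewrite -isof !gf.
apply: inner_content_le => A [e e0 h].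
have -> : A = f @` (g @` A).
  rewrite image_comp; apply/seteqP; split => [x Ax|_ [y Ay <-]]; last by rewrite /= gf.
  by exists x; rewrite /= ?gf.
apply: le_trans (haar_content_isometry _ isof) _.
apply: inner_content_ge; exists e => // _ y [x Ax <-] xy.
have [z Uz zy] : (f @` U) (f y) by apply: (h x) => //; rewrite -(gf x) isof.
by rewrite -(fg y) -zy fg.
Qed.

End HaarContent.

Section HaarMeasure.
Variables (R : realType) (m : nat) (S : orthogonal_group R m).
Local Notation T := (og S).
Local Notation phi := (@haar_content R m S).
Local Notation lam := (@inner_content R m S).
Implicit Types (X U V : set T) (e : R).

Lemma open_borel U : open U -> measurable (U : set (borel T)).
Proof. by move=> oU; exact: sub_sigma_algebra. Qed.

(* As sets which are not open have content +oo, only open covers matter in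
   [mu_ext open_content]. *)
Definition open_content (U : set (borel T)) : \bar R :=
  if pselect (open (U : set T)) then (lam U)%:E else +oo%E.

Lemma open_contentE U : open U -> open_content U = (lam U)%:E.
Proof. by rewrite /open_content; case: pselect. Qed.

Lemma open_content_ge0 U : (0 <= open_content U)%E.
Proof.
by rewrite /open_content; case: pselect => [oU|] //; rewrite lee_fin inner_content_ge0.
Qed.

Lemma open_content0 : open_content set0 = 0%E.
Proof. by rewrite open_contentE ?inner_content0//; exact: open0. Qed.

Definition haar_outer (X : set (borel T)) : \bar R := mu_ext open_content X.

HB.instance Definition _ := isOuterMeasure.Build R (borel T) haar_outer
  (@mu_ext0 _ (borel T) R open_content open_content0 open_content_ge0)
  (@mu_ext_ge0 _ (borel T) R open_content open_content_ge0)
  (@le_mu_ext _ (borel T) R open_content)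
  (@mu_ext_sigma_subadditive _ (borel T) R open_content open_content_ge0).

Lemma open_content_series_open (F : nat -> set T) :
  (\sum_(k <oo) open_content (F k) < +oo)%E -> forall k, open (F k).
Proof.
move=> h k; apply: contrapT => nk; move: h.
rewrite (@eseries_pinfty _ (fun k => open_content (F k)) xpredT k) ?ltxx//.
  by move=> n _; rewrite -ltNye; exact: lt_le_trans (open_content_ge0 _).
by rewrite /open_content; case: pselect.
Qed.

Lemma haar_outer_open U : open U -> haar_outer U = (lam U)%:E.
Proof.
move=> oU; apply/eqP; rewrite eq_le; apply/andP; split.
  apply: ereal_inf_lbound; exists (fun k => if k is 0%N then U else set0).
    split; last by move=> x Ux; exists 0%N.
    by case=> [|k]; [exact: open_borel|exact: measurable0].
  rewrite nneseries_recl//; last by move=> k _; exact: open_content_ge0.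
  rewrite open_contentE// eseries0 ?adde0// => -[|k] // _ _.
  exact: open_content0.
apply: le_ereal_inf_tmp => _ [F [mF UF] <-].
have [->|] := eqVneq (\sum_(k <oo) open_content (F k))%E +oo%E; first exact: leey.
rewrite -ltey => Foo; have oF := open_content_series_open Foo.
have h A : well_inside A U -> ((phi A)%:E <= \sum_(k <oo) open_content (F k))%E.
  move=> AU; have [n hn] := haar_content_cover AU oF UF.
  apply: (@le_trans _ _ (\sum_(0 <= k < n) open_content (F k))%E).
    rewrite (eq_bigr (fun k => (lam (F k))%:E)) => [|k _]; last by rewrite open_contentE.
    by rewrite sumEFin big_mkord lee_fin.
  by apply: nneseries_lim_ge => k _ _; exact: open_content_ge0.
move: Foo h; case: (\sum_(k <oo) _)%E => [r _ h| //|_ h].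
  by rewrite lee_fin; apply: inner_content_le => A /h; rewrite lee_fin.
by have [A /h] := inner_content_near U (@ltr01 R).
Qed.

Lemma haar_outerT : haar_outer setT = 1%E.
Proof. by rewrite haar_outer_open ?inner_contentT//; exact: openT. Qed.

Lemma haar_outer_fin X : haar_outer X \is a fin_num.
Proof.
have h0 : (0 <= haar_outer X)%E by exact: outer_measure_ge0.
rewrite ge0_fin_numE//; apply: (@le_lt_trans _ _ (haar_outer setT)).
  exact: le_outer_measure.
by rewrite haar_outerT ltry.
Qed.

Lemma haar_outer_near X e : 0 < e ->
  exists V, [/\ open V, X `<=` V & (haar_outer V <= haar_outer X + e%:E)%E].
Proof.
move=> e0; have [_ [F [mF XF] <-] Fe] := lb_ereal_inf_adherent e0 (haar_outer_fin X).
have oF : forall k, open (F k : set T).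
  apply: open_content_series_open; apply: lt_trans Fe _.
  have := haar_outer_fin X; rewrite /haar_outer /mu_ext.
  by case: (ereal_inf _) => // r _; rewrite ltry.
exists (\bigcup_k F k); split => //; first by apply: bigcup_open => k _.
apply: le_trans (ltW Fe); apply: le_trans (outer_measure_sigma_subadditive _ _) _.
by apply: lee_nneseries => k _; rewrite /= ?outer_measure_ge0// haar_outer_open// open_contentE.
Qed.

(* [K] fills up V inside U, then [L] fills up the remainder of V at a positive
   distance from [K]; on such sets the content is additive. *)
Lemma haar_outer_caratheodory_open U : open U -> haar_outer.-caratheodory U.
Proof.
move=> oU; apply: le_caratheodory_measurable => X; apply/lee_addgt0Pr => e e0.
have e3 : 0 < e / 3 by rewrite divr_gt0.
have [V [oV XV hV]] := haar_outer_near X e3.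
have oW : open (V `&` U) by exact: openI.
have [K [k k0 KW] hK] := inner_content_near (V `&` U) e3.
have oV' : open (V `&` ~` closure K).
  by apply: openI => //; apply: closed_openC; exact: closed_closure.
have [L [l l0 LV'] hL] := inner_content_near (V `&` ~` closure K) e3.
have h1 : (haar_outer (X `&` U) <= (lam (V `&` U))%:E)%E.
  by rewrite -haar_outer_open//; apply: le_outer_measure => x [/XV].
have h2 : (haar_outer (X `&` ~` U) <= (lam (V `&` ~` closure K))%:E)%E.
  rewrite -haar_outer_open//; apply: le_outer_measure => x [/XV Vx nUx]; split => //.
  move=> /(_ _ (nbhsx_ballx x k k0))[y [Ky]]; rewrite ballEmdist /= => xy.
  by apply: nUx; apply: (KW y x Ky _).2; rewrite metric_sym.
have h3 : phi K + phi L <= lam V.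
  apply: le_trans (_ : phi (K `|` L) <= _).
    apply: (haar_content_sep l0) => x y Kx Ly; rewrite leNgt; apply/negP => xy.
    rewrite metric_sym in xy; have [_] := LV' y x Ly xy; apply.
    exact: subset_closure.
  apply: inner_content_ge; exists (Num.min k l); first by rewrite lt_min k0.
  move=> x y; rewrite lt_min => -[Kx|Lx] /andP[xk xl].
    by have [] := KW x y Kx xk.
  by have [] := LV' x y Lx xl.
apply: (le_trans (leeD h1 h2)).
rewrite haar_outer_open// in hV.
have : ((lam V + e / 3 + e / 3)%:E <= haar_outer X + e%:E)%E.
  have -> : e%:E = ((e / 3)%:E + ((e / 3)%:E + (e / 3)%:E))%E.
    by rewrite -!EFinD; congr (_%:E); lra.
  by rewrite addeA !EFinD -addeA leeD2r.
apply: le_trans; rewrite -EFinD lee_fin; lra.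
Qed.

Lemma haar_outer_caratheodory (B : set (borel T)) :
  measurable B -> haar_outer.-caratheodory B.
Proof.
apply: smallest_sub; last by move=> U oU; exact: haar_outer_caratheodory_open.
split; first exact: caratheodory_measurable_set0.
  by move=> A mA; rewrite setTD; exact: caratheodory_measurable_setC.
by move=> F mF; exact: caratheodory_measurable_bigcup.
Qed.

Definition haar_measure (X : set (borel T)) : \bar R := haar_outer X.

Let haar_measure0 : haar_measure set0 = 0%E.
Proof. exact: outer_measure0. Qed.

Let haar_measure_ge0 X : (0 <= haar_measure X)%E.
Proof. exact: outer_measure_ge0. Qed.

Let haar_measure_additive : semi_sigma_additive haar_measure.
Proof.
move=> F mF tF mUF; apply: (caratheodory_measure_sigma_additive _ tF).
  by move=> k; exact: haar_outer_caratheodory.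
exact: haar_outer_caratheodory.
Qed.

HB.instance Definition _ := isMeasure.Build _ (borel T) R haar_measure
  haar_measure0 haar_measure_ge0 haar_measure_additive.

Let haar_measureT : haar_measure setT = 1%E.
Proof. exact: haar_outerT. Qed.

HB.instance Definition _ := Measure_isProbability.Build _ (borel T) R haar_measure
  haar_measureT.

Lemma isometry_open (f g : T -> T) U : cancel f g -> cancel g f ->
  (forall x y, mdist (f x) (f y) = mdist x y) -> open U -> open (f @` U).
Proof.
move=> fg gf isof oU; rewrite openE => _ [x Ux <-].
have := open_nbhs_nbhs (conj oU Ux); rewrite -nbhs_ballE => -[r /= r0 hr].
rewrite /interior -nbhs_ballE; exists r => //= y; rewrite ballEmdist /= => xy.
exists (g y); last exact: gf.
by apply: hr; rewrite ballEmdist /= -isof gf.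
Qed.

(** The generality of isometries covers right translations as well as left ones; the two invariance
    relations of the trace integral use one each. *)
Lemma haar_measure_isometry (f g : T -> T) (B : set (borel T)) :
  cancel f g -> cancel g f -> (forall x y, mdist (f x) (f y) = mdist x y) ->
  haar_measure (f @` B) = haar_measure B.
Proof.
have le_iso (f1 g1 : T -> T) (B1 : set (borel T)) :
    cancel f1 g1 -> cancel g1 f1 -> (forall x y, mdist (f1 x) (f1 y) = mdist x y) ->
    (haar_measure (f1 @` B1) <= haar_measure B1)%E.
  move=> fg gf isof; apply: le_ereal_inf_tmp => _ [F [mF BF] <-].
  have [->|] := eqVneq (\sum_(k <oo) open_content (F k))%E +oo%E; first exact: leey.
  rewrite -ltey => Foo; have oF := open_content_series_open Foo.
  have ofF k : open (f1 @` (F k : set T)) by exact: isometry_open fg gf isof _.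
  apply: (@le_trans _ _ (\sum_(k <oo) open_content (f1 @` F k))%E).
    apply: ereal_inf_lbound; exists (fun k => f1 @` F k) => //; split.
      by move=> k; exact: open_borel.
    by move=> _ [x /BF[k _ Fkx] <-]; exists k => //; exists x.
  apply: lee_nneseries => k _ /=; first by move=> _; exact: open_content_ge0.
  by rewrite !open_contentE// lee_fin; exact: inner_content_isometry fg gf isof.
move=> fg gf isof; apply/eqP; rewrite eq_le (le_iso f g)//=.
have isog x y : mdist (g x) (g y) = mdist x y by rewrite -isof !gf.
have := le_iso g f (f @` B) gf fg isog.
rewrite image_comp (_ : (g \o f) @` B = B)//.
by apply/seteqP; split => [_ [x Bx <-]|x Bx]; rewrite /= ?fg//; exists x => //=; rewrite fg.
Qed.

Lemma haar_measureMl (x : T) (B : set (borel T)) :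
  haar_measure [set (x * y)%g | y in (B : set T)] = haar_measure B.
Proof.
apply: (@haar_measure_isometry (fun y => x * y)%g (fun y => x^-1 * y)%g).
- by move=> y; rewrite mulKg.
- by move=> y; rewrite mulVKg.
- by move=> y z; exact: og_distMl.
Qed.

End HaarMeasure.

Section HaarIntegral.
Variables (R : realType) (m : nat) (S : orthogonal_group R m).
Local Notation T := (og S).
Local Notation mu := (@haar_measure R m S).
Implicit Types f g : T -> R.

Definition haar_integral f : R := \int[mu]_(x in setT) f x.

Lemma continuous_borel f : continuous f -> measurable_fun setT (f : borel T -> R).
Proof.
move=> cf; apply: (measurability (@measurable_realfun.RGenOInfty.G R)).
  exact: measurable_realfun.RGenOInfty.measurableE.
move=> _ [_ [x ->] <-]; rewrite setTI; apply: open_borel.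
by apply: open_comp; [move=> y _; exact: cf|exact: rray_open].
Qed.

Lemma continuous_compact_bounded f : continuous f -> exists M, forall x, `|f x| <= M.
Proof.
move=> cf; have cpt : compact (f @` setT).
  by apply: continuous_compact; [exact: continuous_subspaceT|exact: og_compact].
have /compact_bounded[M [_ hM]] := cpt.
by exists (M + 1) => x; apply: hM; [rewrite ltrDl|exists x].
Qed.

Lemma continuous_integrable f : continuous f -> mu.-integrable setT (EFin \o f).
Proof.
move=> cf; apply: measurable_bounded_integrable => //.
- by rewrite [X in (X < _)%E](_ : _ = 1%E) ?ltry//; exact: haar_outerT.
- exact: continuous_borel.
- have [M hM] := continuous_compact_bounded cf.
  by exists M; split => [|r Mr x _]; [exact: num_real|exact: le_trans (hM x) (ltW Mr)].
Qed.

Lemma haar_integralD f g : continuous f -> continuous g ->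
  haar_integral (fun x => f x + g x) = haar_integral f + haar_integral g.
Proof. by move=> cf cg; apply: RintegralD => //; exact: continuous_integrable. Qed.

Lemma haar_integralZ (c : R) f : continuous f ->
  haar_integral (fun x => c * f x) = c * haar_integral f.
Proof. by move=> cf; apply: RintegralZl => //; exact: continuous_integrable. Qed.

Lemma haar_integral_ge0 f : (forall x, 0 <= f x) -> 0 <= haar_integral f.
Proof. by move=> f0; apply: Rintegral_ge0 => x _; exact: f0. Qed.

Lemma haar_integral_cst (c : R) : haar_integral (fun=> c) = c.
Proof.
rewrite /haar_integral Rintegral_cst//.
by rewrite [X in fine X](_ : _ = 1%E) ?mulr1//; exact: haar_outerT.
Qed.

Lemma isometry_continuous (s : T -> T) :
  (forall x y, mdist (s x) (s y) = mdist x y) -> continuous s.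
Proof.
move=> isos x; apply/(@metricType_numDomainType.cvgrPdist_lt R T T (nbhs (x : T)) _) => e e0.
rewrite -nbhs_ballE; exists e => //= y; rewrite ballEmdist /= => xy.
by rewrite isos.
Qed.

Lemma haar_integral_isometry (f : T -> R) (s t : T -> T) : continuous f ->
  cancel s t -> cancel t s -> (forall x y, mdist (s x) (s y) = mdist x y) ->
  haar_integral (f \o s) = haar_integral f.
Proof.
move=> cf st ts isos; have isot x y : mdist (t x) (t y) = mdist x y.
  by rewrite -isos !ts.
have preE (B : set T) : s @^-1` B = t @` B.
  apply/seteqP; split => [x Bx|_ [y By <-]]; last by rewrite /= ts.
  by exists (s x); rewrite ?st.
pose s' : borel T -> borel T := s; have ms : measurable_fun setT s'.
  apply: (@measurability _ _ (borel T) (borel T) setT s' (@open T)) => // _ [U oU <-]; rewrite setTI (preE U).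
  by apply: open_borel; exact: isometry_open ts st isot oU.
have cfs : continuous (f \o s).
  move=> x; apply: continuous_comp; last exact: cf.
  exact: isometry_continuous.
congr fine.
rewrite -(@eq_measure_integral _ (borel T) R setT mu (pushforward mu s') (EFin \o f)).
  by rewrite integral_pushforward//; [apply/measurable_realfun.measurable_EFinP; exact: continuous_borel|exact: (continuous_integrable cfs)].
move=> B mB _; change (mu (s @^-1` B) = mu B).
by rewrite (preE B); exact: haar_measure_isometry ts st isot.
Qed.

Lemma haar_integralMl (z : T) f : continuous f ->
  haar_integral (fun x => f (z * x)%g) = haar_integral f.
Proof.
move=> cf; apply: (@haar_integral_isometry f (fun y => z * y)%g (fun y => z^-1 * y)%g) => //.
- by move=> y; rewrite mulKg.
- by move=> y; rewrite mulVKg.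
- by move=> x y; exact: og_distMl.
Qed.

Lemma haar_integralMr (z : T) f : continuous f ->
  haar_integral (fun x => f (x * z)%g) = haar_integral f.
Proof.
move=> cf; apply: (@haar_integral_isometry f (fun y => y * z)%g (fun y => y * z^-1)%g) => //.
- by move=> y; rewrite mulgK.
- by move=> y; rewrite mulgVK.
- by move=> x y; exact: og_distMr.
Qed.

End HaarIntegral.

(** * Lie group structure *)

Section SmoothCalculus.
Variables (R : realType) (V : normedModType R).
Implicit Types (U : set V) (k : nat).

Lemma Ck_continuous (W : normedModType R) k U (f : V -> W) x :
  Ck k U f -> U x -> {for x, continuous f}.
Proof. by case: k => [|k] [h _] /h. Qed.

Lemma Ck_sub (W : normedModType R) k U U' (f : V -> W) :
  U `<=` U' -> Ck k U' f -> Ck k U f.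
Proof.
move=> UU'; elim: k f => [|k ih] f /= [cf df]; split => //.
- by move=> x /UU' /cf.
- by move=> x /UU' /cf.
- by move=> v; have [h1 h2] := df v; split; [move=> x /UU' /h1|exact: ih].
Qed.

Lemma Ck_ext (W : normedModType R) k U (f g : V -> W) :
  open U -> (forall x, U x -> f x = g x) -> Ck k U f -> Ck k U g.
Proof.
move=> oU; elim: k f g => [|k ih] f g fg /= [cf df].
  split=> // x Ux; have fgx : \near x, f x = g x.
    by apply: filterS (open_nbhs_nbhs (conj oU Ux)).
  rewrite /prop_for /continuous_at -fg//; apply: cvg_trans (cf _ Ux).
  exact: near_eq_cvg.
have near x : U x -> \near x, f x = g x.
  by move=> Ux; apply: filterS (open_nbhs_nbhs (conj oU Ux)).
split=> [x Ux|v].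
  rewrite /prop_for /continuous_at -fg//; apply: cvg_trans (cf _ Ux).
  exact: near_eq_cvg (near _ Ux).
have [h1 h2] := df v; split=> [x Ux|].
  exact: near_eq_derivable (near _ Ux) (h1 _ Ux).
by apply: ih h2 => x Ux; exact: near_eq_derive (near _ Ux).
Qed.

Lemma Ck_pred (W : normedModType R) k U (f : V -> W) : Ck k.+1 U f -> Ck k U f.
Proof.
elim: k f => [|k ih] f [cf df]; split => // v.
by have [h1 h2] := df v; split => //; exact: ih.
Qed.

Lemma Ck_cst (W : normedModType R) k U (c : W) : Ck k U (fun=> c).
Proof.
elim: k c => [|k ih] c; first by split=> // x _; exact: cvg_cst.
split=> [x _|v]; first exact: cvg_cst.
split=> [x _|]; first exact: derivable_cst.
by rewrite (_ : 'D_v _ = fun=> 0) //; apply/funext => x; rewrite derive_cst.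
Qed.

Lemma CkD (W : normedModType R) k U (f g : V -> W) : open U ->
  Ck k U f -> Ck k U g -> Ck k U (fun x => f x + g x).
Proof.
move=> oU; elim: k f g => [|k ih] f g /= [cf df] [cg dg]; split => //.
- by move=> x Ux; apply: continuousD; [exact: cf|exact: cg].
- by move=> x Ux; apply: continuousD; [exact: cf|exact: cg].
move=> v; have [f1 f2] := df v; have [g1 g2] := dg v; split.
  by move=> x Ux; apply: derivableD; [exact: f1|exact: g1].
apply: Ck_ext (ih _ _ f2 g2) => // x Ux.
by rewrite -deriveD//; [exact: f1|exact: g1].
Qed.

Lemma Ck_sum (W : normedModType R) (I : Type) (s : seq I) (P : pred I) k U (f : I -> V -> W) :
  open U -> (forall i, Ck k U (f i)) -> Ck k U (fun x => \sum_(i <- s | P i) f i x).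
Proof.
move=> oU h; elim: s => [|i s ih].
  by rewrite (_ : (fun x => _) = fun=> 0); [exact: Ck_cst|apply/funext => x; rewrite big_nil].
case Pi : (P i).
  rewrite (_ : (fun x => _) = fun x => f i x + \sum_(i <- s | P i) f i x).
    exact: CkD.
  by apply/funext => x; rewrite big_cons Pi.
rewrite (_ : (fun x => _) = fun x => \sum_(i <- s | P i) f i x)//.
by apply/funext => x; rewrite big_cons Pi.
Qed.

Lemma CkM k U (f g : V -> R) : open U ->
  Ck k U f -> Ck k U g -> Ck k U (fun x => f x * g x).
Proof.
move=> oU; elim: k f g => [|k ih] f g [cf df] [cg dg]; split => //.
- by move=> x Ux; apply: continuousM; [exact: cf|exact: cg].
- by move=> x Ux; apply: continuousM; [exact: cf|exact: cg].
move=> v; have [f1 f2] := df v; have [g1 g2] := dg v; split.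
  by move=> x Ux; apply: derivableM; [exact: f1|exact: g1].
have fk : Ck k U f by apply: Ck_pred; split.
have gk : Ck k U g by apply: Ck_pred; split.
apply: Ck_ext (CkD oU (ih _ _ fk g2) (ih _ _ gk f2)) => // x Ux.
by rewrite [RHS]deriveM//; [exact: f1|exact: g1].
Qed.

Lemma Ck_prod (I : Type) (s : seq I) (P : pred I) k U (f : I -> V -> R) :
  open U -> (forall i, Ck k U (f i)) -> Ck k U (fun x => \prod_(i <- s | P i) f i x).
Proof.
move=> oU h; elim: s => [|i s ih].
  by rewrite (_ : (fun x => _) = fun=> 1); [exact: Ck_cst|apply/funext => x; rewrite big_nil].
case Pi : (P i).
  rewrite (_ : (fun x => _) = fun x => f i x * \prod_(i <- s | P i) f i x).
    exact: CkM.
  by apply/funext => x; rewrite big_cons Pi.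
rewrite (_ : (fun x => _) = fun x => \prod_(i <- s | P i) f i x)//.
by apply/funext => x; rewrite big_cons Pi.
Qed.

Lemma CkV k U (f : V -> R) : open U -> (forall x, U x -> f x != 0) ->
  Ck k U f -> Ck k U (fun x => (f x)^-1).
Proof.
move=> oU f0; elim: k f f0 => [|k ih] f f0 [cf df]; split => //.
- by move=> x Ux; apply: continuousV; [exact: f0|exact: cf].
- by move=> x Ux; apply: continuousV; [exact: f0|exact: cf].
have fk : Ck k U f by apply: Ck_pred; split.
move=> v; have [f1 f2] := df v; split.
  by move=> x Ux; apply: derivableV; [exact: f0|exact: f1].
apply: (Ck_ext oU _ (CkM oU (CkM oU (Ck_cst k U (-1 : R)) (CkM oU (ih _ f0 fk) (ih _ f0 fk))) f2)) => // x Ux.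
rewrite [RHS]deriveV//; [|exact: f0|exact: f1].
by rewrite mulN1r -expr2 exprVn.
Qed.

Lemma mx_continuous (p q : nat) (F : V -> 'M[R]_(p, q)) x :
  (forall i j, {for x, continuous (fun x => F x i j)}) -> {for x, continuous F}.
Proof.
move=> h; apply/cvgrPdist_le => e e0; near=> y.
rewrite /Num.Def.normr/= mx_normrE (bigmax_le _ (ltW e0))//= => i _.
rewrite !mxE/=; move: i; near: y; apply: filter_forall => /= i.
exact: ((cvgrPdist_le _ _).1 (h i.1 i.2)).
Unshelve. all: by end_near. Qed.

Lemma Ck_mx (p q : nat) k U (F : V -> 'M[R]_(p, q)) : open U ->
  (forall i j, Ck k U (fun x => F x i j)) -> Ck k U F.
Proof.
move=> oU; elim: k F => [|k ih] F h.
  by split=> // x Ux; apply: mx_continuous => i j; exact: Ck_continuous (h i j) Ux.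
split.
  by move=> x Ux; apply: mx_continuous => i j; exact: Ck_continuous (h i j) Ux.
move=> v; split=> [x Ux|].
  by apply/derivable_mxP => i j; have [_ /(_ v)[+ _]] := h i j; exact.
apply: ih => i j; have [_ /(_ v)[h1 h2]] := h i j.
apply: Ck_ext h2 => // x Ux; rewrite derive_mx ?mxE//.
by apply/derivable_mxP => i' j'; have [_ /(_ v)[+ _]] := h i' j'; exact.
Qed.

(** Regularity is followed entry by entry, because products, determinants and inverses of matrices
    are rational in the entries. *)
Definition Cmx p q k U (F : V -> 'M[R]_(p, q)) := forall i j, Ck k U (fun x => F x i j).

Lemma Cmx_cst p q k U (A : 'M[R]_(p, q)) : Cmx k U (fun=> A).
Proof. by move=> i j; exact: Ck_cst. Qed.

Lemma Cmx_mul p q r k U (F : V -> 'M[R]_(p, q)) (G : V -> 'M[R]_(q, r)) : open U ->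
  Cmx k U F -> Cmx k U G -> Cmx k U (fun x => F x *m G x).
Proof.
move=> oU cF cG i j.
rewrite (_ : (fun x => _) = fun x => \sum_l F x i l * G x l j).
  by apply: Ck_sum => // l; exact: CkM.
by apply/funext => x; rewrite mxE.
Qed.

Lemma Cmx_tr p q k U (F : V -> 'M[R]_(p, q)) :
  Cmx k U F -> Cmx k U (fun x => (F x)^T).
Proof.
move=> cF i j; rewrite (_ : (fun x => _) = fun x => F x j i)//.
by apply/funext => x; rewrite mxE.
Qed.

Lemma Ck_det p k U (F : V -> 'M[R]_p) : open U ->
  Cmx k U F -> Ck k U (fun x => \det (F x)).
Proof.
move=> oU cF; apply: Ck_sum => // s; apply: CkM => //; first exact: Ck_cst.
by apply: Ck_prod => // i; exact: cF.
Qed.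

Lemma Cmx_inv p k U (F : V -> 'M[R]_p) : open U ->
  (forall x, U x -> F x \in unitmx) -> Cmx k U F -> Cmx k U (fun x => invmx (F x)).
Proof.
move=> oU uF cF i j.
apply: (@Ck_ext _ _ _ (fun x => (\det (F x))^-1 * cofactor (F x) j i)) => //.
  by move=> x Ux; rewrite /invmx uF// !mxE.
apply: CkM => //; first apply: CkV => //.
- by move=> x Ux; rewrite -unitfE -unitmxE uF.
- exact: Ck_det.
apply: CkM => //; first exact: Ck_cst.
apply: Ck_det => // i' j'.
rewrite (_ : (fun x => _) = fun x => F x (lift j i') (lift i j')); first exact: cF.
by apply/funext => x; rewrite !mxE.
Qed.

End SmoothCalculus.

Section SmoothProduct.
Variables (R : realType) (V V' W : normedModType R).

Lemma Ck_fst k (U : set V) (f : V -> W) :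
  Ck k U f -> Ck k [set y : V * V' | U y.1] (fun y => f y.1).
Proof.
elim: k f => [|k ih] f /= [cf df]; split => //.
- by move=> [x y] /= Ux; apply: (cvg_comp _ _ (@cvg_fst _ _ (nbhs x) (nbhs y) _)); exact: cf.
- by move=> [x y] /= Ux; apply: (cvg_comp _ _ (@cvg_fst _ _ (nbhs x) (nbhs y) _)); exact: cf.
move=> v; have [h1 h2] := df v.1; split=> [x Ux|]; first exact: h1 Ux.
exact: ih h2.
Qed.

Lemma Ck_snd k (U : set V) (f : V -> W) :
  Ck k U f -> Ck k [set y : V' * V | U y.2] (fun y => f y.2).
Proof.
elim: k f => [|k ih] f /= [cf df]; split => //.
- by move=> [x y] /= Ux; apply: (cvg_comp _ _ (@cvg_snd _ _ (nbhs x) (nbhs y) _)); exact: cf.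
- by move=> [x y] /= Ux; apply: (cvg_comp _ _ (@cvg_snd _ _ (nbhs x) (nbhs y) _)); exact: cf.
move=> v; have [h1 h2] := df v.2; split=> [x Ux|]; first exact: h1 Ux.
exact: ih h2.
Qed.

End SmoothProduct.

(** * The tangent cone of a closed group of matrices is a linear space *)

Section TangentSpace.
Variables (R : realType) (m : nat) (S : orthogonal_group R m).
Local Notation M := 'M[R]_m.
Implicit Types (x y h X Y : M) (e t : R).

(* The one-sided tangent cone at the identity. *)
Definition tangent X := forall e, 0 < e -> exists2 d, 0 < d &
  forall t, 0 < t -> t < d -> exists2 h, og_set S h & fnorm (h - 1%:M - t *: X) <= e * t.

Lemma og_fnormMl h x : og_set S h -> fnorm (h *m x) = fnorm x.
Proof. by move=> /og_mulVmx; exact: fnorm_orthl. Qed.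

Lemma tangent_step X e : tangent X -> 0 < e -> exists2 d, 0 < d &
  forall t, 0 < t -> t < d -> exists h, [/\ og_set S h,
    fnorm (h - 1%:M - t *: X) <= e * t & fnorm (h - 1%:M) <= (e + fnorm X) * t].
Proof.
move=> tX e0; have [d d0 hd] := tX e e0; exists d => // t t0 td.
have [h Sh hh] := hd t t0 td; exists h; split => //.
rewrite -(subrK (t *: X) (h - 1%:M)); apply: le_trans (fnormD _ _) _.
by rewrite mulrDl lerD// fnormZ gtr0_norm// mulrC.
Qed.

Lemma tangent0 : tangent 0.
Proof.
move=> e e0; exists 1 => // t t0 _; exists 1%:M; first exact: og_set1.
by rewrite subrr scaler0 subr0 fnorm0 mulr_ge0// ltW.
Qed.

(** The product h k of the approximations of t X and t Y is used. Left multiplication by h preserves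
    the norm, so the only new error is (h - 1)(t Y), which is of order t^2; c is the constant in
    front of t^2. *)
Lemma tangentD X Y : tangent X -> tangent Y -> tangent (X + Y).
Proof.
move=> tX tY e e0; have e3 : 0 < e / 3 by rewrite divr_gt0.
have [d d0 hd] := tangent_step tX e3; have [d' d'0 hd'] := tangent_step tY e3.
pose c := (e / 3 + fnorm X) * fnorm Y + 1.
have c0 : 0 < c by rewrite ltr_wpDl// mulr_ge0// addr_ge0// ltW.
exists (Num.min d (Num.min d' (e / 3 / c))); first by rewrite !lt_min d0 d'0 divr_gt0.
move=> t t0; rewrite !lt_min => /and3P[td td']; rewrite ltr_pdivlMr// => tc.
have [h [Sh h1 h2]] := hd t t0 td; have [k [Sk k1 k2]] := hd' t t0 td'.
exists (h *m k); first exact: og_setM.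
have -> : h *m k - 1%:M - t *: (X + Y) =
    (h - 1%:M - t *: X) + h *m (k - 1%:M - t *: Y) + (h - 1%:M) *m (t *: Y).
  rewrite !mulmxBr mulmxBl mul1mx mulmx1 scalerDr.
  by apply/matrixP => i j; rewrite !mxE; ring.
apply: le_trans (fnormD _ _) _; apply: le_trans (lerD (fnormD _ _) (fnormM _ _)) _.
rewrite og_fnormMl// fnormZ gtr0_norm//.
have : fnorm (h - 1%:M) * (t * fnorm Y) <= e / 3 * t.
  apply: (@le_trans _ _ ((e / 3 + fnorm X) * t * (t * fnorm Y))).
    by rewrite ler_wpM2r// mulr_ge0// ltW.
  have := ler_wpM2r (ltW t0) (ltW tc); have := mulr_ge0 (ltW t0) (ltW t0).
  by rewrite /c; lra.
lra.
Qed.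

Lemma tangentN X : tangent X -> tangent (- X).
Proof.
move=> tX e e0; have e2 : 0 < e / 2 by rewrite divr_gt0.
have [d d0 hd] := tangent_step tX e2.
pose c := (e / 2 + fnorm X) * fnorm X + 1.
have c0 : 0 < c by rewrite ltr_wpDl// mulr_ge0// addr_ge0// ltW.
exists (Num.min d (e / 2 / c)); first by rewrite lt_min d0 divr_gt0.
move=> t t0; rewrite lt_min => /andP[td]; rewrite ltr_pdivlMr// => tc.
have [h [Sh h1 h2]] := hd t t0 td; exists h^T; first exact: og_setV.
have hh : h^T *m h = 1%:M := og_mulVmx Sh.
have -> : h^T - 1%:M - t *: - X =
    - (h^T *m (h - 1%:M - t *: X)) + h^T *m ((h - 1%:M) *m (t *: X)) + 0.
  rewrite !mulmxBr mulmxBl mulmxBr mulmxA hh !mul1mx mulmx1 scalerN addr0.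
  by apply/matrixP => i j; rewrite !mxE; ring.
rewrite addr0; apply: le_trans (fnormD _ _) _; rewrite fnormN.
rewrite !(@og_fnormMl h^T) ?og_setV//; try exact: og_setV.
apply: le_trans (lerD h1 (fnormM _ _)) _; rewrite fnormZ gtr0_norm//.
have : fnorm (h - 1%:M) * (t * fnorm X) <= e / 2 * t.
  apply: (@le_trans _ _ ((e / 2 + fnorm X) * t * (t * fnorm X))).
    by rewrite ler_wpM2r// mulr_ge0// ltW.
  have := ler_wpM2r (ltW t0) (ltW tc); have := mulr_ge0 (ltW t0) (ltW t0).
  by rewrite /c; lra.
lra.
Qed.

Lemma tangentZ (c : R) X : tangent X -> tangent (c *: X).
Proof.
have pos (a : R) (Y : M) : 0 < a -> tangent Y -> tangent (a *: Y).
  move=> a0 tY e e0; have [d d0 hd] := tY (e / a) (divr_gt0 e0 a0).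
  exists (d / a); first exact: divr_gt0.
  move=> t t0; rewrite ltr_pdivlMr// => td.
  have [h Sh hh] := hd (t * a) (mulr_gt0 t0 a0) td; exists h => //.
  rewrite scalerA; apply: le_trans hh _.
  by rewrite mulrCA divfK ?gt_eqF// mulrC.
move=> tX; have [c0|c0|->] := ltgtP c 0; last by rewrite scale0r; exact: tangent0.
  rewrite -(opprK c) scaleNr; apply: tangentN; apply: pos => //.
  by rewrite oppr_gt0.
exact: pos.
Qed.

(** The matrix q is the n-th power of h. Multiplication by h is isometric, so the errors add up
    without being amplified and the deviation from linearity stays quadratic in n |h - 1|. *)
Lemma power_near_one h n : og_set S h -> exists2 q, og_set S q &
  fnorm (q - 1%:M - n%:R *: (h - 1%:M)) <= n%:R ^+ 2 * fnorm (h - 1%:M) ^+ 2.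
Proof.
move=> Sh; elim: n => [|n [q Sq hq]].
  exists 1%:M; first exact: og_set1.
  by rewrite subrr scale0r subr0 fnorm0 expr0n mul0r.
exists (h *m q); first exact: og_setM.
set s := fnorm (h - 1%:M) in hq *; have s0 : 0 <= s by exact: fnorm_ge0.
have -> : h *m q - 1%:M - n.+1%:R *: (h - 1%:M) =
    h *m (q - 1%:M - n%:R *: (h - 1%:M)) + n%:R *: ((h - 1%:M) *m (h - 1%:M)).
  rewrite !mulmxBr -scalemxAr !mulmxBr mulmxBl !mulmx1 mul1mx -natr1 !scalerBr !scalerDl !scale1r.
  by apply/matrixP => i j; rewrite !mxE; ring.
apply: le_trans (fnormD _ _) _; rewrite og_fnormMl// fnormZ normr_nat.
apply: le_trans (lerD hq (ler_wpM2l _ (fnormM _ _))) _; rewrite ?ler0n// -/s.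
have n0 : 0 <= n%:R :> R by [].
rewrite -natr1; nra.
Qed.

(* The power of [u n] of order t / |u n - 1| is close to 1 + t X. *)
Lemma tangent_limit (u : nat -> M) X : (forall n, og_set S (u n)) ->
  (forall n, u n != 1%:M) ->
  (forall e, 0 < e -> ufilter [set n | fnorm (u n - 1%:M) < e]) ->
  (forall e, 0 < e ->
     ufilter [set n | fnorm ((fnorm (u n - 1%:M))^-1 *: (u n - 1%:M) - X) < e]) ->
  tangent X.
Proof.
move=> Su u1 lim1 limX e e0; have e3 : 0 < e / 3 by rewrite divr_gt0.
exists (e / 3) => // t t0 te.
have c0 : 0 < fnorm X + 1 by rewrite ltr_wpDl.
have et : 0 < e / 3 * t / (fnorm X + 1) by rewrite divr_gt0// mulr_gt0.
have [n [/= su vX]] := filter_ex (filterI (lim1 _ et) (limX _ e3)).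
set s := fnorm (u n - 1%:M) in su vX.
have s0 : 0 < s.
  rewrite lt_def fnorm_ge0 andbT; apply: contra (u1 n) => /eqP /fnorm_eq0 h.
  by rewrite -subr_eq0 h.
pose N := Num.truncn (t / s).
have t1 : N%:R * s <= t.
  by rewrite -ler_pdivlMr// truncn_le// ltW// divr_gt0.
have t2 : t < (N%:R + 1) * s.
  by rewrite -ltr_pdivrMr// natr1 truncnS_gt.
have [q Sq hq] := power_near_one N (Su n); exists q => //.
have -> : q - 1%:M - t *: X = (q - 1%:M - N%:R *: (u n - 1%:M)) +
    ((N%:R * s) *: (s^-1 *: (u n - 1%:M) - X) + (N%:R * s - t) *: X).
  have -> : N%:R *: (u n - 1%:M) = (N%:R * s) *: (s^-1 *: (u n - 1%:M)).
    by rewrite scalerA -mulrA divff ?gt_eqF// mulr1.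
  move: (s^-1 *: _) => v.
  by apply/matrixP => i j; rewrite !mxE; ring.
apply: le_trans (fnormD _ _) _; apply: le_trans (lerD hq (fnormD _ _)) _.
rewrite !fnormZ -/s -exprMn.
have N0 : 0 <= N%:R * s by rewrite mulr_ge0// ltW.
rewrite (ger0_norm N0) ler0_norm ?subr_le0// opprB.
set z := N%:R * s in t1 N0 *.
have tz : t - z < s by move: t2; rewrite mulrDl mul1r -/z; lra.
have a1 : z ^+ 2 <= t * (e / 3).
  by rewrite expr2; apply: ler_pM => //; apply: le_trans t1 (ltW te).
have a2 : z * fnorm (s^-1 *: (u n - 1%:M) - X) <= t * (e / 3).
  by apply: ler_pM => //; exact: ltW.
have a3 : (t - z) * fnorm X <= t * (e / 3).
  apply: (@le_trans _ _ (s * (fnorm X + 1))).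
    by apply: ler_pM => //; rewrite ?subr_ge0 ?lerDl// ltW.
  by rewrite -ler_pdivlMr// [t * _]mulrC ltW.
lra.
Qed.

(** Otherwise there are elements u n tending to 1 with no tangent vector at a distance of at most e
    |u n - 1|. Their directions have an ultralimit X, which is tangent by [tangent_limit], and |u n
    - 1| X is a contradiction for suitable n. *)
Lemma tangent_approx e : 0 < e -> exists2 r, 0 < r &
  forall h, og_set S h -> fnorm (h - 1%:M) < r ->
    exists2 X, tangent X & fnorm (h - 1%:M - X) <= e * fnorm (h - 1%:M).
Proof.
move=> e0; apply: contrapT => no.
have /choice[u hu] : forall n : nat, exists h, [/\ og_set S h,
    fnorm (h - 1%:M) < n.+1%:R^-1 & forall X, tangent X ->
      e * fnorm (h - 1%:M) < fnorm (h - 1%:M - X)].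
  move=> n; apply: contrapT => nh; apply: no; exists n.+1%:R^-1 => // h Sh hn.
  apply: contrapT => nX; apply: nh; exists h; split => // X tX.
  by rewrite ltNge; apply/negP => le; apply: nX; exists X.
have u1 n : u n != 1%:M.
  have [_ _ /(_ 0 tangent0) h] := hu n; apply/eqP => u1.
  by move: h; rewrite u1 subrr subr0 fnorm0 mulr0 ltxx.
have s0 n : 0 < fnorm (u n - 1%:M).
  rewrite lt_def fnorm_ge0 andbT; apply: contra (u1 n) => /eqP /fnorm_eq0 h.
  by rewrite -subr_eq0 h.
have [X limX] : exists X, forall d : R, 0 < d ->
    ufilter [set n | fnorm ((fnorm (u n - 1%:M))^-1 *: (u n - 1%:M) - X) < d].
  apply: (@fnorm_ultralimit R m nat ufilter _ 1) => n.
  by rewrite fnormZ ger0_norm ?invr_ge0// mulVf// gt_eqF.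
have tX : tangent X.
  apply: (@tangent_limit u) => // [n|d d0]; first by case: (hu n).
  apply: filterS (ufilter_inv d0) => n /= nd; apply: lt_trans nd.
  by case: (hu n).
have [n /= hn] := filter_ex (limX e e0).
have [_ _ /(_ _ (tangentZ (fnorm (u n - 1%:M)) tX))] := hu n.
have -> : u n - 1%:M - fnorm (u n - 1%:M) *: X =
    fnorm (u n - 1%:M) *: ((fnorm (u n - 1%:M))^-1 *: (u n - 1%:M) - X).
  by rewrite scalerBr scalerA divff ?gt_eqF// scale1r.
rewrite fnormZ ger0_norm// mulrC ltr_pM2l//; apply/negP; rewrite -leNgt; exact: ltW.
Qed.

Definition orthonormal_family (d : nat) (b : nat -> M) :=
  (forall i, (i < d)%N -> tangent (b i)) /\
  forall i j, (i < d)%N -> (j < d)%N -> fdot (b i) (b j) = (i == j)%:R.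

Lemma orthonormal_family_size d b : orthonormal_family d b -> (d <= m * m)%N.
Proof.
move=> [_ ob]; pose A : 'M[R]_(d, m * m) := \matrix_(i < d) mxvec (b i).
apply: (@mulmx1_min R _ _ A A^T); apply/matrixP => i j.
rewrite !mxE -(ob _ _ (ltn_ord i) (ltn_ord j)) /fdot pair_big/=.
rewrite (reindex _ (curry_mxvec_bij m m))/=; apply: eq_bigr => -[k l] _ /=.
by rewrite !mxE !mxvecE.
Qed.

(** An orthonormal family of maximal size exists because sizes are at most m^2; a tangent vector
    orthogonal to it could be normalized and added. *)
Lemma tangent_basis : exists d b, orthonormal_family d b /\
  forall X, tangent X -> (forall i, (i < d)%N -> fdot X (b i) = 0) -> X = 0.
Proof.
have ex : exists d, `[< exists b, orthonormal_family d b >].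
  by exists 0%N; apply/asboolP; exists (fun=> 0); split.
have bd d : `[< exists b, orthonormal_family d b >] -> (d <= m * m)%N.
  by move=> /asboolP[b]; exact: orthonormal_family_size.
case: (ex_maxnP ex bd) => d /asboolP[b ob] max; exists d, b; split => // X tX X0.
apply: contrapT => /eqP nX.
have sX : 0 < fnorm X.
  by rewrite lt_def fnorm_ge0 andbT; apply: contra nX => /eqP /fnorm_eq0 ->.
suff /max : `[< exists b, orthonormal_family d.+1 b >] by rewrite ltnn.
apply/asboolP; exists (fun i => if (i < d)%N then b i else (fnorm X)^-1 *: X).
have last i : (i < d.+1)%N -> ~~ (i < d)%N -> i = d.
  by rewrite -leqNgt ltnS => h1 h2; apply/eqP; rewrite eqn_leq h1.
split=> [i|i j] id.
  by case: ifPn => [/ob.1//|_]; exact: tangentZ.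
move=> jd; case: ifPn => [hi|/last -> //]; case: ifPn => [hj|/last -> //].
- exact: ob.2.
- by rewrite fdotZr fdotC X0// mulr0 ltn_eqF.
- by rewrite fdotZl X0// mulr0 gtn_eqF.
- rewrite fdotZl fdotZr -fnorm_sq eqxx expr2 [X in _ * X]mulrA mulVf ?gt_eqF//.
  by rewrite mul1r mulVf ?gt_eqF.
Qed.

End TangentSpace.

Section Lipschitz.
Variables (R : realType) (m : nat) (S : orthogonal_group R m).

Lemma og_lipschitz_continuous (W : normedModType R) (f : og S -> W) (c : R) :
  0 <= c -> (forall x y, `|f x - f y| <= c * mdist x y) -> continuous f.
Proof.
move=> c0 fc x; apply/(@cvgrPdist_lt _ W (og S) (nbhs (x : og S)) _) => e e0.
have c1 : 0 < c + 1 by rewrite ltr_wpDl.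
rewrite -nbhs_ballE; exists (e / (c + 1)); first exact: divr_gt0.
move=> y; rewrite ballEmdist /= ltr_pdivlMr// => xy.
apply: le_lt_trans (fc x y) _; apply: le_lt_trans xy; rewrite mulrC ler_wpM2l ?lerDl//.
exact: mdist_ge0.
Qed.

End Lipschitz.

(** * Tangential coordinates near 1, the smooth local inverse and the atlas of translates *)

Section TangentCoordinates.
Variables (R : realType) (m : nat) (S : orthogonal_group R m).
Variables (d : nat) (b : nat -> 'M[R]_m).
Hypothesis ob : orthonormal_family S d b.
Hypothesis bmax : forall X, tangent S X ->
  (forall i, (i < d)%N -> fdot X (b i) = 0) -> X = 0.
Local Notation M := 'M[R]_m.
Implicit Types (x X : M) (y v : 'rV[R]_d).

Definition tcoord x : 'rV[R]_d := \row_(k < d) fdot x (b k).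
Definition tvec y : M := \sum_(k < d) y 0 k *: b k.

Lemma tcoordD x x' : tcoord (x + x') = tcoord x + tcoord x'.
Proof. by apply/rowP => k; rewrite !mxE fdotDl. Qed.

Lemma tcoordZ (a : R) x : tcoord (a *: x) = a *: tcoord x.
Proof. by apply/rowP => k; rewrite !mxE fdotZl. Qed.

Lemma tcoordB x x' : tcoord (x - x') = tcoord x - tcoord x'.
Proof. by apply/rowP => k; rewrite !mxE fdotBl. Qed.

Lemma tvecD y y' : tvec (y + y') = tvec y + tvec y'.
Proof. by rewrite -big_split; apply: eq_bigr => k _; rewrite mxE scalerDl. Qed.

Lemma tvecZ (a : R) y : tvec (a *: y) = a *: tvec y.
Proof. by rewrite scaler_sumr; apply: eq_bigr => k _; rewrite mxE scalerA. Qed.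

Lemma tvecB y y' : tvec (y - y') = tvec y - tvec y'.
Proof. by rewrite /tvec -sumrB; apply: eq_bigr => k _; rewrite !mxE scalerBl. Qed.

Lemma tcoord0 : tcoord 0 = 0.
Proof. by apply/rowP => k; rewrite !mxE fdot0l. Qed.

Lemma tvec0 : tvec 0 = 0.
Proof. by rewrite /tvec big1// => k _; rewrite mxE scale0r. Qed.

Lemma tvecK y : tcoord (tvec y) = y.
Proof.
apply/rowP => k; rewrite mxE fdot_suml (bigD1 k)//= fdotZl ob.2// eqxx mulr1.
rewrite big1 ?addr0// => l lk; rewrite fdotZl ob.2//.
by rewrite (_ : (l == k :> nat) = false) ?mulr0//; exact: negbTE.
Qed.

Lemma tangent_tvec y : tangent S (tvec y).
Proof.
rewrite /tvec; elim/big_ind: _ => [|u v|k _]; first exact: tangent0.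
  exact: tangentD.
by apply: tangentZ; exact: ob.1.
Qed.

Lemma tcoord_orth x y : fdot (x - tvec (tcoord x)) (tvec y) = 0.
Proof.
rewrite fdotC fdot_suml big1// => k _; rewrite fdotZl fdotC fdotBl.
by have /rowP/(_ k) := tvecK (tcoord x); rewrite !mxE => ->; rewrite subrr mulr0.
Qed.

Lemma tcoordK X : tangent S X -> tvec (tcoord X) = X.
Proof.
move=> tX; apply/esym/eqP; rewrite -subr_eq0; apply/eqP; apply: bmax.
  by apply: tangentD => //; apply: tangentN; exact: tangent_tvec.
move=> i id; have := tcoord_orth X (delta_mx 0 (Ordinal id)).
rewrite (_ : tvec (delta_mx _ _) = b i)//.
rewrite /tvec (bigD1 (Ordinal id))//= mxE !eqxx scale1r big1 ?addr0// => k kn.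
by rewrite mxE (negbTE kn) andbF scale0r.
Qed.

Lemma fnorm_pythagoras x x' : fdot x x' = 0 -> fnorm x <= fnorm (x + x').
Proof.
move=> h; rewrite -(@ler_pXn2r _ 2) ?nnegrE// !fnorm_sq fdotDl !fdotDr h.
by rewrite (fdotC x') h addr0 add0r lerDl fdot_ge0.
Qed.

Lemma tcoord_best x y : fnorm (x - tvec (tcoord x)) <= fnorm (x - tvec y).
Proof.
rewrite [X in _ <= fnorm X](_ : _ = (x - tvec (tcoord x)) + tvec (tcoord x - y)).
  by apply: fnorm_pythagoras; exact: tcoord_orth.
by rewrite tvecB addrA subrK.
Qed.

Lemma tcoord_contract x : fnorm (tvec (tcoord x)) <= fnorm x.
Proof.
rewrite -[X in _ <= fnorm X](subrK (tvec (tcoord x)) x) addrC.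
by apply: fnorm_pythagoras; rewrite fdotC tcoord_orth.
Qed.

Lemma tangent_remainder e : 0 < e -> exists2 r, 0 < r &
  forall h, og_set S h -> fnorm (h - 1%:M) < r ->
    fnorm (h - 1%:M - tvec (tcoord (h - 1%:M))) <= e * fnorm (h - 1%:M).
Proof.
move=> e0; have [r r0 hr] := tangent_approx S e0; exists r => // h Sh hh.
have [X tX hX] := hr h Sh hh; apply: le_trans hX.
by rewrite -[in leRHS](tcoordK tX); exact: tcoord_best.
Qed.

(** Write h = h' k. Then h - h' = h' (k - 1) differs from k - 1 by (h' - 1)(k - 1), at most a
    quarter of its norm, and k - 1 is tangent up to another quarter. So the projection keeps at
    least half of the norm. Halving r ensures that k falls in the domain of [tangent_remainder]. *)
Lemma tcoord_bilipschitz : exists r, [/\ 0 < r, r <= 1 / 4 &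
  forall h h', og_set S h -> og_set S h' -> fnorm (h - 1%:M) < r ->
    fnorm (h' - 1%:M) < r -> fnorm (h - h') <= 2 * fnorm (tvec (tcoord (h - h')))].
Proof.
have [r r0 hr] := @tangent_remainder (1 / 4) ltac:(lra).
exists (Num.min (1 / 4) (r / 2)); split; first by rewrite lt_min; apply/andP; split; lra.
  by rewrite ge_min lexx.
move=> h h' Sh Sh'; rewrite !lt_min => /andP[h1 h2] /andP[h'1 h'2].
pose k := h'^T *m h; have Sk : og_set S k by apply: og_setM => //; exact: og_setV.
have hk : h = h' *m k by rewrite mulmxA (og_orth Sh') mul1mx.
have wk : h - h' = h' *m (k - 1%:M) by rewrite mulmxBr -hk mulmx1.
have kw : fnorm (k - 1%:M) = fnorm (h - h') by rewrite wk (og_fnormMl _ Sh').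
have kr : fnorm (k - 1%:M) < r.
  by rewrite kw (le_lt_trans (fnorm_sub 1%:M _ _))// (fnormBC 1%:M); lra.
have := hr k Sk kr; rewrite kw => hR; set w := h - h' in wk kw hR *.
have dk : fnorm (w - (k - 1%:M)) <= 1 / 4 * fnorm w.
  have -> : w - (k - 1%:M) = (h' - 1%:M) *m (k - 1%:M) by rewrite mulmxBl mul1mx wk.
  by apply: le_trans (fnormM _ _) _; rewrite kw ler_wpM2r// ltW.
have l1 := tcoord_best w (tcoord (k - 1%:M)).
have l2 := fnorm_sub (k - 1%:M) w (tvec (tcoord (k - 1%:M))).
have := fnormD (w - tvec (tcoord w)) (tvec (tcoord w)); rewrite subrK.
move: (le_trans l1 l2) hR dk; clear.
move: (fnorm (w - tvec _)) (fnorm (tvec (tcoord w))) (fnorm w) => a1 a2 a3.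
move: (fnorm (w - _)) (fnorm (k - 1%:M - _)) => a4 a5; lra.
Qed.

Lemma tvec_eq0 y : tvec y = 0 -> y = 0.
Proof. by move=> h; rewrite -(tvecK y) h tcoord0. Qed.

Section LocalInverse.
Variable r : R.
Hypotheses (r0 : 0 < r) (r4 : r <= 1 / 4).
Hypothesis bilip : forall h h', og_set S h -> og_set S h' -> fnorm (h - 1%:M) < r ->
    fnorm (h' - 1%:M) < r -> fnorm (h - h') <= 2 * fnorm (tvec (tcoord (h - h'))).

(* Among the group elements close to 1, take one whose coordinate is closest to
   [y]: unless it equals [y], a small step in the tangent direction of the defect
   brings it closer. *)
Lemma tcoord_surjective y : fnorm (tvec y) < r / 16 -> exists h,
  [/\ og_set S h, fnorm (h - 1%:M) < r & tcoord (h - 1%:M) = y].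
Proof.
move=> yr; have r0' := r0; have r4' := r4.
pose f (h : og S) := fnorm (tvec (tcoord (og_val h - 1%:M)) - tvec y).
have cf : continuous f.
  apply: (@og_lipschitz_continuous R m S _ f 1) => // h h'; rewrite mul1r og_distE.
  have sub (u v : M) : `|fnorm u - fnorm v| <= fnorm (u - v).
    have h1 := fnormD (u - v) v; have h2 := fnormD (v - u) u.
    rewrite !subrK in h1 h2; rewrite (fnormBC v) in h2.
    by rewrite ler_norml; apply/andP; split; lra.
  apply: le_trans (sub _ _) _.
  have -> : tvec (tcoord (og_val h - 1%:M)) - tvec y - (tvec (tcoord (og_val h' - 1%:M)) - tvec y)
      = tvec (tcoord (og_val h - og_val h')).
    by rewrite !tcoordB !tvecB; apply/matrixP => i j; rewrite !mxE; ring.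
  exact: tcoord_contract.
pose A := [set h : og S | fnorm (og_val h - 1%:M) <= r / 2].
have cA : compact A.
  apply: (subclosed_compact _ (@og_compact R m S)) => // h hA.
  rewrite /A /=; apply/ler_addgt0Pr => e e0.
  have [h' [h'A]] := hA _ (nbhsx_ballx h e e0); rewrite ballEmdist /= og_distE => hh.
  rewrite /A /= in h'A; have := fnorm_sub (og_val h') (og_val h) 1%:M.
  lra.
have A1 : A 1%g by rewrite /A /mkset og_val1 subrr fnorm0 divr_ge0// ltW.
have [||h0 h0A hmin] := @compact_EVT_min _ R f A _ cA.
- by exists 1%g.
- exact: continuous_subspaceT.
rewrite inE /A /= in h0A.
set h1 := og_val h0 in h0A; have Sh1 : og_set S h1 by exact: og_valP.
have f1 : f h0 <= fnorm (tvec y).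
  apply: le_trans (hmin 1%g _) _; first by rewrite inE.
  by rewrite /f og_val1 subrr tcoord0 tvec0 sub0r fnormN.
(* The minimum is at most the value at 1, so the coordinate of h1 has norm at most twice r / 16.
   This keeps h1 away from the boundary of A, at r / 2, and leaves room for one more step. *)
have h1r : fnorm (h1 - 1%:M) <= r / 4.
  have := @bilip h1 1%:M Sh1 (og_set1 S); rewrite subrr fnorm0 => /(_ _ r0) h.
  have {h} := h ltac:(lra); have := fnormD (tvec (tcoord (h1 - 1%:M)) - tvec y) (tvec y).
  by rewrite subrK; rewrite /f -/h1 in f1; lra.
exists h1; split => //; first by lra.
set D := tvec y - tvec (tcoord (h1 - 1%:M)).
have fD : f h0 = fnorm D by rewrite /f fnormBC.
have [D0|D0] := eqVneq (fnorm D) 0.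
  apply/eqP; rewrite -subr_eq0; apply/eqP; apply: tvec_eq0.
  by rewrite tvecB -opprB -/D (fnorm_eq0 D0) oppr0.
have {}D0 : 0 < fnorm D by rewrite lt_def D0 fnorm_ge0.
exfalso.
have tD : tangent S D.
  by apply: tangentD; [exact: tangent_tvec|apply: tangentN; exact: tangent_tvec].
have [q q0 hq] := tangent_step tD (divr_gt0 D0 (ltr0n _ 4)).
(* The three bounds on t make the step tangent up to a quarter of |D|, keep 1 - t nonnegative, and
   keep h1 k inside A. The gain t |D| then exceeds the errors, which are t |D| / 4 from the tangency
   and at most 5 t |D| / 64 from (h1 - 1)(k - 1). *)
pose t := Num.min (q / 2) (Num.min (1 / 2) (r / 8 / fnorm D)).
have t0 : 0 < t by rewrite !lt_min !divr_gt0//.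
have tq : t < q.
  have : t <= q / 2 by rewrite ge_min lexx.
  lra.
have t1 : t <= 1 / 2 by rewrite !ge_min lexx orbT.
have tr : t * fnorm D <= r / 8 by rewrite -ler_pdivlMr// !ge_min lexx !orbT.
have [k [Sk k1 k2]] := hq t t0 tq.
pose h2 : og S := (h0 * og_of Sk)%g.
have v2 : og_val h2 = h1 *m k by rewrite og_valM.
have hk : h1 *m k - h1 = h1 *m (k - 1%:M) by rewrite mulmxBr mulmx1.
have h2A : A h2.
  rewrite /A /mkset v2; apply: le_trans (fnorm_sub h1 _ _) _.
  rewrite hk (og_fnormMl _ Sh1); lra.
have := hmin h2; rewrite inE => /(_ h2A); rewrite fD /f v2; apply/negP; rewrite -ltNge.
have -> : tvec (tcoord (h1 *m k - 1%:M)) - tvec y =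
    tvec (tcoord ((k - 1%:M - t *: D) + (h1 - 1%:M) *m (k - 1%:M))) - (1 - t) *: D.
  set z := _ + (h1 - 1%:M) *m (k - 1%:M).
  have e1 : h1 *m k - 1%:M = (h1 - 1%:M) + z + t *: D.
    rewrite /z mulmxBr mulmx1 mulmxBl mul1mx.
    by apply/matrixP => i j; rewrite !mxE; ring.
  rewrite {}e1 !tcoordD !tvecD -tvecD -tcoordD tcoordZ tvecZ (tcoordK tD) scalerBl scale1r /D.
  move: (tvec (tcoord (h1 - _))) (tvec y) (tvec (tcoord z)) => a c g.
  by apply/matrixP => i j; rewrite !mxE; ring.
apply: le_lt_trans (fnormB _ _) _; rewrite fnormZ ger0_norm ?subr_ge0; last by lra.
have l1 := tcoord_contract (k - 1%:M - t *: D + (h1 - 1%:M) *m (k - 1%:M)).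
have l2 := fnormD (k - 1%:M - t *: D) ((h1 - 1%:M) *m (k - 1%:M)).
have l3 := fnormM (h1 - 1%:M) (k - 1%:M).
have l4 : fnorm (h1 - 1%:M) * fnorm (k - 1%:M) <= 1 / 16 * fnorm (k - 1%:M).
  by rewrite ler_wpM2r//; lra.
have l5 : 0 < t * fnorm D by rewrite mulr_gt0.
lra.
Qed.

Definition tball : set 'rV[R]_d := [set y | fnorm (tvec y) < r / 16].

Lemma tcoord_injective h h' : og_set S h -> og_set S h' ->
  fnorm (h - 1%:M) < r -> fnorm (h' - 1%:M) < r ->
  tcoord (h - 1%:M) = tcoord (h' - 1%:M) -> h = h'.
Proof.
move=> Sh Sh' hr hr' e; apply/eqP; rewrite -subr_eq0; apply/eqP/fnorm_eq0.
have := bilip Sh Sh' hr hr'.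
have -> : h - h' = (h - 1%:M) - (h' - 1%:M) by rewrite opprB addrA subrK.
rewrite tcoordB e subrr tvec0 fnorm0 mulr0.
by move=> h0; apply/eqP; rewrite eq_le h0 fnorm_ge0.
Qed.

(* Outside of [tball] the parametrization has junk values in the group. *)
Lemma tparam_ex y : exists h, og_set S h /\ (tball y ->
  fnorm (h - 1%:M) < r /\ tcoord (h - 1%:M) = y).
Proof.
have [yb|yb] := pselect (tball y); last by exists 1%:M; split => //; exact: og_set1.
by have [h [Sh hr hy]] := tcoord_surjective yb; exists h.
Qed.

Definition tparam y : M := projT1 (cid (tparam_ex y)).

Lemma tparam_og y : og_set S (tparam y).
Proof. by rewrite /tparam; case: cid => h []. Qed.

Lemma tparam_near y : tball y -> fnorm (tparam y - 1%:M) < r.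
Proof. by rewrite /tparam; case: cid => h /= [_ hb] /hb[]. Qed.

Lemma tparamK y : tball y -> tcoord (tparam y - 1%:M) = y.
Proof. by rewrite /tparam; case: cid => h /= [_ hb] /hb[]. Qed.

Lemma tcoord_paramK h : og_set S h -> fnorm (h - 1%:M) < r ->
  tball (tcoord (h - 1%:M)) -> tparam (tcoord (h - 1%:M)) = h.
Proof.
move=> Sh hr hb; apply: tcoord_injective => //; first exact: tparam_og.
  exact: tparam_near.
exact: tparamK.
Qed.

Lemma tparam_lipschitz y y' : tball y -> tball y' ->
  fnorm (tparam y - tparam y') <= 2 * fnorm (tvec (y - y')).
Proof.
move=> yb yb'.
apply: le_trans (bilip (tparam_og y) (tparam_og y') (tparam_near yb) (tparam_near yb')) _.
have -> : tparam y - tparam y' = (tparam y - 1%:M) - (tparam y' - 1%:M).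
  by rewrite opprB addrA subrK.
by rewrite tcoordB !tparamK.
Qed.

(** This is the linear map L(g) of the differential equation: in the coordinates at 1, the effect of
    moving g in the direction g X with X tangent. Row vectors are multiplied on the right, as
    [tjacE] records. *)
Definition tjac (g : M) : 'M[R]_d := \matrix_(i < d, j < d) fdot (g *m b i) (b j).

Lemma tjacE g v : v *m tjac g = tcoord (g *m tvec v).
Proof.
apply/rowP => k; rewrite !mxE mulmx_sumr fdot_suml; apply: eq_bigr => i _.
by rewrite mxE -scalemxAr fdotZl.
Qed.

Lemma tjac_bound g v : fnorm (g - 1%:M) <= 1 / 2 ->
  fnorm (tvec v) <= 2 * fnorm (tvec (v *m tjac g)).
Proof.
move=> g1; have e : tvec v = tvec (v *m tjac g) - tvec (tcoord ((g - 1%:M) *m tvec v)).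
  by rewrite tjacE mulmxBl mul1mx tcoordB tvecK tvecB opprB addrC subrK.
have := fnormB (tvec (v *m tjac g)) (tvec (tcoord ((g - 1%:M) *m tvec v))).
have := tcoord_contract ((g - 1%:M) *m tvec v).
have := fnormM (g - 1%:M) (tvec v); rewrite -e.
have : fnorm (g - 1%:M) * fnorm (tvec v) <= 1 / 2 * fnorm (tvec v) by rewrite ler_wpM2r.
lra.
Qed.

Lemma tjac_unit g : fnorm (g - 1%:M) <= 1 / 2 -> tjac g \in unitmx.
Proof.
move=> g1; rewrite -row_free_unit; apply: inj_row_free => v v0.
apply: tvec_eq0; apply: fnorm_eq0; apply/eqP; rewrite eq_le fnorm_ge0 andbT.
by have := tjac_bound v g1; rewrite v0 tvec0 fnorm0 mulr0.
Qed.

Lemma tparam_half y : tball y -> fnorm (tparam y - 1%:M) <= 1 / 2.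
Proof. by move=> /tparam_near h; move: r4; lra. Qed.

Definition tderiv y v : M := tparam y *m tvec (v *m invmx (tjac (tparam y))).

(** With g' = g k, write k - 1 = tvec w + Q, where Q is small with respect to t by
    [tangent_remainder]. Projection of g' - g gives t v = w A + tcoord (g Q), an exact linear
    equation for w; inverting A makes the error explicit. *)
Lemma tparam_derive y v e : tball y -> 0 < e -> exists2 q, 0 < q &
  forall t : R, t != 0 -> `|t| < q ->
    fnorm (t^-1 *: (tparam (t *: v + y) - tparam y) - tderiv y v) <= e.
Proof.
move=> yb e0; pose K := fnorm (tvec v) + 1.
have K0 : 0 < K by rewrite ltr_wpDl.
(* Since |k - 1| is at most 2 |t| K, the factor 6 makes |Q| at most a third of |t| e. The error is
   bounded by |Q| plus 2 |Q|, the 2 being the bound for the inverse of [tjac]. *)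
have [r' r'0 hr'] := tangent_remainder (divr_gt0 e0 (mulr_gt0 (ltr0n R 6) K0)).
have gap : 0 < r / 16 - fnorm (tvec y) by rewrite subr_gt0.
exists (Num.min ((r / 16 - fnorm (tvec y)) / K) (r' / 2 / K)).
  by rewrite lt_min !divr_gt0.
move=> t t0; rewrite lt_min !ltr_pdivlMr// => /andP[t1 t2].
have tp : 0 < `|t| by rewrite normr_gt0.
have tv : `|t| * fnorm (tvec v) <= `|t| * K by rewrite ler_wpM2l// lerDl.
have yb' : tball (t *: v + y).
  rewrite /tball /mkset tvecD tvecZ; apply: le_lt_trans (fnormD _ _) _.
  by rewrite fnormZ; lra.
set g := tparam y; set g' := tparam _; pose A := tjac g.
have Sg : og_set S g by exact: tparam_og.
have uA : A \in unitmx by apply: tjac_unit; exact: tparam_half.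
pose k := g^T *m g'; have Sk : og_set S k.
  by apply: og_setM; [exact: og_setV|exact: tparam_og].
have gk : g' - g = g *m (k - 1%:M) by rewrite mulmxBr mulmxA (og_orth Sg) mul1mx mulmx1.
have sk : fnorm (k - 1%:M) <= 2 * (`|t| * fnorm (tvec v)).
  rewrite -(og_fnormMl _ Sg) -gk -fnormZ -tvecZ -(addrK y (t *: v)).
  exact: tparam_lipschitz.
have hR := hr' k Sk ltac:(lra); set w := tcoord (k - 1%:M) in hR.
set Q := k - 1%:M - tvec w in hR.
have kE : k - 1%:M = tvec w + Q by rewrite /Q [RHS]addrC subrK.
have tvE : t *: v = w *m A + tcoord (g *m Q).
  rewrite tjacE -tcoordD -mulmxDr -kE -gk.
  have -> : g' - g = (g' - 1%:M) - (g - 1%:M) by rewrite opprB addrA subrK.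
  by rewrite tcoordB !tparamK// addrK.
have wE : w = t *: (v *m invmx A) - tcoord (g *m Q) *m invmx A.
  by rewrite scalemxAl tvE mulmxDl mulmxK// addrK.
have E : t^-1 *: (g' - g) - tderiv y v =
    t^-1 *: (g *m Q - g *m tvec (tcoord (g *m Q) *m invmx A)).
  rewrite /tderiv -/g -/A gk kE mulmxDr wE tvecB tvecZ mulmxBr -scalemxAr.
  rewrite !scalerDr scalerA mulVf// scale1r.
  move: (t^-1 *: (g *m Q)) (g *m tvec (v *m _)) (t^-1 *: - _) => a c f.
  by apply/matrixP => i j; rewrite !mxE; ring.
rewrite E fnormZ normfV ler_pdivrMl//; apply: le_trans (fnormB _ _) _.
rewrite !(og_fnormMl _ Sg).
have b1 := tjac_bound (tcoord (g *m Q) *m invmx A) (tparam_half yb).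
rewrite -/g -/A mulmxKV// in b1.
have b2 := tcoord_contract (g *m Q); rewrite (og_fnormMl _ Sg) in b2.
have b3 : fnorm Q <= e / (6 * K) * (2 * (`|t| * K)).
  have c6 : 0 <= e / (6 * K) by apply/ltW; rewrite divr_gt0// mulr_gt0.
  apply: le_trans hR _; rewrite ler_wpM2l//.
  by apply: le_trans sk _; rewrite ler_wpM2l.
have b4 : e / (6 * K) * (2 * (`|t| * K)) = `|t| * e / 3.
  by field; rewrite gt_eqF.
lra.
Qed.

Lemma tvec_bound y : fnorm (tvec y) <= d%:R * `|y|.
Proof.
rewrite /tvec; have nsum (I : Type) (s : seq I) (F : I -> M) :
    fnorm (\sum_(i <- s) F i) <= \sum_(i <- s) fnorm (F i).
  elim: s => [|i s ih]; first by rewrite !big_nil fnorm0.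
  by rewrite !big_cons; apply: le_trans (fnormD _ _) _; rewrite lerD2l.
apply: le_trans (nsum _ _ _) _.
rewrite -[d in d%:R]card_ord -sum1_card natr_sum mulr_suml; apply: ler_sum => k _.
rewrite fnormZ mul1r -[leRHS]mulr1; apply: ler_pM => //.
  rewrite [leRHS]/Num.Def.normr/= mx_normrE.
  by apply: le_trans (le_bigmax _ _ (0, k)).
by rewrite /fnorm ob.2// eqxx sqrtr1.
Qed.

Lemma tball_open : open tball.
Proof.
rewrite openE => y yb; have gap : 0 < r / 16 - fnorm (tvec y) by rewrite subr_gt0.
have d1 : 0 < d%:R + 1 :> R by rewrite ltr_wpDl.
rewrite /interior -nbhs_ballE; exists ((r / 16 - fnorm (tvec y)) / (d%:R + 1)).
  exact: divr_gt0.
move=> y'; rewrite -ball_normE /= ltr_pdivlMr// => yy'.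
rewrite /tball /mkset -(subrK y y') tvecD; apply: le_lt_trans (fnormD _ _) _.
have := tvec_bound (y' - y); rewrite distrC => h.
have := normr_ge0 (y - y'); move: yy'; rewrite mulrC mulrDl mul1r; lra.
Qed.

Lemma tparam_continuous y : tball y -> forall e, 0 < e ->
  \forall y' \near y, fnorm (tparam y - tparam y') < e.
Proof.
move=> yb e e0; have d1 : 0 < 2 * d%:R + 1 :> R by rewrite ltr_wpDl// mulr_ge0.
have yn : nbhs y tball by apply: open_nbhs_nbhs; split => //; exact: tball_open.
have yn' : nbhs y (ball y (e / (2 * d%:R + 1))) by apply: nbhsx_ballx; exact: divr_gt0.
apply: filterS (filterI yn yn') => y' [y'b]; rewrite -ball_normE /= ltr_pdivlMr// => yy'.
apply: le_lt_trans (tparam_lipschitz yb y'b) _.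
have := tvec_bound (y - y'); have := normr_ge0 (y - y'); move: yy'.
rewrite mulrC mulrDl mul1r; lra.
Qed.

Lemma tparam_derivable y v i j : tball y ->
  is_derive y v (fun z => tparam z i j) (tderiv y v i j).
Proof.
move=> yb.
have h : (fun t : R => t^-1 *: ((tparam (t *: v + y) i j) - tparam y i j)) @ 0^' -->
    tderiv y v i j.
  apply/cvgrPdist_le => e e0; have [q q0 hq] := tparam_derive v yb e0.
  near=> t.
  have tn : t != 0 by near: t; exact: nbhs_dnbhs_neq.
  have tq : `|t| < q by near: t; exact: dnbhs0_lt.
  rewrite distrC; apply: le_trans (hq t tn tq).
  have := fnorm_entry (t^-1 *: (tparam (t *: v + y) - tparam y) - tderiv y v) i j.
  by rewrite !mxE.
apply: DeriveDef; first by apply/cvg_ex; exists (tderiv y v i j).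
exact/cvg_lim.
Unshelve. all: by end_near. Qed.

(** Bootstrapping: the derivative [tderiv] is a rational expression in the entries of [tparam], so
    each order of regularity yields the next one. *)
Lemma tparam_smooth k : Cmx k tball tparam.
Proof.
have cont i j : forall y, tball y -> {for y, continuous (fun z => tparam z i j)}.
  move=> y yb; apply/(@cvgrPdist_lt _ R 'rV[R]_d (nbhs (y : 'rV[R]_d)) _) => e e0.
  apply: filterS (tparam_continuous yb e0) => y'; apply: le_lt_trans.
  by have := fnorm_entry (tparam y - tparam y') i j; rewrite !mxE.
elim: k => [|k ih] i j; first by split; [exact: cont|].
split; first exact: cont.
move=> v; split=> [y yb|]; first by have [] := tparam_derivable v i j yb.
have oB := tball_open.
apply: (@Ck_ext R _ _ _ tball (fun y => tderiv y v i j)) => //.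
  by move=> y yb; have [_ ->] := tparam_derivable v i j yb.
move: i j; apply: Cmx_mul => // i j.
have cJ : Cmx k tball (fun y => tjac (tparam y)).
  move=> p q; rewrite (_ : (fun y => _) =
      fun y => \sum_l \sum_l' ((tparam y *m b p) l l' * b q l l')).
    apply: Ck_sum => // l; apply: Ck_sum => // l'; apply: CkM => //.
      by move: l l'; apply: Cmx_mul => //; exact: Cmx_cst.
    exact: Ck_cst.
  by apply/funext => y; rewrite mxE.
have cI := Cmx_inv oB (fun y yb => tjac_unit (tparam_half yb)) cJ.
rewrite (_ : (fun y => _) =
    fun y => \sum_(l < d) (v *m invmx (tjac (tparam y))) 0 l * b l i j).
  apply: Ck_sum => // l; apply: CkM => //; last exact: Ck_cst.
  move: (0 : 'I_1) l; apply: Cmx_mul => //; exact: Cmx_cst.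
by apply/funext => y; rewrite /tvec summxE; apply: eq_bigr => l _; rewrite mxE.
Qed.

Lemma tcoord_smooth (V : normedModType R) (U : set V) (F : V -> M) : open U ->
  (forall k, Cmx k U F) -> smooth_on U (fun z => tcoord (F z - 1%:M)).
Proof.
move=> oU cF k; apply: Ck_mx => // i l.
rewrite (_ : (fun z => _) = fun z => \sum_p \sum_q ((F z p q + - (1%:M : M) p q) * b l p q)).
  apply: Ck_sum => // p; apply: Ck_sum => // q; apply: CkM => //; last exact: Ck_cst.
  by apply: CkD => //; [exact: cF|exact: Ck_cst].
apply/funext => z; rewrite mxE; apply: eq_bigr => p _; apply: eq_bigr => q _.
by rewrite !mxE.
Qed.

Definition tgroup y : og S := og_of (tparam_og y).

(** All charts are left translates of the chart at 1. They share the image [tball], and in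
    coordinates the transition maps, the product and the inverse are [tcoord] of matrix expressions
    in [tparam]. *)
Definition tchart (x : og S) : chart R (og S) d := Chart
  [set h | fnorm (og_val (x^-1 * h)%g - 1%:M) < r /\
           tball (tcoord (og_val (x^-1 * h)%g - 1%:M))]
  (fun h => tcoord (og_val (x^-1 * h)%g - 1%:M))
  (fun y => (x * tgroup y)%g).

Lemma tchart_img (x : og S) : chart_img (tchart x) = tball.
Proof.
apply/seteqP; split => [_ [h [_ hb] <-] //|y yb].
have e : (x^-1 * (x * tgroup y))%g = tgroup y by exact: mulKg.
exists (x * tgroup y)%g; last by rewrite /tchart /chart_coord e; exact: tparamK.
split; rewrite e; first exact: tparam_near.
by rewrite [tcoord _](tparamK yb).
Qed.

Lemma tcoord_continuous (x : og S) :
  continuous (fun h : og S => tcoord (og_val (x^-1 * h)%g - 1%:M)).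
Proof.
apply: (@og_lipschitz_continuous R m S _ _ 1) => // h h'.
rewrite mul1r -tcoordB -(og_distMl x^-1%g h h') og_distE.
have -> : og_val (x^-1 * h)%g - 1%:M - (og_val (x^-1 * h')%g - 1%:M) =
    og_val (x^-1 * h)%g - og_val (x^-1 * h')%g by rewrite opprB addrA subrK.
move: (_ - _) => z; rewrite [leLHS]/Num.Def.normr/= mx_normrE bigmax_le// => -[i k] _ /=.
rewrite mxE ler_norml lerNl -fdotNl -(mulr1 (fnorm z)).
have bk : fnorm (b k) = 1 by rewrite /fnorm ob.2// eqxx sqrtr1.
apply/andP; split; last by rewrite -bk; exact: fdot_le.
by rewrite -(fnormN z) -bk; exact: fdot_le.
Qed.

Lemma tnorm_continuous (x : og S) :
  continuous (fun h : og S => fnorm (og_val (x^-1 * h)%g - 1%:M)).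
Proof.
apply: (@og_lipschitz_continuous R m S _ _ 1) => // h h'.
rewrite mul1r -(og_distMl x^-1%g h h') og_distE.
have h1 := fnorm_sub (og_val (x^-1 * h')%g) (og_val (x^-1 * h)%g) 1%:M.
have h2 := fnorm_sub (og_val (x^-1 * h)%g) (og_val (x^-1 * h')%g) 1%:M.
rewrite [X in _ <= X + _]fnormBC in h2.
by rewrite ler_norml; apply/andP; split; lra.
Qed.

Lemma tchart_dom_open (x : og S) : open (chart_dom (tchart x)).
Proof.
apply: openI.
  apply: (@open_comp _ _ _ [set a : R | a < r]) => [h _|]; first exact: tnorm_continuous.
  exact: open_lt.
by apply: open_comp; [move=> h _; exact: tcoord_continuous|exact: tball_open].
Qed.

Lemma tchart_is_chart (x : og S) : is_chart (tchart x).
Proof.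
split; rewrite ?tchart_img.
- exact: tchart_dom_open.
- exact: tball_open.
- by move=> h _; exact: tcoord_continuous.
- move=> y yb; apply/(@metricType_numDomainType.cvgrPdist_lt R (og S) 'rV[R]_d (nbhs (y : 'rV[R]_d)) _) => e e0.
  apply: filterS (tparam_continuous yb e0) => y'.
  by rewrite /= og_distMl og_distE.
- move=> h [hr hb] /=; apply: (mulgI x^-1%g); rewrite mulKg; apply: val_inj => /=.
  exact: tcoord_paramK (og_valP _) hr hb.
Qed.

Lemma tangent_lie_atlas : lie_atlas [set c | exists x : og S, c = tchart x].
Proof.
have oB := tball_open.
split; first split.
- by move=> _ [x ->]; exact: tchart_is_chart.
- move=> x; exists (tchart x); first by exists x.
  have e : (x^-1 * x)%g = 1%g by exact: mulVg.
  split; rewrite e og_val1 subrr ?fnorm0// tcoord0.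
  by rewrite /tball /mkset tvec0 fnorm0 divr_gt0.
- move=> _ _ [x ->] [x' ->]; rewrite tchart_img /= => k.
  apply: (@Ck_sub _ _ _ _ _ tball) => [y []//|].
  apply: (@tcoord_smooth _ tball (fun y => og_val (x'^-1 * (x * tgroup y))%g)) => // {}k.
  rewrite (_ : (fun y => _) = fun y => (og_val x')^T *m (og_val x *m tparam y)).
    by apply: Cmx_mul => //; [exact: Cmx_cst|apply: Cmx_mul => //; [exact: Cmx_cst|exact: tparam_smooth]].
  by apply/funext => y; rewrite !og_valM og_valV.
- move=> _ _ _ [x1 ->] [x2 ->] [x3 ->] k; rewrite !tchart_img /=.
  have oB1 : open [set y : 'rV[R]_d * 'rV[R]_d | tball y.1].
    by apply: open_comp => // y _; exact: cvg_fst.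
  have oB2 : open [set y : 'rV[R]_d * 'rV[R]_d | tball y.2].
    by apply: open_comp => // y _; exact: cvg_snd.
  pose BB := [set y : 'rV[R]_d * 'rV[R]_d | tball y.1] `&` [set y | tball y.2].
  have oBB : open BB by exact: openI.
  apply: (@Ck_sub _ _ _ _ _ BB) => [y []//|].
  apply: (@tcoord_smooth ('rV[R]_d * 'rV[R]_d)%type BB (fun z : 'rV[R]_d * 'rV[R]_d =>
      (og_val x3)^T *m (og_val x1 *m tparam z.1 *m (og_val x2 *m tparam z.2)))) => // {}k.
  apply: Cmx_mul => //; first exact: Cmx_cst.
  apply: Cmx_mul => //; apply: Cmx_mul => //; try exact: Cmx_cst.
    move=> i j; apply: (@Ck_sub _ _ _ _ _ [set y | tball y.1]) => [y []//|].
    by apply: (@Ck_fst R 'rV[R]_d 'rV[R]_d R k tball (fun y => tparam y i j)); exact: tparam_smooth.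
  move=> i j; apply: (@Ck_sub _ _ _ _ _ [set y | tball y.2]) => [y []//|].
  by apply: (@Ck_snd R 'rV[R]_d 'rV[R]_d R k tball (fun y => tparam y i j)); exact: tparam_smooth.
- move=> _ _ [x1 ->] [x2 ->] k; rewrite !tchart_img /=.
  apply: (@Ck_sub _ _ _ _ _ tball) => [y []//|].
  apply: (@tcoord_smooth _ tball (fun y => og_val (x2^-1 * (x1 * tgroup y)^-1)%g)) => // {}k.
  rewrite (_ : (fun y => _) = fun y => (og_val x2)^T *m (og_val x1 *m tparam y)^T).
    apply: Cmx_mul => //; first exact: Cmx_cst.
    apply: Cmx_tr; apply: Cmx_mul => //; [exact: Cmx_cst|exact: tparam_smooth].
  by apply/funext => y; rewrite !og_valM !og_valV og_valM.
Qed.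

End LocalInverse.
End TangentCoordinates.

Theorem og_Lie_group (R : realType) (m : nat) (S : orthogonal_group R m) :
  compact_Lie_group R (og S).
Proof.
split; [exact: og_compact|exact: og_hausdorff|].
have [d [b [ob bmax]]] := tangent_basis S.
have [r [r0 r4 bilip]] := tcoord_bilipschitz ob bmax.
exists d, [set c | exists x, c = tchart ob bmax r0 r4 bilip x].
exact: tangent_lie_atlas.
Qed.

(** * Models from families of representations *)

Section ComplexIntegral.
Variables (R : realType) (m : nat) (S : orthogonal_group R m).
Local Notation T := (og S).
Local Notation C := R[i].
Implicit Types f g : T -> C.

Definition ccont f := continuous (fun x => complex.Re (f x)) /\
  continuous (fun x => complex.Im (f x)).

Lemma ccont_cst (c : C) : ccont (fun=> c).
Proof. by split=> x; exact: cst_continuous. Qed.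

Lemma ccontD f g : ccont f -> ccont g -> ccont (fun x => f x + g x).
Proof.
move=> [f1 f2] [g1 g2]; split.
  rewrite (_ : (fun x => _) = fun x => complex.Re (f x) + complex.Re (g x)).
    by move=> x; apply: continuousD; [exact: f1|exact: g1].
  by apply/funext => x; case: (f x) => a b; case: (g x).
rewrite (_ : (fun x => _) = fun x => complex.Im (f x) + complex.Im (g x)).
  by move=> x; apply: continuousD; [exact: f2|exact: g2].
by apply/funext => x; case: (f x) => a b; case: (g x).
Qed.

Lemma ccontM f g : ccont f -> ccont g -> ccont (fun x => f x * g x).
Proof.
move=> [f1 f2] [g1 g2]; split.
  rewrite (_ : (fun x => _) = fun x => complex.Re (f x) * complex.Re (g x) -
      complex.Im (f x) * complex.Im (g x)).
    by move=> x; exact: (cvgB (cvgM (f1 x) (g1 x)) (cvgM (f2 x) (g2 x))).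
  by apply/funext => x; case: (f x) => a b; case: (g x).
rewrite (_ : (fun x => _) = fun x => complex.Re (f x) * complex.Im (g x) +
    complex.Im (f x) * complex.Re (g x)).
  by move=> x; exact: (cvgD (cvgM (f1 x) (g2 x)) (cvgM (f2 x) (g1 x))).
by apply/funext => x; case: (f x) => a b; case: (g x).
Qed.

Lemma ccont_sum (I : Type) (s : seq I) (f : I -> T -> C) :
  (forall i, ccont (f i)) -> ccont (fun x => \sum_(i <- s) f i x).
Proof.
move=> h; elim: s => [|i s ih].
  by rewrite (_ : (fun x => _) = fun=> 0); [exact: ccont_cst|apply/funext => x; rewrite big_nil].
rewrite (_ : (fun x => _) = fun x => f i x + \sum_(i <- s) f i x); first exact: ccontD.
by apply/funext => x; rewrite big_cons.
Qed.

Lemma ccont_comp f (s : T -> T) : ccont f -> continuous s -> ccont (f \o s).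
Proof.
move=> [f1 f2] cs; split=> x.
  by apply: (@continuous_comp T T R s (fun x => complex.Re (f x)) x); [exact: cs|exact: f1].
by apply: (@continuous_comp T T R s (fun x => complex.Im (f x)) x); [exact: cs|exact: f2].
Qed.

Lemma ccont_near f : (forall x (e : R), 0 < e -> \forall y \near x, cn (f x - f y) < e) ->
  ccont f.
Proof.
move=> h; split=> x; apply/(@cvgrPdist_lt _ R T (nbhs (x : T)) _) => e e0;
  apply: filterS (h x e e0) => y; apply: le_lt_trans.
  by rewrite -raddfB; exact: cn_Re.
by rewrite -raddfB; exact: cn_Im.
Qed.

Lemma ccont_continuous f : ccont f -> continuous (f : T -> C^o).
Proof.
move=> [f1 f2] x; apply/(@cvgrPdist_lt _ C^o T (nbhs (x : T)) _) => e e0.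
have r0 : 0 < cn e / 2.
  rewrite divr_gt0// lt_def cn_ge0 andbT; apply/eqP => /cn_eq0 e1.
  by rewrite e1 ltxx in e0.
have ee : e = (cn e)%:C by rewrite -cnE ger0_norm// ltW.
have /(@cvgrPdist_lt _ R T (nbhs (x : T)) _) h1 := f1 x.
have /(@cvgrPdist_lt _ R T (nbhs (x : T)) _) h2 := f2 x.
apply: filterS (filterI (h1 _ r0) (h2 _ r0)) => y [/= h3 h4].
rewrite ee cnE ltcR; apply: le_lt_trans (cn_ReIm _) _.
by rewrite !raddfB /= (splitr (cn e)) ltrD.
Qed.

Definition cint f : C := haar_integral (fun x => complex.Re (f x)) +i*
  haar_integral (fun x => complex.Im (f x)).

Lemma eq_cint f g : f =1 g -> cint f = cint g.
Proof. by move=> /funext ->. Qed.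

Lemma cintD f g : ccont f -> ccont g -> cint (fun x => f x + g x) = cint f + cint g.
Proof.
move=> [f1 f2] [g1 g2]; rewrite /cint.
rewrite -[RHS]/((_ + _) +i* (_ + _)) -!haar_integralD//.
by congr (_ +i* _); congr haar_integral; apply/funext => x; rewrite raddfD.
Qed.

Lemma cintZ (c : C) f : ccont f -> cint (fun x => c * f x) = c * cint f.
Proof.
move=> [f1 f2]; case: c => a b; rewrite /cint.
have -> : (a +i* b) * (haar_integral (fun x => complex.Re (f x)) +i*
    haar_integral (fun x => complex.Im (f x))) =
    (a * haar_integral (fun x => complex.Re (f x)) +
      - b * haar_integral (fun x => complex.Im (f x))) +i*
    (a * haar_integral (fun x => complex.Im (f x)) +
      b * haar_integral (fun x => complex.Re (f x))).
  by rewrite mulNr; simpc.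
have cM (r : R) (h : T -> R) : continuous h -> continuous (fun x => r * h x).
  by move=> ch x; apply: continuousM; [exact: cst_continuous|exact: ch].
rewrite -!haar_integralZ// -!haar_integralD//; try exact: cM.
congr (_ +i* _); congr haar_integral; apply/funext => x.
  by case: (f x) => p q /=; rewrite mulNr.
by case: (f x) => p q /=.
Qed.

Lemma cint_sum (I : Type) (s : seq I) (f : I -> T -> C) : (forall i, ccont (f i)) ->
  cint (fun x => \sum_(i <- s) f i x) = \sum_(i <- s) cint (f i).
Proof.
move=> h; elim: s => [|i s ih].
  rewrite big_nil (eq_cint (g := fun=> 0)) => [|x]; last by rewrite big_nil.
  by rewrite /cint /= haar_integral_cst.
rewrite big_cons (eq_cint (g := fun x => f i x + \sum_(i <- s) f i x)) => [|x].
  by rewrite cintD ?ih//; exact: ccont_sum.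
by rewrite big_cons.
Qed.

Lemma cint_cst (c : C) : cint (fun=> c) = c.
Proof. by rewrite /cint !haar_integral_cst; case: c. Qed.

Lemma cintMl (z : T) f : ccont f -> cint (fun x => f (z * x)%g) = cint f.
Proof. by move=> [f1 f2]; congr (_ +i* _); exact: (haar_integralMl z). Qed.

Lemma cintMr (z : T) f : ccont f -> cint (fun x => f (x * z)%g) = cint f.
Proof. by move=> [f1 f2]; congr (_ +i* _); exact: (haar_integralMr z). Qed.

Lemma cint_ge0 f : (forall x, 0 <= f x) -> 0 <= cint f.
Proof.
move=> f0; have Re0 x : 0 <= complex.Re (f x).
  by have := f0 x; rewrite (ge0_real (f0 x)) lecR.
have -> : cint f = (haar_integral (fun x => complex.Re (f x)))%:C.
  congr (_ +i* _); rewrite (_ : (fun x => _) = fun=> 0) ?haar_integral_cst//.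
  by apply/funext => x; rewrite (ge0_real (f0 x)).
by rewrite lecR; exact: haar_integral_ge0.
Qed.

End ComplexIntegral.

Section StationaryModel.
Variables (R : realType) (N : nat) (G : compactMatrixQuantumGroup R N).
Local Notation A := (cqg_alg G).
Local Notation C := R[i].
Variables (m : nat) (S : orthogonal_group R m) (rho : A -> og S -> bool -> bool -> C).
Hypothesis rho_rep : forall x, rep (fun a => rho a x).
Hypothesis rho_cont : forall a i j, ccont (fun x => rho a x i j).
Hypothesis rho_inj : forall a, (forall x i j, rho a x i j = 0) -> a = 0.
(** The convolution formula after a trace over the first leg: what remains in the second leg is
    diagonal. The translation t depends on the index because a pair representation involves both y
    and its complex conjugate. *)
Hypothesis rho_convr : forall (y : og S) (r : bool), exists t : bool -> og S,
  forall a (K : finType) (b c : K -> A), comult a = \sum_k tens (b k) (c k) ->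
  forall x s, \sum_k (\sum_i rho (b k) x i i) * rho (c k) y r s =
    (r == s)%:R * \sum_i rho a (x * t i)%g i i.
Hypothesis rho_convl : forall (y : og S) (r : bool), exists t : bool -> og S,
  forall a (K : finType) (b c : K -> A), comult a = \sum_k tens (b k) (c k) ->
  forall x s, \sum_k (\sum_i rho (c k) x i i) * rho (b k) y r s =
    (r == s)%:R * \sum_i rho a (t i * x)%g i i.

Definition model_state (a : A) : C := 2^-1 * cint (fun x => \sum_i rho a x i i).

Lemma trace_cont a : ccont (fun x => \sum_i rho a x i i).
Proof. by apply: ccont_sum => i. Qed.

Lemma model_state_state : cstar_state model_state.
Proof.
split.
- move=> c a b; rewrite /model_state (eq_cint (g := fun x =>
      c * (\sum_i rho a x i i) + \sum_i rho b x i i)); last first.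
    move=> x; rewrite mulr_sumr -big_split; apply: eq_bigr => i _.
    exact: (repZD (rho_rep x)).
  rewrite cintD ?cintZ; [|exact: trace_cont|apply: ccontM; [exact: ccont_cst|exact: trace_cont]|exact: trace_cont].
  by rewrite mulrDr mulrCA.
- move=> a; rewrite /model_state mulr_ge0 ?invr_ge0 ?ler0n//; apply: cint_ge0 => x.
  apply: sumr_ge0 => i _; rewrite (rep_sqE (rho_rep x)) lecR.
  by apply: sumr_ge0 => k _; rewrite sqr_ge0.
- rewrite /model_state (eq_cint (g := fun=> 2)); last first.
    by move=> x; rewrite sum_bool !(rep1 (rho_rep x)).
  by rewrite cint_cst mulVf// pnatr_eq0.
Qed.

(** By faithfulness it suffices to compare both sides under each rho y. There the traced convolution
    formula turns the left side into integrals of translates of the diagonal entries of a, and the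
    invariance of the measure removes the translations. *)
Lemma model_state_invariant (a : A) (K : finType) (b c : K -> A) :
  comult a = \sum_k tens (b k) (c k) ->
  \sum_k model_state (b k) *: c k = model_state a *: 1 /\
  \sum_k model_state (c k) *: b k = model_state a *: 1.
Proof.
have rsum y (F : K -> A) r s : rho (\sum_k F k) y r s = \sum_k rho (F k) y r s.
  by apply: (big_morph (fun a => rho a y r s)) => [z w|];
    [exact: (repD (rho_rep y))|exact: (rep0 (rho_rep y))].
move=> ab; split; apply/eqP; rewrite -subr_eq0; apply/eqP; apply: rho_inj => y r s;
  rewrite (repB (rho_rep y)) rsum (repZ (rho_rep y)) (rep1 (rho_rep y));
  apply/eqP; rewrite subr_eq0; apply/eqP.
- have [t ht] := rho_convr y r.
  under eq_bigr do rewrite (repZ (rho_rep y)) /model_state -mulrA.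
  rewrite -mulr_sumr -[RHS]mulrA; congr (_ * _).
  rewrite (eq_bigr (fun k => cint (fun x => rho (c k) y r s * \sum_i rho (b k) x i i))) => [|k _]; last first.
    by rewrite cintZ 1?mulrC//; exact: trace_cont.
  rewrite -cint_sum; last by move=> k; apply: ccontM; [exact: ccont_cst|exact: trace_cont].
  rewrite (eq_cint (g := fun x => (r == s)%:R * \sum_i rho a (x * t i)%g i i)); last first.
    by move=> x; rewrite -(ht _ _ _ _ ab); apply: eq_bigr => k _; rewrite mulrC.
  have cm i : ccont (fun x => rho a (x * t i)%g i i).
    apply: (ccont_comp (f := fun x => rho a x i i) (s := fun x => (x * t i)%g)) => //.
    by apply: isometry_continuous => x z; exact: og_distMr.
  rewrite cintZ; last exact: ccont_sum.
  rewrite mulrC !cint_sum//; congr (_ * _); apply: eq_bigr => i _.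
  exact: (cintMr (t i) (f := fun x => rho a x i i)).
- have [t ht] := rho_convl y r.
  under eq_bigr do rewrite (repZ (rho_rep y)) /model_state -mulrA.
  rewrite -mulr_sumr -[RHS]mulrA; congr (_ * _).
  rewrite (eq_bigr (fun k => cint (fun x => rho (b k) y r s * \sum_i rho (c k) x i i))) => [|k _]; last first.
    by rewrite cintZ 1?mulrC//; exact: trace_cont.
  rewrite -cint_sum; last by move=> k; apply: ccontM; [exact: ccont_cst|exact: trace_cont].
  rewrite (eq_cint (g := fun x => (r == s)%:R * \sum_i rho a (t i * x)%g i i)); last first.
    by move=> x; rewrite -(ht _ _ _ _ ab); apply: eq_bigr => k _; rewrite mulrC.
  have cm i : ccont (fun x => rho a (t i * x)%g i i).
    apply: (ccont_comp (f := fun x => rho a x i i) (s := fun x => (t i * x)%g)) => //.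
    by apply: isometry_continuous => x z; exact: og_distMl.
  rewrite cintZ; last exact: ccont_sum.
  rewrite mulrC !cint_sum//; congr (_ * _); apply: eq_bigr => i _.
  exact: (cintMl (t i) (f := fun x => rho a x i i)).
Qed.

Lemma comult_algebraic_subalgebra : star_subalgebra [set a : A |
  exists (K : finType) (b c : K -> A), comult a = \sum_k tens (b k) (c k)].
Proof.
have [Dl D1 DM Ds] := comult_morphism G; have tP := tensP G.
split.
- by exists unit, (fun=> 1), (fun=> 1); rewrite D1 big_const card_unit /= addr0 (tens11 tP).
- move=> l a a' [K [b [c ab]]] [K' [b' [c' ab']]].
  exists (K + K')%type, (fun k => match k with inl k => l *: b k | inr k => b' k end),
    (fun k => match k with inl k => c k | inr k => c' k end).
  rewrite Dl ab ab' big_sumType /= scaler_sumr; congr (_ + _).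
  by apply: eq_bigr => k _; rewrite (tensZl tP).
- move=> a a' [K [b [c ab]]] [K' [b' [c' ab']]].
  exists (K * K')%type, (fun k => b k.1 * b' k.2), (fun k => c k.1 * c' k.2).
  rewrite DM ab ab' mulr_suml -(pair_big xpredT xpredT (fun k k' => tens (b k * b' k') (c k * c' k'))) /=.
  by apply: eq_bigr => k _; rewrite mulr_sumr; apply: eq_bigr => k' _; rewrite (tensM tP).
- move=> a [K [b [c ab]]]; exists K, (fun k => star (b k)), (fun k => star (c k)).
  by rewrite Ds ab star_sum; apply: eq_bigr => k _; rewrite (tens_star tP).
Qed.

(** The sum of the h(b k) m(c k), with m the model state, equals h(a) by the left invariance of h
    and m(a) by the right invariance of m. This determines h on the elements with an algebraic
    coproduct, which are dense. *)
Lemma haar_state_unique (h : A -> C) : haar_state h -> h = model_state.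
Proof.
move=> [hS hI]; have mS := model_state_state.
suff all0 a : h a - model_state a = 0.
  by apply/funext => a; apply/eqP; rewrite -subr_eq0; apply/eqP.
have := dense_subalgebra (@fund_generates R N G) comult_algebraic_subalgebra.
move=> /(_ _ a) da; apply: (@closed_zero R A (fun a => h a - model_state a) 2).
- by move=> b c; rewrite (stateB hS) (stateB mS); ring.
- move=> b; apply: le_trans (cnB _ _) _; rewrite mulrDl mul1r.
  by apply: lerD; exact: state_bound.
have {}da := da _; move=> e e0.
have [] := da _ e e0.
  move=> _ [i [j ->]]; exists 'I_N, (fun k => fund G i k), (fun k => fund G k j).
  exact: comult_fund.
move=> s [K [b [c ab]]] as_; exists s => //=.
pose b' (i : 'I_#|K|) := b (enum_val i); pose c' (i : 'I_#|K|) := c (enum_val i).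
have ab' : comult s = \sum_(k < #|K|) tens (b' k) (c' k).
  by rewrite ab big_ord_finType.
have [h1 _] := hI _ _ _ _ ab'; have [_ h2] := model_state_invariant ab.
have e1 : \sum_k h (b k) * model_state (c k) = h s.
  have := congr1 model_state h1; rewrite (stateZ mS) (state1 mS) mulr1 => <-.
  rewrite (state_sum mS) (big_ord_finType (fun k => h (b k) * model_state (c k))).
  by apply: eq_bigr => k _; rewrite (stateZ mS).
have := congr1 h h2; rewrite (stateZ hS) (state1 hS) mulr1 => <-.
rewrite (state_sum hS) -e1; apply/eqP; rewrite subr_eq0; apply/eqP; apply: eq_bigr => k _.
by rewrite (stateZ hS) mulrC.
Qed.

Definition model (a : A) : 'M[CH R (og S)]_2 := \matrix_(i, j)
  (mkcts (ccont_continuous (rho_cont a (i == 1) (j == 1))) : CH R (og S)).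

Lemma mx_eval_model a (x : og S) (i j : 'I_2) :
  mx_eval (model a) x i j = rho a x (i == 1) (j == 1).
Proof. by rewrite /mx_eval !mxE. Qed.

Lemma sum_ord2 (V : nmodType) (F : bool -> V) : \sum_(i < 2) F (i == 1) = \sum_i F i.
Proof. by rewrite big_ord_recl big_ord1 sum_bool /= addrC. Qed.

Theorem stationary_model : exists (H : topologicalGroupType) (mu : probability (borel H) R)
         (pi : A -> 'M[CH R H]_2),
    compact_Lie_group R H /\ haar_probability mu /\
    model_morphism pi /\ injective pi /\
    (forall h : A -> complex R,
       haar_state h <-> (forall a, h a = trace_integral mu (pi a))).
Proof.
exists (og S : topologicalGroupType), (@haar_measure R m S : probability _ R), model.
have b2 (i j : 'I_2) : ((i == 1) == (j == 1)) = (i == j).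
  by case: i => -[|[|?]] ? //; case: j => -[|[|?]] ?.
split; first exact: og_Lie_group.
split; first by move=> x B _; exact: haar_measureMl.
split.
  move=> x; split.
  - move=> c a b; apply/matrixP => i j; rewrite !mxE.
    exact: (repZD (rho_rep x)).
  - by apply/matrixP => i j; rewrite mx_eval_model (rep1 (rho_rep x)) b2 !mxE.
  - move=> a b; apply/matrixP => i j; rewrite mx_eval_model (repM (rho_rep x)) !mxE.
    rewrite -(sum_ord2 (fun k => rho a x (i == 1) k * rho b x k (j == 1))).
    by apply: eq_bigr => k _; rewrite !mx_eval_model.
  - move=> a; apply/matrixP => i j; rewrite mx_eval_model (rep_star (rho_rep x)).
    by rewrite !mxE.
split.
  move=> a b ab; apply/eqP; rewrite -subr_eq0; apply/eqP; apply: rho_inj => x i j.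
  have ord2 (k : bool) : exists k' : 'I_2, (k' == 1) = k.
    by case: k; [exists 1|exists 0].
  have [i' <-] := ord2 i; have [j' <-] := ord2 j.
  by rewrite (repB (rho_rep x)) -!mx_eval_model ab subrr.
have tiE a : trace_integral (@haar_measure R m S) (model a) = model_state a.
  rewrite /model_state -cintZ; last exact: trace_cont.
  have e x : normalized_trace (mx_eval (model a) x) = 2^-1 * \sum_i rho a x i i.
    rewrite /normalized_trace; congr (_ * _).
    rewrite -sum_ord2; apply: eq_bigr => i _; exact: mx_eval_model.
  by rewrite /trace_integral /cint /haar_integral; congr (_ +i* _);
    apply: eq_Rintegral => x _; rewrite e.
move=> h; split=> [/haar_state_unique -> a|hE]; first by rewrite tiE.
have -> : h = model_state by apply/funext => a; rewrite hE tiE.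
split; first exact: model_state_state.
by move=> a n b c; exact: model_state_invariant.
Qed.

End StationaryModel.

(** * Unitary matrices as real orthogonal matrices of twice the size *)

Section Realification.
Variables (R : realType) (N : nat).
Local Notation C := R[i].
Implicit Types V W : 'M[C]_N.

Definition adjc V : 'M[C]_N := map_mx (@conjc R) V^T.
Definition conjm V : 'M[C]_N := map_mx (@conjc R) V.

Lemma conjmM V W : conjm (V *m W) = conjm V *m conjm W.
Proof. by rewrite /conjm map_mxM. Qed.

Lemma conjmK V : conjm (conjm V) = V.
Proof. by apply/matrixP => i j; rewrite !mxE conjcK. Qed.

Definition realify V : 'M[R]_(N + N) :=
  block_mx (map_mx (@complex.Re R) V) (- map_mx (@complex.Im R) V)
           (map_mx (@complex.Im R) V) (map_mx (@complex.Re R) V).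

Definition complexify (X : 'M[R]_(N + N)) : 'M[C]_N :=
  \matrix_(i, j) (ulsubmx X i j +i* dlsubmx X i j).

Lemma realifyK : cancel realify complexify.
Proof.
move=> V; apply/matrixP => i j; rewrite mxE block_mxKul block_mxKdl !mxE.
by case: (V i j).
Qed.

Lemma realifyM V W : realify (V *m W) = realify V *m realify W.
Proof.
have ReM : map_mx (@complex.Re R) (V *m W) = map_mx (@complex.Re R) V *m map_mx (@complex.Re R) W -
    map_mx (@complex.Im R) V *m map_mx (@complex.Im R) W.
  apply/matrixP => i j; rewrite !mxE raddf_sum -sumrB; apply: eq_bigr => k _.
  by rewrite !mxE; case: (V i k) => a b; case: (W k j).
have ImM : map_mx (@complex.Im R) (V *m W) = map_mx (@complex.Re R) V *m map_mx (@complex.Im R) W +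
    map_mx (@complex.Im R) V *m map_mx (@complex.Re R) W.
  apply/matrixP => i j; rewrite !mxE raddf_sum -big_split; apply: eq_bigr => k _.
  by rewrite !mxE; case: (V i k) => a b; case: (W k j).
rewrite /realify mulmx_block ReM ImM !mulmxN !mulNmx.
congr block_mx; first by rewrite opprD.
- by rewrite addrC.
- by rewrite addrC.
Qed.

Lemma realify1 : realify 1%:M = 1%:M.
Proof.
rewrite /realify scalar_mx_block; congr block_mx; apply/matrixP => i j; rewrite !mxE;
  by case: eqP => _ //=; rewrite ?oppr0.
Qed.

Lemma realify_adjc V : realify (adjc V) = (realify V)^T.
Proof.
rewrite /realify tr_block_mx; congr block_mx; apply/matrixP => i j; rewrite !mxE;
  by case: (V j i) => a b //=; rewrite opprK.
Qed.

Lemma complexify_close X Y i j :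
  cn (complexify X i j - complexify Y i j) <= 2 * fnorm (X - Y).
Proof.
apply: le_trans (cn_ReIm _) _; rewrite mulrDl mul1r !mxE /=.
have h1 := fnorm_entry (X - Y) (lshift N i) (lshift N j).
have h2 := fnorm_entry (X - Y) (rshift N i) (lshift N j).
by rewrite !mxE in h1 h2; exact: lerD.
Qed.

Lemma complexifyM (X Y : 'M[R]_(N + N)) V W : X = realify V -> Y = realify W ->
  complexify (X *m Y) = V *m W.
Proof. by move=> -> ->; rewrite -realifyM realifyK. Qed.

End Realification.

Section Family.
Variables (R : realType) (N : nat) (G : compactMatrixQuantumGroup R N).
Local Notation A := (cqg_alg G).
Local Notation C := R[i].
Local Notation u := (fund G).
(** The two instances of F are a scalar, for characters, and [J2], for pairs. The row p0 is one on
    which the unitarity of the fundamental matrix can be read off. *)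
Variables (J : finType) (F : C -> J -> J -> C) (p0 : J).
Hypothesis F_conj : forall z p q, F (conjc z) p q = conjc (F z p q).
Hypothesis F_close : forall z w p q, cn (F z p q - F w p q) <= cn (z - w).
Hypothesis F_row : forall z w, \sum_q F z p0 q * conjc (F w p0 q) = z * conjc w.
Implicit Types V W : 'M[C]_N.

Definition affords V (rho : A -> J -> J -> C) :=
  rep rho /\ forall i j, rho (u i j) = F (V i j).

Definition afforded V := exists rho, affords V rho.

(* Junk value 0 if [V] is not afforded. *)
Definition frep V : A -> J -> J -> C :=
  if pselect (afforded V) is left h then projT1 (cid h) else fun _ _ _ => 0.

Lemma frepP V : afforded V -> affords V (frep V).
Proof. by rewrite /frep; case: pselect => // h _; case: cid. Qed.

Lemma frep_rep V : afforded V -> rep (frep V).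
Proof. by case/frepP. Qed.

Lemma frep_fund V i j : afforded V -> frep V (u i j) = F (V i j).
Proof. by case/frepP. Qed.

Lemma affords_uniq V rho : affords V rho -> frep V = rho.
Proof.
move=> hr; have [r1 f1] : affords V (frep V) by apply: frepP; exists rho.
have [r2 f2] := hr; apply/funext => a; apply/funext => p; apply/funext => q.
apply: (rep_uniq (@fund_generates R N G) r1 r2) => _ [i [j ->]] p' q'.
by rewrite f1 f2.
Qed.

(** Composition with the antipode reverses products, and transposition of the matrices restores
    their order. *)
Lemma afforded_adj V : afforded V -> afforded (adjc V).
Proof.
case=> rho [hr hf]; have [Sl S1 SM Ss] := antipode_antimorphism G.
exists (fun a p q => rho (antipode a) q p); split; last first.
  move=> i j; apply/funext => p; apply/funext => q.
  by rewrite antipode_fund (rep_star hr) hf !mxE F_conj.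
split.
- by move=> c a b p q; rewrite Sl (repZD hr).
- by move=> p q; rewrite S1 (rep1 hr) eq_sym.
- by move=> a b p q; rewrite SM (repM hr); apply: eq_bigr => k _; rewrite mulrC.
- by move=> a p q; rewrite Ss (rep_star hr).
Qed.

Lemma fund_row i j : \sum_k u i k * star (u j k) = (i == j)%:R.
Proof.
have [/matrixP/(_ i j) + _] := fund_unitary G.
by rewrite !mxE => <-; apply: eq_bigr => k _; rewrite !mxE.
Qed.

Lemma afforded_unitary V : afforded V -> V *m adjc V = 1%:M.
Proof.
case=> rho [hr hf]; apply/matrixP => i j; rewrite !mxE.
have := congr1 (fun a => rho a p0 p0) (fund_row i j).
rewrite (big_morph (fun a => rho a p0 p0) (id1 := 0) (op1 := +%R)); last 2 first.
- by move=> a b; rewrite (repD hr).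
- by rewrite (rep0 hr).
have -> : rho (i == j)%:R p0 p0 = (i == j)%:R.
  by case: (i == j); rewrite ?(rep1 hr) ?(rep0 hr) ?eqxx.
move=> <-; apply: eq_bigr => k _; rewrite !mxE -F_row (repM hr).
by apply: eq_bigr => q _; rewrite (rep_star hr) !hf.
Qed.

(** The ultralimits of the representations along a sequence of matrices form a densely defined
    representation; it is bounded because each representation contracts. *)
Lemma afforded_limit V :
  (forall e : R, 0 < e -> exists2 W, afforded W & forall i j, cn (W i j - V i j) < e) ->
  afforded V.
Proof.
move=> h; have /choice[W hW] : forall n : nat, exists W, afforded W /\
    forall i j, cn (W i j - V i j) < n.+1%:R^-1.
  by move=> n; have [//|W hW1 hW2] := h n.+1%:R^-1; exists W.
have rW n := frep_rep (hW n).1.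
pose L a (M : J -> J -> C) := forall p q, ucvg (fun n => frep (W n) a p q) (M p q).
have LF i j : L (u i j) (F (V i j)).
  move=> p q e e0; apply: filterS (ufilter_inv e0) => n /= ne.
  rewrite (frep_fund _ _ (hW n).1); apply: le_lt_trans (F_close _ _ _ _) _.
  exact: lt_trans ((hW n).2 i j) ne.
have [||||||rho hr hL] := @rep_extend R A J (matrix_entries u) L 1 (@fund_generates R N G).
- by move=> p q; apply: ucvg_ext (ucvg_cst _) => n; rewrite (rep1 (rW n)).
- move=> c a b M M' hM hM' p q.
  apply: ucvg_ext (ucvgD (ucvgM (ucvg_cst c) (hM p q)) (hM' p q)) => n.
  by rewrite (repZD (rW n)).
- move=> a b M M' hM hM' p q.
  apply: ucvg_ext (ucvg_sum _ (fun k => ucvgM (hM p k) (hM' k q))) => n.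
  by rewrite (repM (rW n)).
- move=> a M hM p q; apply: ucvg_ext (ucvg_conj (hM q p)) => n.
  by rewrite (rep_star (rW n)).
- move=> a M hM p q; rewrite mul1r; apply: (ucvg_le (hM p q)) => n.
  exact: rep_bound (rW n) _ _ _.
- by move=> _ [i [j ->]]; exists (F (V i j)).
by exists rho; split => // i j; exact: hL.
Qed.

Hypothesis afforded1 : afforded 1%:M.
Hypothesis affordedM : forall V W, afforded V -> afforded W -> afforded (V *m W).

Let fset : set 'M[R]_(N + N) := [set X | exists2 V, afforded V & X = realify V].

Let fset1 : fset 1%:M.
Proof. by exists 1%:M => //; rewrite realify1. Qed.

Let fsetM X Y : fset X -> fset Y -> fset (X *m Y).
Proof.
move=> [V hV ->] [W hW ->]; exists (V *m W); first exact: affordedM.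
by rewrite realifyM.
Qed.

Let fsetV X : fset X -> fset X^T.
Proof.
move=> [V hV ->]; exists (adjc V); first exact: afforded_adj.
by rewrite realify_adjc.
Qed.

Let fset_orth X : fset X -> X *m X^T = 1%:M.
Proof.
by move=> [V hV ->]; rewrite -realify_adjc -realifyM afforded_unitary// realify1.
Qed.

Let fset_closed X :
  (forall e : R, 0 < e -> exists2 Y, fset Y & fnorm (X - Y) < e) -> fset X.
Proof.
move=> h; exists (complexify X).
  apply: afforded_limit => e e0; have [_ [W hW ->] hY] := h (e / 2) (divr_gt0 e0 (ltr0n _ 2)).
  exists W => // i j; rewrite -[W]realifyK.
  apply: le_lt_trans (complexify_close _ _ _ _) _; rewrite fnormBC.
  by rewrite mulrC -ltr_pdivlMr.
(* It remains to see that X itself has the block form of a realification. It is within an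
   arbitrarily small distance of some realify W, and X |-> realify (complexify X) is Lipschitz and
   fixes realify W. *)
apply/esym/eqP; rewrite -subr_eq0; apply/eqP/fnorm_eq0; apply/eqP.
rewrite eq_le fnorm_ge0 andbT; apply/ler_addgt0Pr => e e0; rewrite add0r.
pose K : R := \sum_(i < N + N) \sum_(j < N + N) 2 + 1.
have K0 : 0 < K by rewrite ltr_wpDl// sumr_ge0// => i _; rewrite sumr_ge0.
have [_ [W hW ->] hY] := h (e / K) (divr_gt0 e0 K0).
have ent i j : `|(realify (complexify X) - realify W) i j| <= 2 * fnorm (X - realify W).
  have cl i' j' := complexify_close X (realify W) i' j'.
  have Rl i' j' := le_trans (cn_Re _) (cl i' j').
  have Il i' j' := le_trans (cn_Im _) (cl i' j').
  rewrite realifyK in Rl Il.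
  have gR i' j' : `|complex.Re (complexify X i' j') - complex.Re (W i' j')| <= 2 * fnorm (X - realify W).
    by rewrite -raddfB; exact: Rl.
  have gI i' j' : `|complex.Im (complexify X i' j') - complex.Im (W i' j')| <= 2 * fnorm (X - realify W).
    by rewrite -raddfB; exact: Il.
  rewrite -(splitK i) -(splitK j) [_ (unsplit _) _]mxE [X in _ + X]mxE.
  case: (fintype.split i) => i'; case: (fintype.split j) => j'; rewrite /= ?block_mxEul ?block_mxEur ?block_mxEdl ?block_mxEdr.
  - by move: (gR i' j'); rewrite !mxE.
  - by move: (gI i' j'); rewrite !mxE -opprD normrN.
  - by move: (gI i' j'); rewrite !mxE.
  - by move: (gR i' j'); rewrite !mxE.
have := fnorm_le_sum ent.
have -> : \sum_(i < N + N) \sum_(j < N + N) (2 * fnorm (X - realify W)) =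
    (K - 1) * fnorm (X - realify W).
  by rewrite /K addrK mulr_suml; apply: eq_bigr => i _; rewrite mulr_suml.
have := fnorm_sub (realify W) (realify (complexify X)) X.
rewrite (fnormBC (realify W) X); move: hY; rewrite ltr_pdivlMr//.
lra.
Qed.

Definition family_group : orthogonal_group R (N + N) :=
  OrthogonalGroup fset1 fsetM fsetV fset_orth fset_closed.

Definition fmx (x : og family_group) : 'M[C]_N := complexify (og_val x).

Lemma fmx_afforded x : afforded (fmx x).
Proof. by rewrite /fmx; have [V hV ->] := og_valP x; rewrite realifyK. Qed.

Lemma fmx_realify x : og_val x = realify (fmx x).
Proof. by rewrite /fmx; have [V hV ->] := og_valP x; rewrite realifyK. Qed.

Lemma fmxM x y : fmx (x * y)%g = fmx x *m fmx y.
Proof. by rewrite {1}/fmx og_valM (complexifyM (fmx_realify x) (fmx_realify y)). Qed.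

Lemma fmx_ex V : afforded V -> exists x, fmx x = V.
Proof.
move=> hV; have hX : fset (realify V) by exists V.
by exists (og_of (hX : og_set family_group (realify V))); rewrite /fmx realifyK.
Qed.

(** The elements a for which this holds form a closed star-subalgebra: as representations contract,
    a norm limit of elements gives a uniform limit of functions on the group. *)
Lemma frep_cont a p q : ccont (fun x => frep (fmx x) a p q).
Proof.
have rx x := frep_rep (fmx_afforded x).
have cbound x b p' q' : cn (frep (fmx x) b p' q') <= cnorm b := rep_bound (rx x) b p' q'.
suff : [set a | forall p q, ccont (fun x => frep (fmx x) a p q)] a by move/(_ p q).
apply: (cgen_rep (@fund_generates R N G)); first split.
- move=> b hb p' q'; apply: ccont_near => x e e0.
  have e3 : 0 < e / 3 by rewrite divr_gt0.
  have [b' /= hb' bb'] := hb _ e3.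
  have [c1 c2] := hb' p' q'.
  have e6 : 0 < e / 3 / 2 by rewrite divr_gt0.
  have /(@cvgrPdist_lt _ R _ (nbhs (x : og family_group)) _) h1 := c1 x.
  have /(@cvgrPdist_lt _ R _ (nbhs (x : og family_group)) _) h2 := c2 x.
  apply: filterS (filterI (h1 _ e6) (h2 _ e6)) => y [/= h3 h4].
  have h5 : cn (frep (fmx x) b' p' q' - frep (fmx y) b' p' q') < e / 3.
    apply: le_lt_trans (cn_ReIm _) _; rewrite !raddfB /= (splitr (e / 3)).
    exact: ltrD.
  have h6 : cn (frep (fmx x) b p' q' - frep (fmx x) b' p' q') < e / 3.
    by rewrite -(repB (rx x)); apply: le_lt_trans bb'.
  have h7 : cn (frep (fmx y) b' p' q' - frep (fmx y) b p' q') < e / 3.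
    by rewrite cnBC -(repB (rx y)); apply: le_lt_trans bb'.
  have := cn_sub (frep (fmx x) b' p' q') (frep (fmx x) b p' q') (frep (fmx y) b p' q').
  have := cn_sub (frep (fmx y) b' p' q') (frep (fmx x) b' p' q') (frep (fmx y) b p' q').
  lra.
- move=> p' q'; rewrite (_ : (fun x => _) = fun=> (p' == q')%:R); first exact: ccont_cst.
  by apply/funext => x; rewrite (rep1 (rx x)).
- move=> c b b' hb hb' p' q'.
  rewrite (_ : (fun x => _) = fun x => c * frep (fmx x) b p' q' + frep (fmx x) b' p' q').
    by apply: ccontD => //; apply: ccontM => //; exact: ccont_cst.
  by apply/funext => x; rewrite (repZD (rx x)).
- move=> b b' hb hb' p' q'.
  rewrite (_ : (fun x => _) = fun x => \sum_k frep (fmx x) b p' k * frep (fmx x) b' k q').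
    by apply: ccont_sum => k; exact: ccontM.
  by apply/funext => x; rewrite (repM (rx x)).
- move=> b hb p' q'; have [c1 c2] := hb q' p'; split.
    rewrite (_ : (fun x => _) = fun x => complex.Re (frep (fmx x) b q' p'))//.
    by apply/funext => x; rewrite (rep_star (rx x)); case: (frep _ _ _ _).
  rewrite (_ : (fun x => _) = fun x => - complex.Im (frep (fmx x) b q' p')).
    by move=> x; apply: continuousN; exact: c2.
  by apply/funext => x; rewrite (rep_star (rx x)); case: (frep _ _ _ _).
- move=> _ [i [j ->]] p' q'; apply: ccont_near => x e e0.
  have e2 : 0 < e / 2 by rewrite divr_gt0.
  apply: filterS (nbhsx_ballx x _ e2) => y; rewrite ballEmdist /= og_distE => xy.
  rewrite !frep_fund; [|exact: fmx_afforded|exact: fmx_afforded].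
  apply: le_lt_trans (F_close _ _ _ _) _.
  by apply: le_lt_trans (complexify_close _ _ _ _) _; rewrite mulrC -ltr_pdivlMr.
Qed.

End Family.

(** * Convolution of the irreducible representations *)

Section Tame.
Variables (R : realType) (A : cstarAlgType R).
Local Notation C := R[i].

Lemma tame_ext (f g : A -> C) : f =1 g -> tame f -> tame g.
Proof. by move=> /funext ->. Qed.

Lemma tame0 (f : A -> C) : tame f -> tame (fun _ : A => 0 : C).
Proof.
by move=> tf; apply: tame_ext (tame_lin (-1) tf tf) => a; rewrite mulN1r addNr.
Qed.

Lemma tameZ c (f : A -> C) : tame f -> tame (fun a => c * f a).
Proof.
by move=> tf; apply: tame_ext (tame_lin c tf (tame0 tf)) => a; rewrite addr0.
Qed.

(** The matrix unit at (i, i) serves as the projection that makes the i-th vector state excisable.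
    The entry at (i, j) is this state evaluated at a between the matrix units (i, i) and (j, i). *)
Lemma rep_onto_tame (J : finType) (rho : A -> J -> J -> C) : rep rho ->
  (forall i j, exists e, forall k l, rho e k l = ((k == i) && (l == j))%:R) ->
  forall i j, tame (fun a => rho a i j).
Proof.
move=> hr onto i j.
have sandwich e1 e2 (p q r s : J) a : (forall k l, rho e1 k l = ((k == p) && (l == q))%:R) ->
    (forall k l, rho e2 k l = ((k == r) && (l == s))%:R) ->
    forall k l, rho (e1 * a * e2) k l = ((k == p) && (l == s))%:R * rho a q r.
  move=> h1 h2 k l; rewrite (repM hr) (bigD1 r)//= big1 ?addr0 => [|k' kr]; last first.
    by rewrite h2 (negbTE kr) mulr0.
  rewrite (repM hr) (bigD1 q)//= big1 ?addr0 => [|k' kq]; last first.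
    by rewrite h1 (negbTE kq) andbF mul0r.
  by rewrite h1 h2 !eqxx andbT /= mulrAC -natrM mulnb.
have [e0 h0] := onto i i; have [e1 h1] := onto i j.
have [f0 g0] := onto j i.
have ex : excisable (fun a => rho a i i).
  split; first exact: rep_state.
  exists e0; split.
    rewrite (rep_sqE hr) big1// => k _; rewrite (repB hr) (rep1 hr) h0 eqxx andbT subrr.
    by rewrite cn0 expr0n.
  move=> a a0; have s0 k l : rho (star e0) k l = ((k == i) && (l == i))%:R.
    by rewrite (rep_star hr) h0 andbC rmorph_nat.
  rewrite (rep_sqE hr) big1// => k _.
  by rewrite (sandwich _ _ _ _ _ _ a s0 h0) a0 mulr0 cn0 expr0n.
apply: tame_ext (tame_excisable e0 f0 ex) => a.
by rewrite (sandwich _ _ _ _ _ _ a h0 g0) !eqxx mul1r.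
Qed.

Lemma char_tame (rho : A -> unit -> unit -> C) : rep rho ->
  forall i j, tame (fun a => rho a i j).
Proof.
move=> hr; apply: rep_onto_tame => // -[] []; exists 1 => -[] [].
by rewrite (rep1 hr).
Qed.

End Tame.

Section PairReps.
Variables (R : realType) (N : nat) (G : compactMatrixQuantumGroup R N).
Local Notation A := (cqg_alg G).
Local Notation C := R[i].
Local Notation u := (fund G).
Implicit Types V W : 'M[C]_N.

Local Notation F2 := (@J2 R).

Definition J1 (z : C) (_ _ : unit) : C := z.

Lemma J2_conj (z : C) p q : J2 (conjc z) p q = conjc (J2 z p q).
Proof.
rewrite /J2; case: eqP => _; first by rewrite conjc0.
by case: q; rewrite ?conjcK.
Qed.

Lemma J2_close (z w : C) p q : cn (J2 z p q - J2 w p q) <= cn (z - w).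
Proof.
case: p; case: q; rewrite /J2 /= ?subrr ?cn0//.
by rewrite -rmorphB cnJ.
Qed.

Lemma J2_row (z w : C) : \sum_q J2 z false q * conjc (J2 w false q) = z * conjc w.
Proof. by rewrite sum_bool /J2 /= mul0r addr0. Qed.

Lemma J2_flip (z : C) p q : J2 z (~~ p) (~~ q) = J2 (conjc z) p q.
Proof. by case: p; case: q; rewrite /J2 /= ?conjcK. Qed.

Lemma J2M (z w : C) p q : J2 z p q * J2 w p q = J2 (z * w) p q.
Proof.
rewrite /J2; case: eqP => _; first by rewrite mul0r.
by case: q; rewrite // rmorphM.
Qed.

Lemma J2_real (r z : C) p q : conjc r = r -> r * J2 z p q = J2 (r * z) p q.
Proof.
move=> rr; rewrite /J2; case: eqP => _; first by rewrite mulr0.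
by case: q; rewrite // rmorphM /= rr.
Qed.

Lemma J2_sum (I : Type) (s : seq I) (z : I -> C) p q :
  \sum_(k <- s) J2 (z k) p q = J2 (\sum_(k <- s) z k) p q.
Proof.
rewrite /J2; case: eqP => _; first by rewrite big1.
by case: q; rewrite // rmorph_sum.
Qed.

(* A real matrix times a phase: the representation splits into two characters. *)
Lemma afforded_real_line V (rho : A -> bool -> bool -> C) (mu : C) : affords F2 V rho -> mu * conjc mu = 1 ->
  (forall i j, conjc (mu * V i j) = mu * V i j) ->
  affords J1 (mu *: V) (fun a _ _ => rho a false false + mu * rho a false true) /\
  forall a, rho a true true = rho a false false /\
    rho a true false = mu ^+ 2 * rho a false true.
Proof.
move=> [hr hf] mu1 muV.
have cj i j : conjc (V i j) = mu ^+ 2 * V i j.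
  by rewrite expr2 -mulrA -muV rmorphM mulrA mu1 mul1r.
have bd (f : A -> C) K : (forall a b, f (a - b) = f a - f b) -> (forall a, cn (f a) <= K * cnorm a) ->
    cclosure [set a | f a = 0] `<=` [set a | f a = 0] by exact: closed_zero.
have mun : cn mu = 1.
  have := congr1 (@cn R) mu1; rewrite cnM cnJ cn1 => h.
  by apply/eqP; rewrite -(@eqrXn2 _ 2) ?cn_ge0// expr1n expr2 h.
(* The condition says that (1, mu) is an eigenvector of rho a, with the eigenvalue of the statement:
   rho a commutes with [[0, 1], [mu^2, 0]]. *)
pose P := [set a | rho a true true = rho a false false /\
    rho a true false = mu ^+ 2 * rho a false true].
have Pa a : P a.
  apply: (cgen_rep (@fund_generates R N G)) => {a}; first split.
  - move=> a ha; split; apply/eqP; rewrite -subr_eq0; apply/eqP.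
      apply: (bd (fun a => rho a true true - rho a false false) 2).
      + by move=> x y; rewrite !(repB hr); ring.
      + move=> x; apply: le_trans (cnB _ _) _; rewrite mulrDl mul1r.
        by apply: lerD; exact: rep_bound.
      + by move=> e e0; have [b [/= b1 b2] ab] := ha e e0; exists b => //=; rewrite b1 subrr.
    apply: (bd (fun a => rho a true false - mu ^+ 2 * rho a false true) 2).
    + by move=> x y; rewrite !(repB hr); ring.
    + move=> x; apply: le_trans (cnB _ _) _; rewrite mulrDl mul1r.
      by apply: lerD; rewrite ?cnM ?mun ?expr2 ?cnM ?mun ?mul1r; exact: rep_bound.
    + by move=> e e0; have [b [/= b1 b2] ab] := ha e e0; exists b => //=; rewrite b2 subrr.
  - by rewrite /P /= !(rep1 hr) /= mulr0.
  - move=> c a b [a1 a2] [b1 b2]; rewrite /P /= !(repZD hr) a1 a2 b1 b2; split=> //.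
    by ring.
  - move=> a b [a1 a2] [b1 b2]; rewrite /P /= !(repM hr) !sum_bool a1 a2 b1 b2.
    by split; ring.
  - move=> a [a1 a2]; rewrite /P /= !(rep_star hr) a1 a2; split=> //.
    rewrite rmorphM rmorphXn mulrA -exprMn mu1 expr1n mul1r.
    by [].
  - by move=> _ [i [j ->]]; rewrite /P /= !hf /J2 /= cj.
split; last by move=> a; exact: Pa.
split; last first.
  move=> i j; apply/funext => -[]; apply/funext => -[].
  by rewrite hf /J2 /J1 /= mxE add0r.
split.
- by move=> c a b _ _; rewrite !(repZD hr); ring.
- by move=> [] []; rewrite !(rep1 hr) /= mulr0 addr0.
- move=> a b _ _; rewrite big_const card_unit /= addr0 !(repM hr) !sum_bool.
  by have [_ a2] := Pa a; have [b1 b2] := Pa b; rewrite b1 b2; ring.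
- move=> a _ _; rewrite !(rep_star hr); have [_ ->] := Pa a.
  have -> : conjc (mu ^+ 2 * rho a false true) = conjc mu ^+ 2 * conjc (rho a false true).
    by rewrite rmorphM rmorphXn.
  by rewrite rmorphD rmorphM /= expr2 !mulrA mu1 mul1r.
Qed.

(** If the entries of V do not lie on one real line of the complex plane, the representation is onto
    the 2 by 2 matrices and its diagonal states are excisable. Otherwise it is a sum of two
    characters, of which the coefficients are combinations. *)
Lemma pair_tame V (rho : A -> bool -> bool -> C) : affords F2 V rho -> forall p q, tame (fun a => rho a p q).
Proof.
move=> hV; have [hr hf] := hV.
have [[i [j [k [l ne]]]]|comm] := pselect (exists i j k l,
    V i j * conjc (V k l) != conjc (V i j) * V k l).
  set z := V i j * conjc (V k l) in ne.
  have zc : conjc z = conjc (V i j) * V k l by rewrite rmorphM /= conjcK.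
  rewrite -zc -subr_eq0 in ne.
  have V0 : conjc (V i j) != 0.
    by apply: contra ne => /eqP h; rewrite zc h mul0r subr0 /z -(conjcK (V i j)) h conjc0 mul0r.
  (* In this representation u i j u k l is diagonal with the distinct entries z and conj z, so p is
     mapped to a diagonal matrix unit; multiplication by u i j moves it off the diagonal. *)
  pose p := (z - conjc z)^-1 *: (u i j * u k l - conjc z *: 1).
  have pE q r : rho p q r = ((q == false) && (r == false))%:R.
    rewrite /p (repZ hr) (repB hr) (repM hr) (repZ hr) (rep1 hr) sum_bool !hf.
    case: q; case: r; rewrite /J2 /= ?mul0r ?mulr0 ?addr0 ?add0r ?oppr0 ?subr0 ?mulr0//.
      by rewrite mulr1 -zc subrr mulr0.
    by rewrite mulr1 -/z mulVf.
  pose q := (conjc (V i j))^-1 *: (u i j * p).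
  have qE r s : rho q r s = ((r == true) && (s == false))%:R.
    rewrite /q (repZ hr) (repM hr) sum_bool !pE !hf.
    case: r; case: s; rewrite /J2 /= ?mul0r ?mulr0 ?addr0 ?add0r ?mulr0//.
    by rewrite mulr1 mulVf.
  apply: rep_onto_tame => // -[] [].
  - exists (1 - p) => r s; rewrite (repB hr) (rep1 hr) pE.
    by case: r; case: s; rewrite /= ?subr0 ?subrr.
  - by exists q.
  - exists (star q) => r s; rewrite (rep_star hr) qE andbC.
    by rewrite rmorph_nat.
  - by exists p.
have {}comm i j k l : V i j * conjc (V k l) = conjc (V i j) * V k l.
  by apply: contrapT => /eqP ne; apply: comm; exists i, j, k, l.
have [mu mu1 muV] : exists2 mu : C, mu * conjc mu = 1 &
    forall i j, conjc (mu * V i j) = mu * V i j.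
  have [[k [l kl]]|no] := pselect (exists k l, V k l != 0); last first.
    exists 1 => [|i j]; first by rewrite conjc1 mulr1.
    have -> : V i j = 0 by apply: contrapT => /eqP ne; apply: no; exists i, j.
    by rewrite mulr0 conjc0.
  have n0 : cn (V k l) != 0 by apply: contra kl => /eqP /cn_eq0 ->.
  have cmu : conjc (conjc (V k l) * ((cn (V k l))^-1)%:C) = V k l * ((cn (V k l))^-1)%:C.
    by rewrite rmorphM /= conjcK oppr0.
  exists (conjc (V k l) * ((cn (V k l))^-1)%:C).
    rewrite cmu mulrACA [conjc _ * _]mulrC cn_sq -!rmorphM /= -expr2 -exprMn divff//.
    by rewrite expr1n.
  by move=> i j; rewrite rmorphM /= cmu [RHS]mulrAC [X in _ = X * _]mulrC comm; ring.
have [c1 h] := afforded_real_line hV mu1 muV.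
(* The phase - mu qualifies as well and gives the other character. The half sum and half difference
   of the two characters return the entries of the first row. *)
have [||c2 _] := @afforded_real_line V rho (- mu) hV.
- by rewrite rmorphN mulrNN.
- by move=> i j; rewrite mulNr rmorphN /=; congr (- _); exact: muV.
have t1 := char_tame c1.1 tt tt; have t2 := char_tame c2.1 tt tt.
have m0 : mu != 0 by apply/eqP => m0; move: mu1; rewrite m0 mul0r => /eqP; rewrite eq_sym oner_eq0.
have two : (2 : C) != 0 by rewrite pnatr_eq0.
have tff : tame (fun a => rho a false false).
  apply: tame_ext (tame_lin (2^-1) t1 (tameZ (2^-1) t2)) => a /=.
  by field.
have tft : tame (fun a => rho a false true).
  apply: tame_ext (tame_lin ((2 * mu)^-1) t1 (tameZ (- (2 * mu)^-1) t2)) => a /=.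
  by field; rewrite m0.
case=> [] [] //.
- by apply: tame_ext tff => a; have [-> _] := h a.
- by apply: tame_ext (tameZ (mu ^+ 2) tft) => a; have [_ ->] := h a.
Qed.

(** Both factors exchange the two indices, so the parity p (+) q is preserved by the convolution.
    The even part, on the indices (p, p), multiplies the entries of V and W; on the odd part, (p, ~~
    p), the second factor is flipped and W is replaced by its conjugate. *)
Lemma pair_conv V W : afforded G F2 V -> afforded G F2 W ->
  [/\ afforded G F2 (V *m W), afforded G F2 (V *m conjm W) &
  forall a (K : finType) (b c : K -> A), comult a = \sum_k tens (b k) (c k) ->
  forall p q p' q', \sum_k frep F2 V (b k) p p' * frep F2 W (c k) q q' =
    if p (+) q != p' (+) q' then 0 else
    if p == q then frep F2 (V *m W) a p p' else frep F2 (V *m conjm W) a p p'].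
Proof.
move=> hV hW; have aV := frepP hV; have aW := frepP hW.
have [kappa hk kE] := rep_conv aV.1 aW.1 (pair_tame aV) (pair_tame aW).
have kf i j x y : kappa (u i j) x y =
    \sum_k J2 (V i k) x.1 y.1 * J2 (W k j) x.2 y.2.
  rewrite (kE _ _ _ _ (@comult_fund R N G i j)).
  by apply: eq_bigr => k _; rewrite aV.2 aW.2.
pose c (x : bool * bool) := x.1 (+) x.2.
have koff x : matrix_entries u x -> forall i j, c i != c j -> kappa x i j = 0.
  move=> [i [j ->]] [p q] [p' q'] cx; rewrite kf big1// => k _ /=.
  by move: cx; rewrite /c /J2 /=; case: p; case: q; case: p'; case: q'; rewrite //= ?mul0r ?mulr0.
have gen := @fund_generates R N G.
have r1 : affords F2 (V *m W) (fun a p q => kappa a (p, p) (q, q)).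
  split.
    apply: (rep_block (c := c) (b := false) (e := fun p => (p, p)) gen hk koff).
    - by move=> p q [].
    - by case.
    - by move=> [[] []] //= _; [exists true|exists false].
  move=> i j; apply/funext => p; apply/funext => q; rewrite kf mxE.
  by rewrite -J2_sum; apply: eq_bigr => k _; rewrite J2M.
have r2 : affords F2 (V *m conjm W) (fun a p q => kappa a (p, ~~ p) (q, ~~ q)).
  split.
    apply: (rep_block (c := c) (b := true) (e := fun p => (p, ~~ p)) gen hk koff).
    - by move=> p q [].
    - by case.
    - by move=> [[] []] //= _; [exists true|exists false].
  move=> i j; apply/funext => p; apply/funext => q; rewrite kf mxE.
  by rewrite -J2_sum; apply: eq_bigr => k _; rewrite J2_flip J2M mxE.
split; [by eexists; exact: r1|by eexists; exact: r2|].
move=> a K b d ab p q p' q'; rewrite -(kE _ _ _ _ ab (p, q) (p', q')).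
have [cx|cx] := boolP (p (+) q != p' (+) q').
  exact: (rep_off_block gen hk koff a (i := (p, q)) (j := (p', q')) cx).
rewrite (affords_uniq r1) (affords_uniq r2).
by move: cx; case: p; case: q; case: p'; case: q'.
Qed.

Lemma char_conv V W : afforded G J1 V -> afforded G J1 W ->
  afforded G J1 (V *m W) /\
  forall a (K : finType) (b c : K -> A), comult a = \sum_k tens (b k) (c k) ->
  \sum_k frep J1 V (b k) tt tt * frep J1 W (c k) tt tt = frep J1 (V *m W) a tt tt.
Proof.
move=> hV hW; have aV := frepP hV; have aW := frepP hW.
have [kappa hk kE] := rep_conv aV.1 aW.1 (char_tame aV.1) (char_tame aW.1).
have r1 : affords J1 (V *m W) (fun a p q => kappa a (p, p) (q, q)).
  split.
    apply: (rep_block (c := fun=> false) (b := false) (e := fun p => (p, p)) (@fund_generates R N G) hk) => //.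
    - by move=> p q [].
    - by move=> [[] []] _; exists tt.
  move=> i j; apply/funext => p; apply/funext => q.
  rewrite (kE _ _ _ _ (@comult_fund R N G i j)) /J1 mxE.
  by apply: eq_bigr => k _; rewrite aV.2 aW.2.
split; first by eexists; exact: r1.
by move=> a K b c ab; rewrite (affords_uniq r1) (kE _ _ _ _ ab).
Qed.

(** A character takes real values at the self-adjoint coordinates, and real multiples keep the shape
    of [J2]. *)
Lemma char_pair_conv V W : (forall i j, star (u i j) = u i j) ->
  afforded G J1 V -> afforded G F2 W -> afforded G F2 (V *m W).
Proof.
move=> sa hV hW; have aV := frepP hV; have aW := frepP hW.
have Vr i j : conjc (V i j) = V i j.
  have := rep_star aV.1 (u i j) tt tt; rewrite sa aV.2 /J1 => e.
  by rewrite -e.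
have [kappa hk kE] := rep_conv aV.1 aW.1 (char_tame aV.1) (pair_tame aW).
exists (fun a p q => kappa a (tt, p) (tt, q)); split.
  apply: (rep_block (c := fun=> false) (b := false) (e := fun p => (tt, p)) (@fund_generates R N G) hk) => //.
  - by move=> p q [].
  - by move=> [[] p] _; exists p.
move=> i j; apply/funext => p; apply/funext => q.
rewrite (kE _ _ _ _ (@comult_fund R N G i j)) mxE.
under eq_bigr do rewrite aV.2 aW.2 /J1 /=.
by rewrite -J2_sum; apply: eq_bigr => k _; rewrite J2_real.
Qed.

Lemma afforded_conj V : afforded G F2 V -> afforded G F2 (conjm V) /\
  forall (a : A) p q, frep F2 (conjm V) a p q = frep F2 V a (~~ p) (~~ q).
Proof.
move=> hV; have [hr hf] := frepP hV.
have h : affords F2 (conjm V) (fun (a : A) p q => frep F2 V a (~~ p) (~~ q)).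
  split; last first.
    by move=> i j; apply/funext => p; apply/funext => q; rewrite hf mxE J2_flip.
  split.
  - by move=> c a b p q; rewrite (repZD hr).
  - by move=> p q; rewrite (rep1 hr) (inj_eq negb_inj).
  - by move=> a b p q; rewrite (repM hr) !sum_bool addrC.
  - by move=> a p q; rewrite (rep_star hr).
by split; [eexists; exact: h|move=> a p q; rewrite (affords_uniq h)].
Qed.

End PairReps.

Lemma sum_unit (V : nmodType) (f : unit -> V) : \sum_q f q = f tt.
Proof. by rewrite (big_pred1 tt)//; case. Qed.

(** * The model of a closed quantum subgroup of the half-liberated orthogonal group *)

Section Ostar.
Variables (R : realType) (N : nat) (G : compactMatrixQuantumGroup R N).
Hypothesis hG : closed_subgroup_Ostar G.
Local Notation A := (cqg_alg G).
Local Notation C := R[i].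
Local Notation u := (fund G).
Local Notation F2 := (@J2 R).
Local Notation F1 := (@J1 R).
Implicit Types V W : 'M[C]_N.

Lemma morphismB (B D : cstarAlgType R) (f : B -> D) x y :
  cstar_morphism f -> f (x - y) = f x - f y.
Proof.
by case=> fl _ _ _; rewrite -scaleN1r addrC fl scaleN1r addrC.
Qed.

Lemma ostar_coordinates : (forall i j, star (u i j) = u i j) /\
  forall a b c, matrix_entries u a -> matrix_entries u b -> matrix_entries u c ->
    a * b * c = c * b * a.
Proof.
have [Q [w [q [[P [v [p [[_ [sa _] _] [mp _ ker] pw]]]] mq _ qw]]]] := hG.
have quw i j : u i j = q (p (v i j)) by rewrite pw qw.
have [_ _ pM ps] := mp; have [ql _ qM qs] := mq.
split=> [i j|_ _ _ [i1 [j1 ->]] [i2 [j2 ->]] [i3 [j3 ->]]].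
  by rewrite quw -qs -ps sa.
apply/eqP; rewrite -subr_eq0; apply/eqP; rewrite !quw -!qM -!pM.
rewrite -(morphismB _ _ mq) -(morphismB _ _ mp).
have -> : p (v i1 j1 * v i2 j2 * v i3 j3 - v i3 j3 * v i2 j2 * v i1 j1) = 0.
  apply/ker => I _; apply; exists (v i1 j1), (v i2 j2), (v i3 j3).
  by split=> //; [exists i1, j1|exists i2, j2|exists i3, j3].
by have := morphismB 0 0 mq; rewrite !subrr.
Qed.

Let U (k : 'I_N * 'I_N) : A := u k.1 k.2.

Let U_sa k : star (U k) = U k.
Proof. exact: ostar_coordinates.1. Qed.

Let U_hc i j k : U i * U j * U k = U k * U j * U i.
Proof. by apply: ostar_coordinates.2; eexists; eexists. Qed.

Let U_gen : cstar_generated (range U).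
Proof.
move=> T hT UT; apply: (@fund_generates R N G) => // _ [i [j ->]].
by apply: UT; exists (i, j).
Qed.

Let U_sum (i : 'I_N * 'I_N) : exists s : seq ('I_N * 'I_N), \sum_(j <- s) U j * U j = 1.
Proof.
exists [seq (i.1, k) | k <- enum 'I_N]; rewrite big_map big_enum /=.
transitivity ((i.1 == i.1)%:R : A); last by rewrite eqxx.
rewrite -fund_row; by apply: eq_bigr => k _; rewrite /U /= ostar_coordinates.1.
Qed.

Lemma ostar_characters_or_pairs (a : A) : a != 0 ->
  (exists2 V, afforded G F1 V & frep F1 V a tt tt != 0) \/
  (exists2 V, afforded G F2 V & exists p q, frep F2 V a p q != 0).
Proof.
move=> /(enough_reps U_sa U_hc U_gen U_sum)[[rho hr ra]|[rho [v [hr rv _ [p [q ra]]]]]].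
  have h : affords F1 (\matrix_(i, j) rho (u i j) tt tt) rho.
    split=> // i j; apply/funext => -[]; apply/funext => -[].
    by rewrite /J1 mxE.
  left; exists (\matrix_(i, j) rho (u i j) tt tt); first by exists rho.
  by rewrite (affords_uniq h).
have h : affords F2 (\matrix_(i, j) v (i, j)) rho.
  by split=> // i j; rewrite mxE -(rv (i, j)).
right; exists (\matrix_(i, j) v (i, j)); first by exists rho.
by exists p, q; rewrite (affords_uniq h).
Qed.

Section PairCase.
Variable V0 : 'M[C]_N.
Hypothesis hV0 : afforded G F2 V0.

(** The counit only gives a character at the matrix 1; a pair representation there is the
    convolution of the given one with its composition with the antipode. *)
Let aff1 : afforded G F2 1%:M.
Proof.
rewrite -(afforded_unitary (@J2_row R) hV0).
by case: (pair_conv hV0 (afforded_adj (@J2_conj R) hV0)).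
Qed.

Let affM V W : afforded G F2 V -> afforded G F2 W -> afforded G F2 (V *m W).
Proof. by move=> hV hW; case: (pair_conv hV hW). Qed.

Let H := family_group (@J2_conj R) (@J2_close R) (@J2_row R) aff1 affM.
Let mx (x : og H) : 'M[C]_N := fmx x.

Let haff x : afforded G F2 (mx x). Proof. exact: fmx_afforded. Qed.

Lemma pair_case_model : exists (H : topologicalGroupType) (mu : probability (borel H) R)
         (pi : A -> 'M[CH R H]_2),
    compact_Lie_group R H /\ haar_probability mu /\
    model_morphism pi /\ injective pi /\
    (forall h : A -> complex R,
       haar_state h <-> (forall a, h a = trace_integral mu (pi a))).
Proof.
apply: (@stationary_model R N G _ H (fun a x => frep F2 (mx x) a)).
- by move=> x; exact: frep_rep.
- by move=> a p q; exact: frep_cont.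
- move=> a a0; apply: contrapT => /eqP /ostar_characters_or_pairs[[V hV]|[V hV [p [q]]]]; last first.
    by have [x <-] := fmx_ex (@J2_conj R) (@J2_close R) (@J2_row R) aff1 affM hV; rewrite a0 eqxx.
  (* A character V is seen by the pairs: V = (V V0) V0^* is a product of matrices of pair
     representations. Since V is real, its pair representation splits with phase 1 and the character
     is one of the two summands. *)
  have hV2 : afforded G F2 V.
    rewrite -[V]mulmx1 -(afforded_unitary (@J2_row R) hV0) mulmxA.
    apply: affM; last exact: (afforded_adj (@J2_conj R) hV0).
    exact: (char_pair_conv ostar_coordinates.1 hV hV0).
  have Vr i j : conjc (V i j) = V i j.
    have [hr hf] := frepP hV.
    have := rep_star hr (u i j) tt tt; rewrite ostar_coordinates.1 hf /J1 => e.
    by rewrite -e.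
  have [||h1 _] := @afforded_real_line R N G V _ 1 (frepP hV2).
  + by rewrite conjc1 mulr1.
  + by move=> i j; rewrite mul1r.
  rewrite scale1r in h1; rewrite (affords_uniq h1) mul1r.
  have [x <-] := fmx_ex (@J2_conj R) (@J2_close R) (@J2_row R) aff1 affM hV2.
  by rewrite !a0 addr0 eqxx.
- move=> y r.
  have [y' hy'] := fmx_ex (@J2_conj R) (@J2_close R) (@J2_row R) aff1 affM (afforded_conj (haff y)).1.
  (* For p equal to the index r of the second leg the even summand x y appears, and for the other p
     the odd summand x (conj y), which is translation by y'. *)
  exists (fun p => if p == r then y else y') => a K b c ab x s.
  have [_ _ conv] := pair_conv (haff x) (haff y).
  under eq_bigr do rewrite mulr_suml.
  rewrite exchange_big mulr_sumr; apply: eq_bigr => p _ /=.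
  rewrite (conv a K b c ab p r p s) (inj_eq (@addbI p)).
  have [->|_] := eqVneq r s; last by rewrite mul0r.
  by rewrite mul1r; case: eqVneq => _; rewrite /mx fmxM ?hy'.
- move=> y r.
  have [y' hy'] := fmx_ex (@J2_conj R) (@J2_close R) (@J2_row R) aff1 affM (afforded_conj (haff y)).1.
  exists (fun p => if p == r then y else y') => a K b c ab x s.
  have [_ hyx conv] := pair_conv (haff y) (haff x).
  under eq_bigr do rewrite mulrC mulr_sumr.
  rewrite exchange_big mulr_sumr; apply: eq_bigr => p _ /=.
  rewrite (conv a K b c ab r p s p) (inj_eq (@addIb p)).
  have [<-|_] := eqVneq r s; last by rewrite mul0r.
  rewrite mul1r eq_sym; have [->|pr] := eqVneq p r; rewrite /mx fmxM//.
  (* The odd summand is now y (conj x) at the index r. Conjugation of the matrix flips the index, so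
     this is the entry of (conj y) x at p, a left translate of x by y'. *)
  have [_ e] := afforded_conj hyx; rewrite hy'.
  have -> : r = ~~ p by move: pr; case: (p); case: (r).
  by rewrite -e conjmM conjmK.
Qed.

End PairCase.

Section CharacterCase.
Hypothesis no_pair : forall V, ~ afforded G F2 V.

Let F1_conj (z : C) p q : F1 (conjc z) p q = conjc (F1 z p q). Proof. by []. Qed.

Let F1_close (z w : C) p q : cn (F1 z p q - F1 w p q) <= cn (z - w).
Proof. by []. Qed.

Let F1_row (z w : C) : \sum_q F1 z tt q * conjc (F1 w tt q) = z * conjc w.
Proof. by rewrite sum_unit. Qed.

Let aff1 : afforded G F1 1%:M.
Proof.
have [el e1 eM es] := counit_character G.
exists (fun a _ _ => counit a); split.
  split => //.
  - by move=> c a b _ _; rewrite el.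
  - by move=> a b _ _; rewrite sum_unit eM.
by move=> i j; apply/funext => p; apply/funext => q; rewrite counit_fund /J1 mxE.
Qed.

Let affM V W : afforded G F1 V -> afforded G F1 W -> afforded G F1 (V *m W).
Proof. by move=> hV hW; case: (char_conv hV hW). Qed.

Let H := family_group F1_conj F1_close F1_row aff1 affM.
Let mx (x : og H) : 'M[C]_N := fmx x.

Let haff x : afforded G F1 (mx x). Proof. exact: fmx_afforded. Qed.

Lemma character_case_model : exists (H : topologicalGroupType) (mu : probability (borel H) R)
         (pi : A -> 'M[CH R H]_2),
    compact_Lie_group R H /\ haar_probability mu /\
    model_morphism pi /\ injective pi /\
    (forall h : A -> complex R,
       haar_state h <-> (forall a, h a = trace_integral mu (pi a))).
Proof.
have rx x := frep_rep (haff x).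
have conv x y : forall a (K : finType) (b c : K -> A), comult a = \sum_k tens (b k) (c k) ->
    \sum_k frep F1 (mx x) (b k) tt tt * frep F1 (mx y) (c k) tt tt = frep F1 (mx (x * y)%g) a tt tt.
  by move=> a K b c ab; rewrite /mx fmxM; case: (char_conv (haff x) (haff y)) => _; exact.
(* The character sits on both diagonal entries, so that the normalized trace returns it. *)
apply: (@stationary_model R N G _ H (fun a x p q => (p == q)%:R * frep F1 (mx x) a tt tt)).
- move=> x; split.
  + by move=> c a b p q; rewrite (repZD (rx x)); ring.
  + by move=> p q; rewrite (rep1 (rx x)) mulr1.
  + move=> a b p q; rewrite (repM (rx x)) sum_unit sum_bool.
    by case: p; case: q; rewrite /= ?mul1r ?mul0r ?addr0 ?add0r ?mulr0.
  + by move=> a p q; rewrite (rep_star (rx x)) rmorphM rmorph_nat eq_sym.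
- move=> a p q; apply: ccontM; first exact: ccont_cst.
  exact: frep_cont.
- move=> a a0; apply: contrapT => /eqP /ostar_characters_or_pairs[[V hV]|[V /no_pair//]].
  have [x <-] := fmx_ex F1_conj F1_close F1_row aff1 affM hV.
  by have := a0 x true true; rewrite mul1r => ->; rewrite eqxx.
- move=> y r; exists (fun=> y) => a K b c ab x s.
  rewrite sum_bool !eqxx !mul1r -(conv x y a K b c ab) mulrDr mulr_sumr -big_split.
  by apply: eq_bigr => k _; rewrite sum_bool !eqxx /=; ring.
- move=> y r; exists (fun=> y) => a K b c ab x s.
  rewrite sum_bool !eqxx !mul1r -(conv y x a K b c ab) mulrDr mulr_sumr -big_split.
  by apply: eq_bigr => k _; rewrite sum_bool !eqxx /=; ring.
Qed.

End CharacterCase.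
End Ostar.

Theorem theorem2p4 (R : realType) (N : nat) (G : compactMatrixQuantumGroup R N) :
  closed_subgroup_Ostar G ->
  exists (H : topologicalGroupType) (mu : probability (borel H) R)
         (pi : cqg_alg G -> 'M[CH R H]_2),
    compact_Lie_group R H /\ haar_probability mu /\
    model_morphism pi /\ injective pi /\
    (forall h : cqg_alg G -> complex R,
       haar_state h <-> (forall a, h a = trace_integral mu (pi a))).
Proof.
move=> hG; have [[V hV]|no] := pselect (exists V, afforded G (@J2 R) V).
  exact: pair_case_model hG _ hV.
by apply: character_case_model => // V hV; apply: no; exists V.
Qed.
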